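(* For each $j \in \mathbb{N}$, define the dyadic Fourier partial sum operator acting on trigonometric polynomials $f \in \mathcal{P}$ by $$S_j f := \sum_{|\lambda_n| \le 2^j} \widehat{f}(\lambda_n) e^{i\lambda_n \cdot},$$ with corresponding maximal operator $S^{*}f := \sup_{j \in \mathbb{N}} |S_j f|$. Then for each $k \in \mathbb{N}$, the operator $S^{*}$ extends to the class of all functions $f \in S^{2^k}$ that satisfy the separation condition, and it satisfies the bound $$\| S^{*} f \|_{S^{2^k}} \le C \, \| f \|_{S^{2^k}}$$ for all such $f$, where the constant $C$ depends on $f$ only through $\alpha_f$ (and may depend on $k$).
   Context: $\mathbb{N} = \{1,2,3,\dots\}$. $\mathcal{P}$ is the space of trigonometric polynomials on $\mathbb{R}$, i.e. finite sums $\sum_{n=-N}^{N} c_n e^{i\lambda_n \cdot}$ with $c_n \in \mathbb{C}$, $\lambda_n \in \mathbb{R}$. For $p \in [1,\infty)$ and a measurable function $f$ on $\mathbb{R}$, the Stepanov norm is $$\|f\|_{S^p} := \Big( \sup_{x \in \mathbb{R}} \int_x^{x+1} |f(s)|^p \, ds \Big)^{1/p},$$ and the Stepanov space $S^p$ is the completion of $\mathcal{P}$ with respect to this norm (a space of functions in $L^p_{\mathrm{loc}}(\mathbb{R})$, identified up to a.e. equality). For $f \in S^p$ and $\lambda \in \mathbb{R}$, the Fourier coefficient is $\widehat{f}(\lambda) := \lim_{T \to \infty} \frac{1}{2T} \int_{-T}^{T} f(x) e^{-i\lambda x} \, dx$; it is non-zero for only countably many $\lambda$. The Fourier exponents $(\lambda_n)$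 of $f$ are the strictly increasing enumeration, with $\lambda_{-n} = -\lambda_n$ (so $\lambda_0 = 0$), of the symmetric set $$\Lambda_f := \{0\} \cup \{\lambda \in \mathbb{R} : \widehat{f}(\lambda) \ne 0 \text{ or } \widehat{f}(-\lambda) \neq 0\}$$ (a finite enumeration if $\Lambda_f$ is finite). The function $f$ satisfies the separation condition if there exists $\alpha > 0$ such that $\lambda_{n+1} - \lambda_n > \alpha$ for all consecutive exponents; $\alpha_f$ denotes the supremum of all such $\alpha$ (with $\alpha_f = +\infty$ if $\Lambda_f = \{0\}$). For $f$ satisfying the separation condition, the sum defining $S_j f$ has finitely many terms, so that $S_j f$ and $S^{*} f$ are given by the same formulas. *)

(* Defs.v *)
From HB Require Import structures.
From mathcomp Require Import all_boot all_order all_algebra.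
From mathcomp Require Import all_classical all_reals all_analysis.
From mathcomp Require Import complex.

Set Implicit Arguments.
Unset Strict Implicit.
Unset Printing Implicit Defensive.

Import Order.TTheory GRing.Theory Num.Theory.
Import numFieldNormedType.Exports.

Local Open Scope classical_set_scope.
Local Open Scope ring_scope.
Local Open Scope complex_scope.

Definition cmod (R : realType) (z : R[i]) : R := ComplexField.Normc.normc z.

Definition cis (R : realType) (t : R) : R[i] := cos t +i* sin t.

Definition trig_poly (R : realType) (f : R -> R[i]) : Prop :=
  exists (N : nat) (c : 'I_N -> R[i]) (lam : 'I_N -> R),
    forall x, f x = \sum_(n < N) c n * cis (lam n * x).

(* Defined on extended-real-valued functions because a maximal function is a
   supremum that may be infinite; a complex function [f] is measured through
   its modulus. *)
Definition stepanov_enorm (R : realType) (p : R) (g : R -> \bar R) : \bar R :=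
  (ereal_sup [set \int[lebesgue_measure]_(s in `[x, (x + 1)%R]) (`|g s| `^ p)
             | x in [set: R]] `^ p^-1)%E.

Definition stepanov_norm (R : realType) (p : R) (f : R -> R[i]) : \bar R :=
  stepanov_enorm p (fun s => (cmod (f s))%:E).

Definition cmeasurable (R : realType) (f : R -> R[i]) : Prop :=
  measurable_fun [set: R] (fun x => complex.Re (f x)) /\
  measurable_fun [set: R] (fun x => complex.Im (f x)).

(* The completion of the trigonometric polynomials, realised as their closure
   among measurable functions.  Elements are representatives: every notion
   below is invariant under almost-everywhere equality of [f]. *)
Definition stepanov_space (R : realType) (p : R) (f : R -> R[i]) : Prop :=
  cmeasurable f /\
  forall e : R, 0 < e ->
    exists2 P : R -> R[i], trig_poly P &
      (stepanov_norm p (fun x => (f x - P x)%R) < e%:E)%E.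

Definition cintegral (R : realType) (D : set R) (f : R -> R[i]) : R[i] :=
  (\int[lebesgue_measure]_(x in D) complex.Re (f x)) +i*
  (\int[lebesgue_measure]_(x in D) complex.Im (f x)).

(* [R[i]^o] is [R[i]] with the topology of its modulus. *)
Definition fourier_mean (R : realType) (f : R -> R[i]) (l T : R) : R[i]^o :=
  ((2 * T)^-1)%:C * cintegral `[- T, T] (fun x => f x * cis (- (l * x))).

Definition fourier_coef (R : realType) (f : R -> R[i]) (l : R) : R[i] :=
  lim (fourier_mean f l T @[T --> +oo]).

Definition exponents (R : realType) (f : R -> R[i]) : set R :=
  [set 0] `|` [set l | fourier_coef f l != 0 \/ fourier_coef f (- l) != 0].

(* [D] is the index set of the enumeration: all integers, or -N, ..., N when
   there are finitely many exponents. *)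
Definition exponent_enumeration (R : realType) (f : R -> R[i])
    (D : set int) (lam : int -> R) : Prop :=
  [/\ D = [set: int] \/ exists N : nat, D = [set n : int | `|n| <= N%:Z],
      forall m n, D m -> D n -> m < n -> lam m < lam n,
      forall n, D n -> lam (- n) = - lam n
    & lam @` D = exponents f].

Definition separated_by (R : realType) (f : R -> R[i]) (a : R) : Prop :=
  exists (D : set int) (lam : int -> R),
    exponent_enumeration f D lam /\
    forall n, D n -> D (n + 1) -> a < lam (n + 1) - lam n.

Definition separation_condition (R : realType) (f : R -> R[i]) : Prop :=
  exists2 a : R, 0 < a & separated_by f a.

Definition separation_constant (R : realType) (f : R -> R[i]) : \bar R :=
  ereal_sup [set a%:E | a in [set a : R | 0 < a /\ separated_by f a]].

Definition dyadic_exponents (R : realType) (f : R -> R[i]) (j : nat) : set R :=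
  exponents f `&` [set l | `|l| <= 2 ^+ j].

(* The finitely supported sum [\sum_(l \in A)] is 0 by convention when
   infinitely many terms are nonzero. *)
Definition dyadic_sum (R : realType) (j : nat) (f : R -> R[i]) (x : R) : R[i] :=
  \sum_(l \in dyadic_exponents f j) (fourier_coef f l * cis (l * x)).

Definition dyadic_maximal (R : realType) (f : R -> R[i]) (x : R) : \bar R :=
  ereal_sup [set (cmod (dyadic_sum j f x))%:E | j in [set j : nat | (0 < j)%N]].

(* Main.v *)
(* For a trigonometric polynomial with frequencies [delta] apart, the sharp cut-off at [2^j] is compared
   with the averages [W a = (1 - D^2 / a^2)^-1] at [a = 2^j].  A combination of two consecutive averages is
   controlled by a maximal inequality; the rest is a multiplier of bounded variation applied to a
   Littlewood-Paley piece [h_j].  Both the maximal inequality and the square function estimate for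
   [(\sum_j |h_j|^2)^q], [2 q = 2^k], are obtained in a space weighted by a slowly varying function, from
   integration by parts alone.  Summation by parts over the frequencies reduces the multiplier to the
   partial sums of the [h_j].  Since the frequencies are separated, each partial sum is a Riesz projection
   with respect to a band-limited weight [w]: if [F = a + conj b] with the spectra of [a] and [b] in
   [[delta / 2, +oo)], then [(- a * b)^q] has [w]-integral zero while [- a * b = |b|^2 - F * b], so that
   [|b|^(2 q)] is dominated by [|F|^(2 q)] in the mean.

   A general [f] is replaced by its Bochner-Fejer polynomials.  Their frequencies are exponents of [f], hence
   separated; their Stepanov norms are bounded by a multiple of that of [f]; and their coefficients at any finite set of
   exponents converge to those of [f].  Monotone convergence in the number of dyadic scales concludes. *)
Require Import Defs.
From HB Require Import structures.
From mathcomp Require Import all_boot all_order all_algebra.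
From mathcomp Require Import all_classical all_reals all_analysis.
From mathcomp Require Import measurable_realfun.
From mathcomp Require Import complex.
From mathcomp Require Import ring lra.

Set Implicit Arguments.
Unset Strict Implicit.
Unset Printing Implicit Defensive.

Import Order.TTheory GRing.Theory Num.Theory.
Import numFieldNormedType.Exports.

Local Open Scope classical_set_scope.
Local Open Scope ring_scope.
Local Open Scope complex_scope.

(** * Derivatives and primitives on the line *)

Section Calculus.
Variable R : realType.
Implicit Types (f g h P : R -> R) (x y a c : R).

(** The exponents [2 ^ k] are used twice: the maximal inequality climbs from exponent 2 by squaring
    and Jensen, and [|b| ^ (2 * q)] is a polynomial in [b] and its conjugate, so analyticity alone
    controls its mean. The Stepanov norm is a supremum of local integrals and a trigonometric sum is
    not integrable on the line, so estimates are proved against an integrable weight [om] centred at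
    any point. A derivative then has a small mean instead of a zero one, and the error is absorbed
    because all rates [2 ^ j] are at least 1. The Riesz projection rests on a mean that vanishes
    exactly; this forces a second weight, whose spectrum fits into the gaps between the frequencies.
    Comparing the two weights costs a factor of order [delta ^- 2], and this is how the separation
    enters the constant. The polynomials that approximate [f] in the Stepanov norm may have
    frequencies arbitrarily close together, so the bound for separated polynomials says nothing
    about them; hence the passage through Bochner-Fejer polynomials. Their kernel is a product over
    the finite set of exponents concerned, and it is normalised by its mean [b0], which depends on
    the arithmetic relations between these exponents. *)

Definition deriv_of f f' := forall x, is_derive x (1 : R) f (f' x).

Lemma deriv_ext f f' g g' : f =1 g -> f' =1 g' -> deriv_of f f' -> deriv_of g g'.
Proof.
move=> /funext <- e d x; rewrite -e; exact: d.
Qed.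

Lemma deriv_cst c : deriv_of (fun=> c) (fun=> 0).
Proof. by move=> x; exact: is_derive_cst. Qed.

Lemma deriv_id : deriv_of id (fun=> 1).
Proof. by move=> x; exact: is_derive_id. Qed.

Lemma deriv_add f f' g g' : deriv_of f f' -> deriv_of g g' ->
  deriv_of (fun x => f x + g x) (fun x => f' x + g' x).
Proof. by move=> df dg x; have := df x; have := dg x => ? ?; exact: is_deriveD. Qed.

Lemma deriv_opp f f' : deriv_of f f' -> deriv_of (fun x => - f x) (fun x => - f' x).
Proof. by move=> df x; have := df x => ?; exact: is_deriveN. Qed.

Lemma deriv_sub f f' g g' : deriv_of f f' -> deriv_of g g' ->
  deriv_of (fun x => f x - g x) (fun x => f' x - g' x).
Proof. by move=> df dg; apply: deriv_add => //; exact: deriv_opp. Qed.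

Lemma deriv_mul f f' g g' : deriv_of f f' -> deriv_of g g' ->
  deriv_of (fun x => f x * g x) (fun x => f' x * g x + f x * g' x).
Proof.
move=> df dg x; have := df x; have := dg x => ? ?.
apply: is_derive_eq; rewrite addrC [X in _ = X + _]mulrC; reflexivity.
Qed.

Lemma deriv_scale c f f' : deriv_of f f' -> deriv_of (fun x => c * f x) (fun x => c * f' x).
Proof.
move=> df; apply: deriv_ext (deriv_mul (deriv_cst c) df) => // x.
by rewrite mul0r add0r.
Qed.

Lemma deriv_comp f f' g g' : deriv_of f f' -> deriv_of g g' ->
  deriv_of (fun x => f (g x)) (fun x => g' x * f' (g x)).
Proof.
move=> df dg x; have := df (g x); have := dg x => ? ?.
by apply: is_derive_eq; rewrite mulrC.
Qed.

Lemma deriv_lin a c : deriv_of (fun x => a * x + c) (fun=> a).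
Proof.
apply: deriv_ext (deriv_add (deriv_scale a deriv_id) (deriv_cst c)) => // x.
by rewrite mulr1 addr0.
Qed.

Lemma deriv_compl f f' a c : deriv_of f f' ->
  deriv_of (fun x => f (a * x + c)) (fun x => a * f' (a * x + c)).
Proof. by move=> df; apply: (deriv_comp df (deriv_lin a c)). Qed.

Lemma deriv_expr f f' n : deriv_of f f' ->
  deriv_of (fun x => f x ^+ n) (fun x => n%:R * f x ^+ n.-1 * f' x).
Proof.
move=> df; elim: n => [|n ih].
  by apply: deriv_ext (deriv_cst 1) => // x; rewrite !mul0r.
apply: deriv_ext (deriv_mul df ih) => x; first by rewrite exprS.
case: n {ih} => [|n] /=; first by rewrite !mul0r mulr0 addr0 !expr0 mulr1 !mul1r.
by rewrite (exprS _ n) -[n.+2%:R]natr1; ring.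
Qed.

Lemma deriv_expRM a : deriv_of (fun x => expR (a * x)) (fun x => a * expR (a * x)).
Proof.
have d : deriv_of expR expR by move=> x; exact: is_derive_expR.
by apply: deriv_ext (deriv_compl a 0 d) => x; rewrite addr0.
Qed.

Lemma deriv_cos a : deriv_of (fun x => cos (a * x)) (fun x => - a * sin (a * x)).
Proof.
have d : deriv_of cos (fun x => - sin x) by move=> x; exact: is_derive_cos.
by apply: deriv_ext (deriv_compl a 0 d) => x; rewrite addr0 ?mulrN ?mulNr.
Qed.

Lemma deriv_sin a : deriv_of (fun x => sin (a * x)) (fun x => a * cos (a * x)).
Proof.
have d : deriv_of sin cos by move=> x; exact: is_derive_sin.
by apply: deriv_ext (deriv_compl a 0 d) => x; rewrite addr0.
Qed.

Lemma deriv_inv f f' : deriv_of f f' -> (forall x, f x != 0) ->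
  deriv_of (fun x => (f x)^-1) (fun x => - (f x) ^- 2 * f' x).
Proof. by move=> df f0 x; have := df x => ?; exact: is_deriveV. Qed.

Lemma deriv_sum (I : Type) (r : seq I) (Pr : pred I) (f f' : I -> R -> R) :
  (forall i, deriv_of (f i) (f' i)) ->
  deriv_of (fun x => \sum_(i <- r | Pr i) f i x) (fun x => \sum_(i <- r | Pr i) f' i x).
Proof.
move=> df; elim: r => [|i r ih].
  by apply: deriv_ext (deriv_cst 0) => x; rewrite big_nil.
case Pi: (Pr i); last by apply: deriv_ext ih => x; rewrite big_cons Pi.
by apply: deriv_ext (deriv_add (df i) ih) => x; rewrite big_cons Pi.
Qed.

Lemma deriv_continuous f f' : deriv_of f f' -> continuous f.
Proof.
move=> df x; apply/differentiable_continuous/derivable1_diffP.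
by case: (df x).
Qed.

Lemma contM f g : continuous f -> continuous g -> continuous (fun x => f x * g x).
Proof. by move=> cf cg x; apply: continuousM; [exact: cf|exact: cg]. Qed.

Lemma deriv0_cst f x y : deriv_of f (fun=> 0) -> f x = f y.
Proof. by move=> df; apply: is_derive_0_is_cst. Qed.

Lemma deriv_eq f g f' x y : deriv_of f f' -> deriv_of g f' -> f x - f y = g x - g y.
Proof.
move=> df dg; have d : deriv_of (fun x => f x - g x) (fun=> 0).
  by apply: deriv_ext (deriv_sub df dg) => // z; rewrite subrr.
have := deriv0_cst x y d => e; lra.
Qed.

Lemma deriv_ge0_homo f f' x y : deriv_of f f' -> x <= y ->
  (forall z, x <= z <= y -> 0 <= f' z) -> f x <= f y.
Proof.
move=> df xy f0; rewrite -subr_ge0.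
have [||z zxy ->] := @MVT_segment R f f' x y xy.
- by move=> z _; exact: df.
- by apply: continuous_subspaceT; exact: deriv_continuous df.
by rewrite mulr_ge0 ?subr_ge0// f0//; move: zxy; rewrite in_itv.
Qed.

End Calculus.

Section Primitive.
Variable R : realType.
Notation mu := (@lebesgue_measure R).
Implicit Types (f g h P : R -> R) (x y a c : R).

Lemma continuous_itv_integrable h x y : continuous h -> mu.-integrable `[x, y] (EFin \o h).
Proof.
move=> ch; apply: continuous_compact_integrable; first exact: segment_compact.
exact: continuous_subspaceT.
Qed.

Let base h (n : nat) (x : R) : R := \int[mu]_(t in `[- n%:R, x]) h t.

Let base_shift h (m n : nat) x : continuous h -> (n <= m)%N -> - n%:R <= x ->
  base h m x = base h m (- n%:R) + base h n x.
Proof.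
move=> ch nm nx; rewrite /base.
have i1 := continuous_itv_integrable (- m%:R) x ch.
have := Rintegral_itvB (x := - n%:R) i1; rewrite !bnd_simp lerN2 ler_nat.
move=> /(_ nm nx); rewrite Rintegral_itv_obnd_cbnd => [<-|].
  by rewrite addrC subrK.
apply: integrableS (continuous_itv_integrable (- n%:R) x ch) => //.
exact: subset_itv_oc_cc.
Qed.

(** The integrals from [- n] for different [n] differ by constants, so normalising them at [0] glues
    them into one primitive on the whole line; near a given point a single [n] serves. *)
Lemma prim_ex h : continuous h -> exists P, deriv_of P h /\ P 0 = 0.
Proof.
move=> ch; pose N (x : R) := (Num.truncn `|x|).+1.
pose P x := base h (N x) x - base h (N x) 0.
exists P; split; last by rewrite /P subrr.
have PE m x : `|x| < m%:R -> P x = base h m x - base h m 0.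
  move=> xm; have Nm : (N x <= m)%N.
    by rewrite /N truncn_lt_nat.
  have xN : `|x| < (N x)%:R by rewrite truncnS_gt.
  rewrite (base_shift ch Nm) 1?(base_shift (x := 0) ch Nm) /P.
  - by rewrite opprD addrACA subrr add0r.
  - by rewrite lerNl oppr0.
  - by rewrite lerNl (le_trans (ler_norm _))// normrN ltW.
move=> x; pose m := (N x).+1.
have xm : `|x| < m%:R by rewrite (lt_trans (truncnS_gt _))// ltr_nat.
have [dF dFE] : derivable (base h m) x 1 /\ derive1 (base h m) x = h x.
  apply: (@continuous_FTC1_closed R h (- m%:R) x (x + 1)).
  - by rewrite ltrDl.
  - exact: continuous_itv_integrable.
  - by rewrite ltrNl (le_lt_trans (ler_norm _))// normrN.
  - exact: ch.
have dG : is_derive x (1 : R) (fun y => base h m y - base h m 0) (h x).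
  have : is_derive x (1 : R) (base h m) (h x).
    by apply: DeriveDef; [exact: dF|rewrite -derive1E; exact: dFE].
  move=> d; have := deriv_cst (base h m 0) x => d2.
  by apply: is_derive_eq; rewrite subr0.
apply: near_eq_is_derive dG.
have : \forall y \near x, `|y| < m%:R.
  have /cvgr_lt : `|y| @[y --> x] --> `|x| by apply: cvg_norm; exact: cvg_id.
  exact.
by apply: filterS => y /PE->.
Qed.

(* Junk unless [h] is continuous: [get] then picks the primitive vanishing at [0]. *)
Definition prim h : R -> R := get [set P | deriv_of P h /\ P 0 = 0].

Let primP h : continuous h -> deriv_of (prim h) h /\ prim h 0 = 0.
Proof.
move=> /prim_ex[P hP]; suff : [set P | deriv_of P h /\ P 0 = 0] (prim h) by [].
by apply: getPex; exists P.
Qed.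

Lemma prim_deriv h : continuous h -> deriv_of (prim h) h.
Proof. by move=> /primP[]. Qed.

Lemma prim0 h : continuous h -> prim h 0 = 0.
Proof. by move=> /primP[]. Qed.

Lemma Rintegral_deriv h P x y : continuous h -> deriv_of P h -> x <= y ->
  \int[mu]_(t in `[x, y]) h t = P y - P x.
Proof.
move=> ch dP; rewrite le_eqVlt => /predU1P[<-|xy].
  by rewrite set_itv1 Rintegral_set1 subrr.
rewrite /Rintegral (@continuous_FTC2 _ h P x y xy) //.
- exact: continuous_subspaceT.
- have cP := deriv_continuous dP; split.
  + by move=> z _; case: (dP z).
  + exact/cvg_at_right_filter/cP.
  + exact/cvg_at_left_filter/cP.
- by move=> z _; rewrite derive1E; case: (dP z).
Qed.

End Primitive.

(** * Integrals of functions of quadratic decay *)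

Section IntegralR.
Variable R : realType.
Implicit Types (f g h P K : R -> R) (x y a c C : R).

Definition dominated h := continuous h /\ exists C : R, forall x, `|h x| <= C * (1 + x ^+ 2)^-1.

(** Integrals over the line are limits of symmetric increments of a primitive. Linearity,
    monotonicity and integration by parts then reduce to facts about derivatives, and Lebesgue
    integrals are met again only in the local norms and the Fourier means. *)
Definition intR h : R := lim ((prim h n%:R - prim h (- n%:R)) @[n --> \oo]).

Lemma sqr1_gt0 x : 0 < 1 + x ^+ 2.
Proof. by rewrite ltr_wpDr ?sqr_ge0. Qed.

Lemma deriv_atan : deriv_of (@atan R) (fun x => (1 + x ^+ 2)^-1).
Proof. by move=> x; exact: is_derive1_atan. Qed.

Lemma deriv_diff_le f f' g g' x y : deriv_of f f' -> deriv_of g g' -> x <= y ->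
  (forall z, x <= z <= y -> f' z <= g' z) -> f y - f x <= g y - g x.
Proof.
move=> df dg xy fg; have := deriv_ge0_homo (deriv_sub dg df) xy.
by move=> /(_ (fun z hz => ltac:(rewrite subr_ge0; exact: fg))); lra.
Qed.

Let sq P (n : nat) := P n%:R - P (- n%:R).

Let cvg_pos h P C : deriv_of P h -> (forall x, 0 <= h x) ->
  (forall x, h x <= C * (1 + x ^+ 2)^-1) -> cvgn (sq P).
Proof.
move=> dP h0 hC.
have Ph x y : x <= y -> P x <= P y.
  by move=> xy; apply: deriv_ge0_homo dP xy _.
apply: nondecreasing_is_cvgn.
  move=> m n mn; rewrite /sq lerB ?Ph ?lerN2 ?ler_nat//.
exists (C * pi) => _ [n _ <-].
have n0 : (- n%:R : R) <= n%:R by apply: (@le_trans _ _ 0); rewrite ?oppr_le0 ler0n.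
have h1 := deriv_diff_le dP (deriv_scale C deriv_atan) n0 (fun z _ => hC z).
apply: (le_trans h1).
rewrite -mulrBr ler_wpM2l//.
  by have := le_trans (h0 0) (hC 0); rewrite expr0n/= addr0 invr1 mulr1.
have := @atan_gtNpi2 R (- n%:R); have := @atan_ltpi2 R n%:R; lra.
Qed.

Let sqE P Q h : deriv_of P h -> deriv_of Q h -> sq P = sq Q.
Proof. by move=> dP dQ; apply/funext => n; apply: deriv_eq dP dQ. Qed.

Let cvg_dom h P : deriv_of P h -> dominated h -> cvgn (sq P).
Proof.
move=> dP [_ [C hC]].
have C0 : 0 <= C.
  by have := le_trans (normr_ge0 _) (hC 0); rewrite expr0n/= addr0 invr1 mulr1.
have dA := deriv_scale C deriv_atan.
have i0 x : 0 <= C * (1 + x ^+ 2)^-1 by rewrite mulr_ge0// invr_ge0 ltW// sqr1_gt0.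
(* Adding [C * atan] makes the derivative nonnegative and at most twice the bound, so [P] is a
   difference of two functions whose symmetric increments are monotone and bounded. *)
have h1 : cvgn (sq (fun x => P x + C * atan x)).
  apply: (@cvg_pos _ _ (2 * C) (deriv_add dP dA)) => x; have := hC x; rewrite ler_norml; lra.
have h2 : cvgn (sq (fun x => C * atan x)).
  apply: (@cvg_pos _ _ C dA) => x //.
have -> : sq P = (fun n => sq (fun x => P x + C * atan x) n - sq (fun x => C * atan x) n).
  by apply/funext => n; rewrite /sq; ring.
exact: is_cvgB.
Qed.

Lemma intR_cvg h P : deriv_of P h -> dominated h ->
  (fun n : nat => P n%:R - P (- n%:R)) @ \oo --> intR h.
Proof.
move=> dP dh; have [ch _] := dh.
have e := sqE dP (prim_deriv ch); rewrite -/(sq P) e.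
by apply: cvg_dom dh; exact: prim_deriv.
Qed.

Lemma intR_unique h P l : deriv_of P h -> dominated h ->
  (fun n : nat => P n%:R - P (- n%:R)) @ \oo --> l -> intR h = l.
Proof. by move=> dP dh; apply: cvg_unique => //; exact: intR_cvg. Qed.

Lemma eq_intR g h : g =1 h -> intR g = intR h.
Proof. by move=> /funext ->. Qed.

Lemma dominated_add g h : dominated g -> dominated h -> dominated (fun x => g x + h x).
Proof.
move=> [cg [C hC]] [ch [D hD]]; split.
  by move=> x; apply: continuousD; [exact: cg|exact: ch].
by exists (C + D) => x; rewrite mulrDl (le_trans (ler_normD _ _))// lerD.
Qed.

Lemma dominated_scale a h : dominated h -> dominated (fun x => a * h x).
Proof.
move=> [ch [D hD]]; split.
  by move=> x; apply: continuousM; [exact: cvg_cst|exact: ch].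
by exists (`|a| * D) => x; rewrite normrM -mulrA ler_wpM2l.
Qed.

Lemma dominated0 : dominated (fun=> 0).
Proof.
split; first by move=> x; exact: cvg_cst.
by exists 0 => x; rewrite mul0r normr0.
Qed.

Lemma dominated_sum (I : Type) (r : seq I) (Pr : pred I) (f : I -> R -> R) :
  (forall i, dominated (f i)) -> dominated (fun x => \sum_(i <- r | Pr i) f i x).
Proof.
move=> df; elim: r => [|i r ih].
  by under eq_fun do rewrite big_nil; exact: dominated0.
under eq_fun do rewrite big_cons; case: (Pr i) => //.
exact: dominated_add.
Qed.

Lemma intRD g h : dominated g -> dominated h ->
  intR (fun x => g x + h x) = intR g + intR h.
Proof.
move=> dg dh; have [cg _] := dg; have [ch _] := dh.
have pg := prim_deriv cg; have ph := prim_deriv ch.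
apply: (intR_unique (deriv_add pg ph) (dominated_add dg dh)).
under eq_fun do rewrite opprD addrACA.
by apply: cvgD; [exact: intR_cvg pg dg|exact: intR_cvg ph dh].
Qed.

Lemma intRZ a h : dominated h -> intR (fun x => a * h x) = a * intR h.
Proof.
move=> dh; have [ch _] := dh; have ph := prim_deriv ch.
apply: (intR_unique (deriv_scale a ph) (dominated_scale a dh)).
under eq_fun do rewrite -mulrBr.
by apply: cvgM; [exact: cvg_cst|exact: intR_cvg ph dh].
Qed.

Lemma intRB g h : dominated g -> dominated h ->
  intR (fun x => g x - h x) = intR g - intR h.
Proof.
move=> dg dh; have := intRD dg (dominated_scale (-1) dh).
rewrite intRZ// mulN1r => <-; apply: eq_intR => x; by rewrite mulN1r.
Qed.

Lemma intR0 : intR (fun=> 0) = 0.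
Proof.
apply: (intR_unique (deriv_cst 0) dominated0).
by under eq_fun do rewrite subr0; exact: cvg_cst.
Qed.

Lemma intR_sum (I : Type) (r : seq I) (Pr : pred I) (f : I -> R -> R) :
  (forall i, dominated (f i)) ->
  intR (fun x => \sum_(i <- r | Pr i) f i x) = \sum_(i <- r | Pr i) intR (f i).
Proof.
move=> df; elim: r => [|i r ih].
  by rewrite big_nil -[RHS]intR0; apply: eq_intR => x; rewrite big_nil.
rewrite big_cons -ih; case Pi : (Pr i).
  rewrite -intRD//; last exact: dominated_sum.
  by apply: eq_intR => x; rewrite big_cons Pi.
by apply: eq_intR => x; rewrite big_cons Pi.
Qed.

Lemma intR_ge_itv h P x y : deriv_of P h -> dominated h -> (forall z, 0 <= h z) -> x <= y ->
  P y - P x <= intR h.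
Proof.
move=> dP dh h0 xy.
have Ph u v : u <= v -> P u <= P v.
  by move=> uv; apply: deriv_ge0_homo dP uv _.
apply: cvgr_to_ge (intR_cvg dP dh) _.
near=> n.
have yn : y <= n%:R by near: n; exact: nbhs_infty_ger.
have xn : - x <= n%:R by near: n; exact: nbhs_infty_ger.
by apply: lerB; apply: Ph => //; rewrite lerNl.
Unshelve. all: by end_near. Qed.

Lemma intR_ge0 h : dominated h -> (forall x, 0 <= h x) -> 0 <= intR h.
Proof.
move=> dh h0; have [ch _] := dh.
by have := intR_ge_itv (prim_deriv ch) dh h0 (lexx 0); rewrite subrr.
Qed.

Lemma le_intR g h : dominated g -> dominated h -> (forall x, g x <= h x) ->
  intR g <= intR h.
Proof.
move=> dg dh gh; rewrite -subr_ge0 -intRB//; apply: intR_ge0.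
  apply: dominated_add => //.
  have := dominated_scale (-1) dg.
  by under eq_fun do rewrite mulN1r.
by move=> x; rewrite subr_ge0.
Qed.

Lemma dominated_norm h : dominated h -> dominated (fun x => `|h x|).
Proof.
move=> [ch [C hC]]; split; last by exists C => x; rewrite normr_id.
by move=> x; apply: cvg_norm; exact: ch.
Qed.

Lemma norm_intR_le h : dominated h -> `|intR h| <= intR (fun x => `|h x|).
Proof.
move=> dh; have dn := dominated_norm dh; rewrite ler_norml; apply/andP; split.
  rewrite lerNl -mulN1r -intRZ//; apply: le_intR => //.
    exact: dominated_scale.
  by move=> x; rewrite mulN1r -normrN ler_norm.
by apply: le_intR => // x; rewrite ler_norm.
Qed.

Lemma intR_deriv0 K K' C : deriv_of K K' -> dominated K' ->
  (forall x, `|K x| <= C * (1 + `|x|)^-1) -> intR K' = 0.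
Proof.
move=> dK dK' KC; apply: (intR_unique dK dK').
have C0 : 0 <= C by have := le_trans (normr_ge0 _) (KC 0); rewrite normr0 addr0 invr1 mulr1.
have lim (s : nat -> R) : (forall n, `|s n| = n%:R) -> (fun n => K (s n)) @ \oo --> 0.
  move=> sn; apply/cvgrPdist_le => e e0; near=> n.
  rewrite sub0r normrN; apply: le_trans (KC _) _; rewrite sn.
  rewrite ler_pdivrMr ?ltr_wpDr//.
  have : C / e <= n%:R by near: n; exact: nbhs_infty_ger.
  rewrite ler_pdivrMr// => h; apply: (le_trans h); rewrite mulrC ler_wpM2l//; first exact: ltW.
  by rewrite lerDr.
rewrite -[0]subr0; apply: cvgB; apply: lim => n; by rewrite ?normrN normr_nat.
Unshelve. all: by end_near. Qed.

Definition bcont g := continuous g /\ exists M : R, forall x, `|g x| <= M.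

Lemma bcont_cst c : bcont (fun=> c).
Proof. by split; [move=> x; exact: cvg_cst|exists `|c|]. Qed.

Lemma bcontD f g : bcont f -> bcont g -> bcont (fun x => f x + g x).
Proof.
move=> [cf [M fM]] [cg [N gN]]; split.
  by move=> x; apply: continuousD; [exact: cf|exact: cg].
by exists (M + N) => x; rewrite (le_trans (ler_normD _ _))// lerD.
Qed.

Lemma bcontM f g : bcont f -> bcont g -> bcont (fun x => f x * g x).
Proof.
move=> [cf [M fM]] [cg [N gN]]; split.
  by move=> x; apply: continuousM; [exact: cf|exact: cg].
by exists (M * N) => x; rewrite normrM ler_pM.
Qed.

Lemma bcontZ a f : bcont f -> bcont (fun x => a * f x).
Proof. by apply: bcontM; exact: bcont_cst. Qed.

Lemma bcontN f : bcont f -> bcont (fun x => - f x).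
Proof. by move=> /(bcontZ (-1)); under eq_fun do rewrite mulN1r. Qed.

Lemma bcontB f g : bcont f -> bcont g -> bcont (fun x => f x - g x).
Proof. by move=> cf /bcontN; exact: bcontD. Qed.

Lemma bcontX f n : bcont f -> bcont (fun x => f x ^+ n).
Proof.
move=> cf; elim: n => [|n ih]; first by under eq_fun do rewrite expr0; exact: bcont_cst.
by under eq_fun do rewrite exprS; exact: bcontM.
Qed.

Lemma bcont_norm f : bcont f -> bcont (fun x => `|f x|).
Proof.
move=> [cf [M fM]]; split; last by exists M => x; rewrite normr_id.
by move=> x; apply: cvg_norm; exact: cf.
Qed.

Lemma bcont_max f g : bcont f -> bcont g -> bcont (fun x => Num.max (f x) (g x)).
Proof.
move=> cf cg; have -> : (fun x => Num.max (f x) (g x)) = (fun x => 2^-1 * (f x + g x + `|f x - g x|)).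
  by apply/funext => x; rewrite maxr_absE mulrC.
by apply/bcontZ/bcontD; [exact: bcontD|apply/bcont_norm/bcontB].
Qed.

Lemma bcont_sum (I : Type) (r : seq I) (Pr : pred I) (f : I -> R -> R) :
  (forall i, Pr i -> bcont (f i)) -> bcont (fun x => \sum_(i <- r | Pr i) f i x).
Proof.
move=> df; elim: r => [|i r ih].
  by under eq_fun do rewrite big_nil; exact: bcont_cst.
under eq_fun do rewrite big_cons; case Pi : (Pr i) => //.
by apply: bcontD => //; exact: df.
Qed.

Lemma bcont_bigmax (I : Type) (r : seq I) (f : I -> R -> R) :
  (forall i, bcont (f i)) -> bcont (fun x => \big[Num.max/0]_(i <- r) f i x).
Proof.
move=> df; elim: r => [|i r ih].
  by under eq_fun do rewrite big_nil; exact: bcont_cst.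
by under eq_fun do rewrite big_cons; exact: bcont_max.
Qed.

Lemma bcont_comp_lin f a c : bcont f -> bcont (fun x => f (a * x + c)).
Proof.
move=> [cf [M fM]]; split; last by exists M.
move=> x; apply: (@continuous_comp _ _ _ (fun x => a * x + c) f); last exact: cf.
exact: (deriv_continuous (deriv_lin a c)).
Qed.

Lemma bcont_dominated g h : bcont g -> dominated h -> dominated (fun x => g x * h x).
Proof.
move=> [cg [M gM]] [ch [C hC]]; split.
  by move=> x; apply: continuousM; [exact: cg|exact: ch].
by exists (M * C) => x; rewrite normrM -mulrA ler_pM.
Qed.

End IntegralR.

(** * A slowly varying weight *)

Section Weight.
Variable R : realType.
Implicit Types (f g h P H : R -> R) (x y a c C K : R).

(* The dilation by 32 gives [`|om'| <= om / 32] and [om'' <= om / 256]: against this weight an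
   integration by parts costs less than any rate [>= 1] brings in. *)
Definition om x : R := (1 + (x / 32) ^+ 2)^-1.
Definition om1 x : R := - (x / 512) * om x ^+ 2.
Definition om2 x : R := - 512^-1 * om x ^+ 2 + 2 * (x / 512) ^+ 2 * om x ^+ 3.

Let den_gt0 x : 0 < 1 + (x / 32) ^+ 2. Proof. exact: sqr1_gt0. Qed.

Lemma om_gt0 x : 0 < om x. Proof. by rewrite invr_gt0. Qed.

Lemma om_le1 x : om x <= 1.
Proof. by rewrite invf_le1// lerDl sqr_ge0. Qed.

Lemma omE x : om x * (1 + (x / 32) ^+ 2) = 1.
Proof. by rewrite mulVf// gt_eqF. Qed.

Lemma om_deriv : deriv_of om om1.
Proof.
have d : deriv_of (fun x : R => 1 + (x / 32) ^+ 2) (fun x => x / 512).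
  apply: deriv_ext (deriv_add (deriv_cst 1) (deriv_expr 2 (deriv_lin (32^-1) 0))) => x /=.
    by rewrite addr0 mulrC.
  by rewrite addr0 expr1 add0r; field.
apply: deriv_ext (deriv_inv d _) => x //; last by rewrite gt_eqF.
by rewrite /om1 /om exprVn mulrC mulrN mulNr.
Qed.

Lemma om1_deriv : deriv_of om1 om2.
Proof.
have d1 : deriv_of (fun x : R => - (x / 512)) (fun=> - 512^-1).
  apply: deriv_ext (deriv_lin (- 512^-1) 0) => x //.
  by rewrite addr0 mulNr mulrC.
apply: deriv_ext (deriv_mul d1 (deriv_expr 2 om_deriv)) => x //=.
rewrite /om2 /om1 expr1; ring.
Qed.

Lemma om1_le x : `|om1 x| <= 32^-1 * om x.
Proof.
have o0 := om_gt0 x; rewrite /om1 normrM normrN [`|_ ^+ 2|]ger0_norm ?sqr_ge0//.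
rewrite expr2 mulrA ler_pM2r//; have e := omE x.
have -> : x / 512 = 16^-1 * (x / 32) by field.
set s := x / 32 in e *; rewrite normrM ger0_norm ?invr_ge0// -mulrA.
have : 2 * `|s| <= 1 + s ^+ 2 by have := sqr_ge0 (`|s| - 1); rewrite -[s ^+ 2]real_normK ?num_real//; nra.
move=> /(ler_wpM2r (ltW o0)); rewrite [X in _ <= X]mulrC e; lra.
Qed.

Lemma om2_le x : om2 x <= (16^-1) ^+ 2 * om x.
Proof.
have o0 := om_gt0 x; have e := omE x; rewrite /om2.
have -> : x / 512 = 16^-1 * (x / 32) by field.
set s := x / 32 in e *; set o := om x in e o0 *.
have os : o * s ^+ 2 = 1 - o by lra.
have -> : 2 * (16^-1 * s) ^+ 2 * o ^+ 3 = 128^-1 * (1 - o) * o ^+ 2 by rewrite -os; field.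
have o1 : o <= 1 by exact: om_le1.
rewrite -subr_ge0.
have -> : (16^-1) ^+ 2 * o - (- 512^-1 * o ^+ 2 + 128^-1 * (1 - o) * o ^+ 2) =
   128^-1 * o * (2^-1 + 4^-1 * o - (1 - o) * o) by field.
rewrite mulr_ge0//; first by lra.
nra.
Qed.

Lemma om2_norm_le x : `|om2 x| <= om x.
Proof.
have o0 := om_gt0 x; rewrite ler_norml; apply/andP; split; last first.
  apply: le_trans (om2_le x) _; rewrite ler_piMl ?ltW//; lra.
have o1 := om_le1 x.
have h : 0 <= 2 * (x / 512) ^+ 2 * om x ^+ 3.
  exact: mulr_ge0 (mulr_ge0 (ler0n _ 2) (sqr_ge0 _)) (exprn_ge0 3 (ltW o0)).
have h2 : om x ^+ 2 <= om x by rewrite expr2 ler_piMl// ltW.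
rewrite /om2; lra.
Qed.

Lemma om_le_dom x y : om (x - y) <= 2048 * (1 + y ^+ 2) * (1 + x ^+ 2)^-1.
Proof.
rewrite /om ler_pdivlMr ?sqr1_gt0// mulrC ler_pdivrMr//.
have := sqr_ge0 (x - 2 * y); have := sqr_ge0 x; have := sqr_ge0 y; have := sqr_ge0 (x - y).
nra.
Qed.

Lemma om_ge_dom x : (1 + x ^+ 2)^-1 <= om x.
Proof.
rewrite lef_pV2 ?posrE ?sqr1_gt0// lerD2l expr_div_n ler_pdivrMr//.
have := sqr_ge0 x; lra.
Qed.

Lemma om_shift_deriv y : deriv_of (fun x => om (x - y)) (fun x => om1 (x - y)).
Proof.
by apply: deriv_ext (deriv_compl 1 (- y) om_deriv) => x; rewrite !mul1r.
Qed.

Lemma om1_shift_deriv y : deriv_of (fun x => om1 (x - y)) (fun x => om2 (x - y)).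
Proof.
by apply: deriv_ext (deriv_compl 1 (- y) om1_deriv) => x; rewrite !mul1r.
Qed.

Lemma om2_continuous : continuous (fun x => om2 x).
Proof.
have cX n : continuous (fun x => om x ^+ n).
  exact: (deriv_continuous (deriv_expr n om_deriv)).
have c2 : continuous (fun x : R => (x / 512) ^+ 2).
  apply: (@deriv_continuous _ _ _ (deriv_ext _ _ (deriv_expr 2 (deriv_lin 512^-1 0)))) => [x|x]; last reflexivity.
  by rewrite /= addr0 mulrC.
move=> x; apply: cvgD; apply: cvgM; [exact: cvg_cst|exact: cX| |exact: cX].
by apply: cvgM; [exact: cvg_cst|exact: c2].
Qed.

Let dom_le (h : R -> R) y : continuous h -> (forall x, `|h x| <= om x) ->
  dominated (fun x => h (x - y)).
Proof.
move=> ch hle; split.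
  move=> x; apply: (@continuous_comp _ _ _ (fun x => x - y) h); last exact: ch.
  by apply: cvgB; [exact: cvg_id|exact: cvg_cst].
exists (2048 * (1 + y ^+ 2)) => x; exact: le_trans (hle _) (om_le_dom x y).
Qed.

Lemma om_dominated y : dominated (fun x => om (x - y)).
Proof.
apply: dom_le; first exact: deriv_continuous om_deriv.
by move=> x; rewrite ger0_norm// ltW// om_gt0.
Qed.

Lemma om1_dominated y : dominated (fun x => om1 (x - y)).
Proof.
apply: dom_le; first exact: deriv_continuous om1_deriv.
by move=> x; apply: le_trans (om1_le x) _; rewrite ler_piMl ?ltW ?om_gt0//; lra.
Qed.

Lemma om2_dominated y : dominated (fun x => om2 (x - y)).
Proof. by apply: dom_le; [exact: om2_continuous|exact: om2_norm_le]. Qed.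

Definition E y g : R := intR (fun x => g x * om (x - y)).

Let Ed g y : bcont g -> dominated (fun x => g x * om (x - y)).
Proof. by move=> bg; apply: bcont_dominated => //; exact: om_dominated. Qed.

Lemma E_eq y f g : f =1 g -> E y f = E y g.
Proof. by move=> /funext ->. Qed.

Lemma ED y f g : bcont f -> bcont g -> E y (fun x => f x + g x) = E y f + E y g.
Proof.
by move=> bf bg; rewrite /E -intRD; try exact: Ed; apply: eq_intR => x; rewrite mulrDl.
Qed.

Lemma EZ y a f : bcont f -> E y (fun x => a * f x) = a * E y f.
Proof.
by move=> bf; rewrite /E -intRZ; try exact: Ed; apply: eq_intR => x; rewrite mulrA.
Qed.

Lemma EN y f : bcont f -> E y (fun x => - f x) = - E y f.
Proof. by move=> bf; rewrite -mulN1r -EZ//; apply: E_eq => x; rewrite mulN1r. Qed.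

Lemma EB y f g : bcont f -> bcont g -> E y (fun x => f x - g x) = E y f - E y g.
Proof. by move=> bf bg; rewrite ED ?EN//; exact: bcontN. Qed.

Lemma E_sum y (I : Type) (r : seq I) (Pr : pred I) (f : I -> R -> R) :
  (forall i, Pr i -> bcont (f i)) ->
  E y (fun x => \sum_(i <- r | Pr i) f i x) = \sum_(i <- r | Pr i) E y (f i).
Proof.
move=> bf; elim: r => [|i r ih].
  rewrite big_nil -[RHS]intR0; apply: eq_intR => x; by rewrite big_nil mul0r.
rewrite big_cons -ih; case Pi : (Pr i).
  rewrite -ED; [|exact: bf|exact: bcont_sum].
  by apply: eq_intR => x; rewrite big_cons Pi.
by apply: eq_intR => x; rewrite big_cons Pi.
Qed.

Lemma E_mono y f g : bcont f -> bcont g -> (forall x, f x <= g x) -> E y f <= E y g.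
Proof.
move=> bf bg fg; apply: le_intR; [exact: Ed|exact: Ed|] => x.
by rewrite ler_wpM2r// ltW// om_gt0.
Qed.

Lemma E_ge0 y f : bcont f -> (forall x, 0 <= f x) -> 0 <= E y f.
Proof.
move=> bf f0; apply: intR_ge0; [exact: Ed|] => x.
by rewrite mulr_ge0// ltW// om_gt0.
Qed.

Let inv_le x : (1 + x ^+ 2)^-1 <= 2 * (1 + `|x|)^-1.
Proof.
rewrite ler_pdivlMr ?ltr_wpDr// mulrC ler_pdivrMr ?sqr1_gt0//.
rewrite -[x ^+ 2]real_normK ?num_real//; have := sqr_ge0 (`|x| - 1); nra.
Qed.

Let decay f g : bcont f -> dominated g ->
  exists C, forall x, `|f x * g x| <= C * (1 + `|x|)^-1.
Proof.
move=> bf dg; have [_ [C hC]] := bcont_dominated bf dg.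
have C0 : 0 <= C by have := le_trans (normr_ge0 _) (hC 0); rewrite expr0n/= addr0 invr1 mulr1.
exists (C * 2) => x; apply: le_trans (hC x) _; rewrite -mulrA.
by apply: ler_wpM2l => //; exact: inv_le.
Qed.

(** Only [H * om1] survives the integration by parts, and it is at most 1/32 of [H * om]. This
    stands in for the vanishing mean of a derivative. *)
Lemma E_ibp y H H' : bcont H -> bcont H' -> deriv_of H H' ->
  `|E y H'| <= 32^-1 * E y (fun x => `|H x|).
Proof.
move=> bH bH' dH.
have d := deriv_mul dH (om_shift_deriv y).
have d1 := bcont_dominated bH (om1_dominated y).
have [C hC] := decay bH (om_dominated y).
have := intR_deriv0 d (dominated_add (Ed y bH') d1) hC.
rewrite intRD//; last exact: Ed.
move=> /eqP; rewrite addr_eq0 => /eqP; rewrite -/(E y H') => ->; rewrite normrN.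
have bn := bcont_norm bH.
rewrite -EZ//; apply: le_trans (norm_intR_le d1) _.
apply: le_intR; [exact: dominated_norm|exact/Ed/bcontZ|] => x.
by rewrite normrM mulrAC mulrC ler_wpM2r//; exact: om1_le.
Qed.

(* Functions varying at scale [1 / rho]. *)
Definition slow rho (Psi : R -> R) := exists Psi1 Psi2,
  [/\ deriv_of Psi Psi1, deriv_of Psi1 Psi2, bcont Psi, bcont Psi1 & bcont Psi2] /\
  forall x, [/\ 0 <= Psi x, `|Psi1 x| <= rho * Psi x & Psi2 x <= rho ^+ 2 * Psi x].

Lemma slow_ge0 rho Psi x : slow rho Psi -> 0 <= Psi x.
Proof. by move=> [? [? [_ /(_ x)[]]]]. Qed.

Lemma slow_bcont rho Psi : slow rho Psi -> bcont Psi.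
Proof. by move=> [? [? [[]]]]. Qed.

Lemma slow_cst rho c : 0 <= c -> 0 <= rho -> slow rho (fun=> c).
Proof.
move=> c0 r0; exists (fun=> 0), (fun=> 0); split.
  by split; try exact: bcont_cst; exact: deriv_cst.
by move=> x; rewrite normr0; split; rewrite ?mulr_ge0// sqr_ge0.
Qed.

Lemma slow_le rho rho' Psi : 0 <= rho <= rho' -> slow rho Psi -> slow rho' Psi.
Proof.
move=> /andP[r0 rr] [P1 [P2 [c h]]]; exists P1, P2; split => // x.
have [P0 a b] := h x; split => //.
  by apply: le_trans a _; rewrite ler_wpM2r.
by apply: le_trans b _; rewrite ler_wpM2r// lerXn2r ?nnegrE// (le_trans r0).
Qed.

Lemma slowD rho f g : slow rho f -> slow rho g -> slow rho (fun x => f x + g x).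
Proof.
move=> [f1 [f2 [[df df1 bf bf1 bf2] hf]]] [g1 [g2 [[dg dg1 bg bg1 bg2] hg]]].
exists (fun x => f1 x + g1 x), (fun x => f2 x + g2 x); split.
  by split; try exact: deriv_add; exact: bcontD.
move=> x; have [? ? ?] := hf x; have [? ? ?] := hg x; split; rewrite ?addr_ge0// ?mulrDr ?lerD//.
by rewrite (le_trans (ler_normD _ _))// lerD.
Qed.

Lemma slowM rho rho' f g : slow rho f -> slow rho' g ->
  slow (rho + rho') (fun x => f x * g x).
Proof.
move=> [f1 [f2 [[df df1 bf bf1 bf2] hf]]] [g1 [g2 [[dg dg1 bg bg1 bg2] hg]]].
have dfg := deriv_mul df dg.
have dfg2 := deriv_add (deriv_mul df1 dg) (deriv_mul df dg1).
eexists; eexists; split; first split.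
- exact: dfg.
- exact: dfg2.
- exact: bcontM.
- by apply: bcontD; exact: bcontM.
- by apply: bcontD; apply: bcontD; exact: bcontM.
move=> x; have [f0 f1x f2x] := hf x; have [g0 g1x g2x] := hg x.
have A := ler_pM (normr_ge0 _) (normr_ge0 _) f1x g1x.
have B := ler_wpM2r g0 f2x; have C := ler_wpM2l f0 g2x.
have D : f1 x * g1 x <= `|f1 x| * `|g1 x| by rewrite -normrM ler_norm.
split.
- exact: mulr_ge0.
- rewrite (le_trans (ler_normD _ _))// !normrM (ger0_norm f0) (ger0_norm g0).
  have := ler_wpM2r g0 f1x; have := ler_wpM2l f0 g1x; lra.
- have -> : (rho + rho') ^+ 2 * (f x * g x) =
    rho ^+ 2 * f x * g x + f x * (rho' ^+ 2 * g x) + 2 * (rho * f x * (rho' * g x)) by ring.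
  lra.
Qed.

Lemma slow_sum rho (I : Type) (r : seq I) (Pr : pred I) (f : I -> R -> R) : 0 <= rho ->
  (forall i, Pr i -> slow rho (f i)) -> slow rho (fun x => \sum_(i <- r | Pr i) f i x).
Proof.
move=> r0 df; elim: r => [|i r ih].
  by under eq_fun do rewrite big_nil; exact: slow_cst.
under eq_fun do rewrite big_cons; case Pi : (Pr i) => //.
by apply: slowD => //; exact: df.
Qed.

Lemma slowX rho f n : slow rho f -> slow (n%:R * rho) (fun x => f x ^+ n).
Proof.
move=> sf; elim: n => [|n ih].
  by rewrite mul0r; under eq_fun do rewrite expr0; apply: slow_cst.
under eq_fun do rewrite exprS.
have -> : n.+1%:R * rho = rho + n%:R * rho by rewrite -natr1; ring.
exact: slowM.
Qed.

(** Rates add under products, as in [slowM], and the weight itself varies at rate 1/16. The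
    left-hand side is the second derivative of [Psi * om], with [om] centred at [y]. *)
Lemma om_slow y rho Psi Psi1 Psi2 x :
  0 <= Psi x -> `|Psi1 x| <= rho * Psi x -> Psi2 x <= rho ^+ 2 * Psi x -> 0 <= rho ->
  Psi2 x * om (x - y) + 2 * (Psi1 x * om1 (x - y)) + Psi x * om2 (x - y) <=
  (rho + 16^-1) ^+ 2 * Psi x * om (x - y).
Proof.
move=> P0 P1 P2 r0; have o0 := om_gt0 (x - y).
have := ler_wpM2r (ltW o0) P2; have := ler_wpM2l P0 (om2_le (x - y)).
have A := ler_pM (normr_ge0 _) (normr_ge0 _) P1 (om1_le (x - y)).
have B := ler_norm (Psi1 x * om1 (x - y)); rewrite normrM in B.
have : 0 <= rho * Psi x * om (x - y) by rewrite !mulr_ge0// ltW.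
set o := om _ in A *; set P := Psi x in A *.
have -> : (rho + 16^-1) ^+ 2 * P * o = rho ^+ 2 * P * o + 2 * 16^-1 * (rho * P * o) + P * (16^-1 ^+ 2 * o) by ring.
move: A; have -> : rho * P * (32^-1 * o) = 32^-1 * (rho * P * o) by ring.
lra.
Qed.

(** Both derivatives of [u] are moved onto [Psi * om]. Since [u] is nonnegative, an upper bound on
    the second derivative of that product is enough, which is why [slow] bounds [Psi2] from one
    side. *)
Lemma E_slow_ibp y rho Psi u u1 u2 : 0 <= rho -> slow rho Psi ->
  deriv_of u u1 -> deriv_of u1 u2 -> bcont u -> bcont u1 -> bcont u2 ->
  (forall x, 0 <= u x) ->
  E y (fun x => Psi x * u2 x) <= (rho + 16^-1) ^+ 2 * E y (fun x => Psi x * u x).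
Proof.
move=> r0 [P1 [P2 [[dP dP1 bP bP1 bP2] hP]]] du du1 bu bu1 bu2 u0.
have o := om_shift_deriv y; have o1 := om1_shift_deriv y.
pose W x := Psi x * om (x - y).
pose W1 x := P1 x * om (x - y) + Psi x * om1 (x - y).
pose W2 x := P2 x * om (x - y) + 2 * (P1 x * om1 (x - y)) + Psi x * om2 (x - y).
have dW : deriv_of W W1 by exact: deriv_mul.
have dW1 : deriv_of W1 W2.
  apply: deriv_ext (deriv_add (deriv_mul dP1 o) (deriv_mul dP o1)) => // x.
  by rewrite /W2; ring.
have DW : dominated W by exact: bcont_dominated (om_dominated y).
have DW1 : dominated W1.
  by apply: dominated_add; apply: bcont_dominated => //; [exact: om_dominated|exact: om1_dominated].
have DW2 : dominated W2.
  apply: dominated_add; last by apply: bcont_dominated => //; exact: om2_dominated.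
  apply: dominated_add; last apply: dominated_scale; apply: bcont_dominated => //.
    exact: om_dominated.
  exact: om1_dominated.
pose K x := u1 x * W x - u x * W1 x.
have dK : deriv_of K (fun x => u2 x * W x - u x * W2 x).
  apply: deriv_ext (deriv_sub (deriv_mul du1 dW) (deriv_mul du dW1)) => // x.
  by ring.
have [C1 h1] := decay bu1 DW; have [C2 h2] := decay bu DW1.
have D2 : dominated (fun x => u2 x * W x) by exact: bcont_dominated.
have D3 : dominated (fun x => u x * W2 x) by exact: bcont_dominated.
have DD : dominated (fun x => u2 x * W x - u x * W2 x).
  apply: dominated_add => //; have := dominated_scale (-1) D3.
  by under eq_fun do rewrite mulN1r.
have := intR_deriv0 (C := C1 + C2) dK DD.
rewrite intRB// => K0.
have -> : E y (fun x => Psi x * u2 x) = intR (fun x => u2 x * W x).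
  by apply: eq_intR => x; rewrite /W; ring.
have -> : intR (fun x => u2 x * W x) = intR (fun x => u x * W2 x).
  apply/eqP; rewrite -subr_eq0 K0// => x; rewrite /K mulrDl.
  by rewrite (le_trans (ler_normB _ _))// lerD.
rewrite -EZ; last exact: bcontM.
apply: le_intR => // [|x]; first by apply/Ed/bcontZ/bcontM.
have [P0 P1x P2x] := hP x.
have := ler_wpM2l (u0 x) (om_slow y P0 P1x P2x r0).
by rewrite /W2; lra.
Qed.

Definition unif_le g K := forall y, prim g (y + 1) - prim g y <= K.

(** Integration by parts against [P x - P y], whose modulus is at most [(|x - y| + 1) * K]. The
    derivative of the weight pays for this growth, as [(|u| + 1) * |om1 u| <= 4 * om u], and the
    integral of [om], equal to [32 * pi], is below 128; hence [512 = 4 * 128]. *)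
Lemma unif_le_E y g K : bcont g -> (forall x, 0 <= g x) -> unif_le g K ->
  E y g <= 512 * K.
Proof.
move=> bg g0 gK; have [cg [M gM]] := bg.
have dP := prim_deriv cg; set P := prim g in dP.
have Ph u v : u <= v -> P u <= P v.
  by move=> uv; apply: deriv_ge0_homo dP uv _.
have K0 : 0 <= K by apply: le_trans (gK 0); rewrite subr_ge0 Ph// lerDl.
have Pn u n : P (u + n%:R) - P u <= n%:R * K.
  elim: n => [|n ih]; first by rewrite mul0r addr0 subrr.
  have := gK (u + n%:R); rewrite -/P -natr1 addrA; lra.
have Puv u v : u <= v -> P v - P u <= ((v - u) + 1) * K.
  move=> uv; have h : v <= u + (Num.truncn (v - u)).+1%:R.
    by rewrite -lerBlDl ltW// truncnS_gt.
  have := Ph _ _ h; have := Pn u (Num.truncn (v - u)).+1.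
  have : (Num.truncn (v - u)).+1%:R * K <= (v - u + 1) * K.
    by rewrite ler_wpM2r// -natr1 lerD2r truncn_le// subr_ge0.
  lra.
have PB x : `|P x - P y| <= (`|x - y| + 1) * K.
  case: (leP y x) => xy.
    by rewrite !ger0_norm ?subr_ge0 ?Ph// Puv.
  by rewrite distrC [`|x - y|]distrC !ger0_norm ?subr_ge0 ?Ph ?Puv// ltW.
have d := deriv_mul (deriv_sub dP (deriv_cst (P y))) (om_shift_deriv y).
have i512 : `|512^-1 : R| = 512^-1 by rewrite ger0_norm ?invr_ge0 ?ler0n.
have key x : (`|x - y| + 1) * K * `|om1 (x - y)| <= 4 * K * om (x - y).
  rewrite /om1; set u := x - y; have e := omE u; have o0 := om_gt0 u.
  rewrite normrM normrN normrM [`|om u ^+ 2|]ger0_norm ?sqr_ge0// i512.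
  have -> : (`|u| + 1) * K * (`|u| / 512 * om u ^+ 2) = ((`|u| + 1) * `|u| / 512 * om u) * (K * om u) by ring.
  rewrite -[4 * K * om u]mulrA; apply: ler_wpM2r; first exact: mulr_ge0 K0 (ltW o0).
  rewrite -(ler_pM2r (den_gt0 u)) -[leLHS]mulrA e mulr1.
  have -> : (u / 32) ^+ 2 = `|u| ^+ 2 / 1024 by rewrite real_normK ?num_real//; field.
  have := normr_ge0 u; set v := `|u| => v0; have := sqr_ge0 (v - 1); nra.
have d1 : dominated (fun x => (P x - P y) * om1 (x - y)).
  split.
    move=> x; apply: cvgM; last exact: (deriv_continuous (om1_shift_deriv y)).
    by apply: cvgB; [exact: (deriv_continuous dP)|exact: cvg_cst].
  exists (4 * K * (2048 * (1 + y ^+ 2))) => x; rewrite normrM.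
  apply: le_trans (ler_wpM2r (normr_ge0 _) (PB x)) _; apply: le_trans (key x) _.
  rewrite -[leRHS]mulrA; apply: ler_wpM2l; last exact: om_le_dom.
  exact: mulr_ge0 (ler0n _ 4) K0.
have d0 : deriv_of (fun x => (P x - P y) * om (x - y)) (fun x => g x * om (x - y) + (P x - P y) * om1 (x - y)).
  by apply: deriv_ext d => // x; rewrite subr0.
have C0 : 0 <= 2048 * (1 + y ^+ 2) := mulr_ge0 (ler0n _ 2048) (ltW (sqr1_gt0 y)).
have := intR_deriv0 (C := (1 + `|y|) * K * (2048 * (1 + y ^+ 2)) * 2) d0 (dominated_add (Ed y bg) d1).
rewrite intRD//; last exact: Ed.
rewrite -/(E y g) => e0.
have -> : E y g = - intR (fun x => (P x - P y) * om1 (x - y)).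
  apply/eqP; rewrite -addr_eq0 e0// => x.
  rewrite normrM (ger0_norm (ltW (om_gt0 (x - y)))).
  have h := ler_pM (normr_ge0 _) (ltW (om_gt0 _)) (PB x) (om_le_dom x y).
  apply: (le_trans h).
  have xy : `|x - y| + 1 <= (1 + `|y|) * (1 + `|x|).
    have := ler_normB x y; have := normr_ge0 x; have := normr_ge0 y; nra.
  apply: (@le_trans _ _ (((1 + `|y|) * (1 + `|x|)) * K * (2048 * (1 + y ^+ 2) * (1 + x ^+ 2)^-1))).
    apply: ler_wpM2r; last exact: ler_wpM2r.
    by apply: (mulr_ge0 C0); rewrite invr_ge0; exact/ltW/sqr1_gt0.
  have x2 : (1 + `|x|) * (1 + x ^+ 2)^-1 <= 2 * (1 + `|x|)^-1.
    rewrite ler_pdivlMr ?ltr_wpDr// mulrAC ler_pdivrMr ?sqr1_gt0//.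
    by rewrite -[x ^+ 2]real_normK ?num_real//; have := sqr_ge0 (`|x| - 1); nra.
  have D0 : 0 <= (1 + `|y|) * K * (2048 * (1 + y ^+ 2)).
    exact: mulr_ge0 (mulr_ge0 (addr_ge0 ler01 (normr_ge0 y)) K0) C0.
  have := ler_wpM2l D0 x2; lra.
apply: le_trans (ler_norm _) _; rewrite normrN; apply: le_trans (norm_intR_le d1) _.
apply: (@le_trans _ _ (4 * K * intR (fun x => om (x - y)))).
  rewrite -intRZ; last exact: om_dominated.
  apply: le_intR; [exact: dominated_norm|apply: dominated_scale; exact: om_dominated|] => x.
  rewrite normrM; apply: le_trans (key x).
  by rewrite ler_wpM2r.
have dA : deriv_of (fun x => 32 * atan ((x - y) / 32)) (fun x => om (x - y)).
  apply: deriv_ext (deriv_scale 32 (deriv_compl 32^-1 (- (y / 32)) (@deriv_atan R))) => x.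
    by congr (_ * atan _); field.
  by rewrite mulrA mulfV// mul1r /om; congr (_ ^-1); congr (1 + _ ^+ 2); field.
have : intR (fun x => om (x - y)) <= 128.
  apply: cvgr_to_le (intR_cvg dA (om_dominated y)) _; near=> n.
  rewrite -mulrBr; have := @pihalf_lt2 R.
  set s := (_ / 32); set t := (_ / 32).
  have := @atan_gtNpi2 R t; have := @atan_ltpi2 R s; lra.
by move=> /(ler_wpM2l (mulr_ge0 (ltW (ltr0Sn _ 3)) K0)); lra.
Unshelve. all: by end_near. Qed.

End Weight.

(** * Exponential averages *)

Section Resolvent.
Variable R : realType.
Implicit Types (f g h P z : R -> R) (x y a c M l : R) (s : bool).

Let ph a g x := a * (expR (a * x) * g x).

Let ph_cont a g : bcont g -> continuous (ph a g).
Proof.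
move=> [cg _]; have ce := deriv_continuous (deriv_expRM a).
exact: (contM (@cst_continuous _ _ a) (contM ce cg)).
Qed.

(* the average of [g] over the past [(-oo, x]] with density [a * exp (- a * t)] *)
Definition past a g x : R :=
  expR (- a * x) * (prim (ph a g) x - lim ((prim (ph a g) (- n%:R)) @[n --> \oo])).

Let incr a g M x y : 0 < a -> bcont g -> (forall x, `|g x| <= M) -> x <= y ->
  `|prim (ph a g) y - prim (ph a g) x| <= M * (expR (a * y) - expR (a * x)).
Proof.
move=> a0 bg gM xy; have dP := prim_deriv (@ph_cont a g bg).
have dE := deriv_scale M (deriv_expRM a); rewrite mulrBr ler_norml lerNl opprB.
have e0 u : 0 <= a * expR (a * u) := mulr_ge0 (ltW a0) (expR_ge0 _).
apply/andP; split.
  have dN := deriv_opp dP; have := deriv_diff_le dN dE xy; rewrite opprK addrC.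
  apply=> u _; rewrite /ph; have := ler_wpM2l (e0 u) (gM u); have := ler_norm (- (a * expR (a * u) * g u)).
  by rewrite normrN normrM (ger0_norm (e0 u)); lra.
have := deriv_diff_le dP dE xy.
apply=> u _; rewrite /ph; have := ler_wpM2l (e0 u) (gM u); have := ler_norm (a * expR (a * u) * g u).
by rewrite normrM (ger0_norm (e0 u)); lra.
Qed.

Let past_cvg a g : 0 < a -> bcont g -> cvgn (fun n : nat => prim (ph a g) (- n%:R)).
Proof.
move=> a0 bg; have [cg [M gM]] := bg; have P_incr := incr a0 bg gM.
have M0 : 0 <= M := le_trans (normr_ge0 _) (gM 0).
have mn (m n : nat) : (m <= n)%N -> - n%:R <= - m%:R :> R by move=> h; rewrite lerN2 ler_nat.
pose p (u : R) : R := prim (ph a g) u; pose e (u : R) : R := expR (a * u).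
(* The primitive oscillates, but by [incr] adding [M * e] makes it nondecreasing; it is then a
   difference of two monotone functions, each bounded below on the left. *)
have mono (u v : R) : u <= v -> p u + M * e u <= p v + M * e v.
  by move=> /P_incr; rewrite -/(p u) -/(p v) -/(e u) -/(e v) ler_norml; lra.
have low (u : R) : u <= 0 -> - M <= p u + M * e u.
  move=> /P_incr; rewrite prim0; last exact: ph_cont.
  have := mulr_ge0 M0 (expR_ge0 (a * u)).
  by rewrite mulr0 expR0 -/(p u) -/(e u) ler_norml; lra.
have -> : (fun n : nat => prim (ph a g) (- n%:R)) = (fun n : nat => (p (- n%:R) + M * e (- n%:R)) - M * e (- n%:R)).
  by apply/funext => n; rewrite addrK.
apply: is_cvgB.
  apply: nonincreasing_is_cvgn; first by move=> m n /mn /mono.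
  by exists (- M) => _ [n _ <-]; apply: low; rewrite oppr_le0.
apply: is_cvgM; first exact: is_cvg_cst.
apply: nonincreasing_is_cvgn.
  by move=> m n /mn h; rewrite ler_expR ler_pM2l.
by exists 0 => _ [n _ <-]; exact: expR_ge0.
Qed.

Lemma past_deriv a g : 0 < a -> bcont g ->
  deriv_of (past a g) (fun x => a * (g x - past a g x)).
Proof.
move=> a0 bg; have dP := prim_deriv (@ph_cont a g bg); rewrite /past; set l := lim _.
apply: deriv_ext (deriv_mul (deriv_expRM (- a)) (deriv_sub dP (deriv_cst l))) => // x.
rewrite subr0 /ph mulrBr.
have : expR (- a * x) * expR (a * x) = 1 by rewrite -expRD mulNr addNr expR0.
move=> e; rewrite [expR (- a * x) * (a * _)]mulrCA [expR (- a * x) * (_ * g x)]mulrA e mul1r; ring.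
Qed.

Lemma past_bound a g M : 0 < a -> bcont g -> (forall x, `|g x| <= M) ->
  forall x, `|past a g x| <= M.
Proof.
move=> a0 bg gM x; have P_incr := incr a0 bg gM.
rewrite /past normrM ger0_norm ?expR_ge0//.
have M0 : 0 <= M := le_trans (normr_ge0 _) (gM 0).
suff : `|prim (ph a g) x - lim (prim (ph a g) (- n%:R) @[n --> \oo])| <= M * expR (a * x).
  move=> /(ler_wpM2l (expR_ge0 (- a * x))); rewrite mulrCA -expRD mulNr addNr expR0.
  by rewrite mulr1.
have c : (`|prim (ph a g) x - prim (ph a g) (- n%:R)|) @[n --> \oo] -->
   `|prim (ph a g) x - lim (prim (ph a g) (- n%:R) @[n --> \oo])|.
  by apply: cvg_norm; apply: cvgB; [exact: cvg_cst|exact: past_cvg].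
apply: cvgr_to_le c _; near=> n.
have xn : - n%:R <= x by rewrite lerNl; near: n; exact: nbhs_infty_ger.
apply: le_trans (P_incr _ _ xn) _; rewrite ler_wpM2l// lerBlDr lerDl expR_ge0//.
Unshelve. all: by end_near. Qed.

Lemma past_ge0 a g : 0 < a -> bcont g -> (forall x, 0 <= g x) -> forall x, 0 <= past a g x.
Proof.
move=> a0 bg g0 x; apply: mulr_ge0; first exact: expR_ge0.
have c : (prim (ph a g) x - prim (ph a g) (- n%:R)) @[n --> \oo] -->
   prim (ph a g) x - lim (prim (ph a g) (- n%:R) @[n --> \oo]).
  by apply: cvgB; [exact: cvg_cst|exact: past_cvg].
apply: cvgr_to_ge c _; near=> n; rewrite subr_ge0.
have xn : - n%:R <= x by rewrite lerNl; near: n; exact: nbhs_infty_ger.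
apply: deriv_ge0_homo (prim_deriv (@ph_cont a g bg)) xn _ => z _.
by apply: mulr_ge0; [exact: ltW|apply: mulr_ge0 => //; exact: expR_ge0].
Unshelve. all: by end_near. Qed.

Let hom0 a h M : 0 < a -> deriv_of h (fun x => - a * h x) -> (forall x, `|h x| <= M) ->
  forall x, h x = 0.
Proof.
move=> a0 dh hM x.
have d0 : deriv_of (fun x => expR (a * x) * h x) (fun=> 0).
  apply: deriv_ext (deriv_mul (deriv_expRM a) dh) => // y; ring.
apply/eqP; rewrite -normr_le0; apply/ler_addgt0Pr => e e0; rewrite add0r.
have M0 : 0 <= M := le_trans (normr_ge0 _) (hM 0).
(* Moving left by [M / e / a] multiplies [h] by [expR (M / e)], which is at least [M / e], while [h]
   stays below [M]; so [h x] is at most [e]. *)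
have := deriv0_cst x (x - M / e / a) d0; rewrite mulrBr expRD -mulrA.
move=> /(mulfI (lt0r_neq0 (expR_gt0 _))) ->; rewrite normrM ger0_norm ?expR_ge0//.
rewrite expRN [a * _]mulrC divfK ?gt_eqF// mulrC ler_pdivrMr ?expR_gt0//.
apply: le_trans (hM _) _; apply: le_trans (_ : e * (M / e) <= _).
  by rewrite mulrC divfK// gt_eqF.
rewrite ler_pM2l//; apply: le_trans (expR_ge1Dx _); rewrite lerDr//.
Qed.

(** An average is characterised as the bounded solution of its differential equation. Linearity, the
    value on constants and the symbols on [cos] and [sin] are all read off from this uniqueness. *)
Lemma past_unique a g z M : 0 < a -> bcont g -> (forall x, `|z x| <= M) ->
  deriv_of z (fun x => a * (g x - z x)) -> past a g =1 z.
Proof.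
move=> a0 bg zM dz x; have [_ [N gN]] := bg.
apply/eqP; rewrite -subr_eq0; apply/eqP.
apply: (@hom0 a (fun x => past a g x - z x) (N + M)) => // [|{}x].
  by apply: deriv_ext (deriv_sub (past_deriv a0 bg) dz) => // y; ring.
by rewrite (le_trans (ler_normB _ _))// lerD// past_bound.
Qed.

(* [s] is the direction of averaging: [true] for the future, [false] for the past. *)
Definition resv s a g x : R := if s then past a (fun t => g (- t)) (- x) else past a g x.

Definition sg s : R := (if s then 1 else -1).

Let bcont_opp g : bcont g -> bcont (fun t => g (- t)).
Proof.
move=> /(bcont_comp_lin (-1) 0).
by under eq_fun do rewrite mulN1r addr0.
Qed.

Lemma resv_deriv s a g : 0 < a -> bcont g ->
  deriv_of (resv s a g) (fun x => sg s * a * (resv s a g x - g x)).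
Proof.
move=> a0 bg; case: s => /=.
  have d := past_deriv a0 (bcont_opp bg).
  apply: deriv_ext (deriv_compl (-1) 0 d) => x; rewrite /= ?mulN1r ?addr0//.
  by rewrite !opprK /sg; ring.
apply: deriv_ext (past_deriv a0 bg) => x //=.
by rewrite /sg; ring.
Qed.

Lemma resv_bound s a g M : 0 < a -> bcont g -> (forall x, `|g x| <= M) ->
  forall x, `|resv s a g x| <= M.
Proof.
move=> a0 bg gM x; case: s => /=; apply: past_bound => //; exact: bcont_opp.
Qed.

Lemma resv_ge0 s a g : 0 < a -> bcont g -> (forall x, 0 <= g x) -> forall x, 0 <= resv s a g x.
Proof.
move=> a0 bg g0 x; case: s => /=; apply: past_ge0 => //; exact: bcont_opp.
Qed.

Lemma resv_bcont s a g : 0 < a -> bcont g -> bcont (resv s a g).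
Proof.
move=> a0 bg; split; first exact: (deriv_continuous (resv_deriv s a0 bg)).
by have [_ [M gM]] := bg; exists M; exact: resv_bound.
Qed.

Lemma resv_unique s a g z M : 0 < a -> bcont g -> (forall x, `|z x| <= M) ->
  deriv_of z (fun x => sg s * a * (z x - g x)) -> resv s a g =1 z.
Proof.
move=> a0 bg zM dz x; case: s dz => /= dz.
  have := @past_unique a _ (fun t => z (- t)) M a0 (bcont_opp bg) (fun y => zM (- y)) _ (- x).
  rewrite opprK; apply.
  apply: deriv_ext (deriv_compl (-1) 0 dz) => y; rewrite /= ?mulN1r ?addr0//.
  by rewrite /sg; ring.
apply: (@past_unique a _ z M a0 bg) => //.
by apply: deriv_ext dz => y //; rewrite /sg; ring.
Qed.

Lemma resv_cst s a c x : 0 < a -> resv s a (fun=> c) x = c.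
Proof.
move=> a0; apply: (@resv_unique s a _ (fun=> c) `|c|) => //; first exact: bcont_cst.
by apply: deriv_ext (deriv_cst c) => // y; rewrite subrr mulr0.
Qed.

Lemma resvD s a f g x : 0 < a -> bcont f -> bcont g ->
  resv s a (fun x => f x + g x) x = resv s a f x + resv s a g x.
Proof.
move=> a0 bf bg; have [_ [M fM]] := bf; have [_ [N gN]] := bg.
apply: (@resv_unique s a _ (fun x => resv s a f x + resv s a g x) (M + N)) => //.
- exact: bcontD.
- by move=> y; rewrite (le_trans (ler_normD _ _))// lerD// resv_bound.
- apply: deriv_ext (deriv_add (resv_deriv s a0 bf) (resv_deriv s a0 bg)) => // y; ring.
Qed.

Lemma resvZ s a c f x : 0 < a -> bcont f ->
  resv s a (fun x => c * f x) x = c * resv s a f x.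
Proof.
move=> a0 bf; have [_ [M fM]] := bf.
apply: (@resv_unique s a _ (fun x => c * resv s a f x) (`|c| * M)) => //.
- exact: bcontZ.
- by move=> y; rewrite normrM ler_wpM2l// resv_bound.
- apply: deriv_ext (deriv_scale c (resv_deriv s a0 bf)) => // y; ring.
Qed.

Lemma resvB s a f g x : 0 < a -> bcont f -> bcont g ->
  resv s a (fun x => f x - g x) x = resv s a f x - resv s a g x.
Proof.
move=> a0 bf bg; rewrite -[X in _ - X]mul1r -mulNr -resvZ// -resvD//; last exact: bcontZ.
by congr (resv s a _ x); apply/funext => y; rewrite mulN1r.
Qed.

Lemma resv_mono s a f g x : 0 < a -> bcont f -> bcont g -> (forall x, f x <= g x) ->
  resv s a f x <= resv s a g x.
Proof.
move=> a0 bf bg fg; rewrite -subr_ge0 -resvB//; apply: resv_ge0 => //; first exact: bcontB.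
by move=> y; rewrite subr_ge0.
Qed.

(* Jensen, from the positivity of the averages of [(g - t) ^+ 2] with [t] the average of [g] *)
Lemma resv_sqr s a g x : 0 < a -> bcont g ->
  resv s a g x ^+ 2 <= resv s a (fun x => g x ^+ 2) x.
Proof.
move=> a0 bg; set t := resv s a g x.
have b2 := bcontX 2 bg; have bc := bcont_cst (t ^+ 2); have b1 := bcontZ (2 * t) bg.
have := @resv_ge0 s a (fun y => (g y ^+ 2 + t ^+ 2) - 2 * t * g y) a0 (bcontB (bcontD b2 bc) b1) _ x.
rewrite resvB//; last exact: bcontD.
rewrite resvD// resv_cst// resvZ// -/t => h.
have : 0 <= resv s a (fun x : R => g x ^+ 2) x + t ^+ 2 - 2 * t * t.
  by apply: h => y; have := sqr_ge0 (g y - t); rewrite expr2; lra.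
by rewrite -mulrA -expr2; lra.
Qed.

Lemma resv_norm s a g x : 0 < a -> bcont g ->
  `|resv s a g x| <= resv s a (fun x => `|g x|) x.
Proof.
move=> a0 bg; have bn := bcont_norm bg; rewrite ler_norml; apply/andP; split.
  rewrite lerNl -mulN1r -resvZ//; apply: resv_mono => //; first exact: bcontZ.
  by move=> y; rewrite mulN1r -normrN ler_norm.
by apply: resv_mono => // y; exact: ler_norm.
Qed.

(* [W a] is the resolvent [(1 - D^2 / a^2)^-1]. *)
Definition W a g x : R := 2^-1 * (resv true a g x + resv false a g x).

Lemma W_bcont a g : 0 < a -> bcont g -> bcont (W a g).
Proof. by move=> a0 bg; apply: bcontZ; apply: bcontD; exact: resv_bcont. Qed.

Lemma W_deriv a g : 0 < a -> bcont g -> exists2 w1,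
  [/\ deriv_of (W a g) w1, deriv_of w1 (fun x => a ^+ 2 * (W a g x - g x)) & bcont w1] &
  ((forall x, 0 <= g x) -> forall x, `|w1 x| <= a * W a g x).
Proof.
move=> a0 bg; have dp := resv_deriv true a0 bg; have dm := resv_deriv false a0 bg.
exists (fun x => a / 2 * (resv true a g x - resv false a g x)).
  split.
  - apply: deriv_ext (deriv_scale 2^-1 (deriv_add dp dm)) => // x.
    by rewrite /sg; field.
  - apply: deriv_ext (deriv_scale (a / 2) (deriv_sub dp dm)) => // x.
    by rewrite /W /sg; field.
  - by apply: bcontZ; apply: bcontB; exact: resv_bcont.
move=> g0 x; rewrite /W; have := resv_ge0 true a0 bg g0 x; have := resv_ge0 false a0 bg g0 x.
set p := resv true a g x; set m := resv false a g x => m0 p0.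
have a2 : 0 <= a / 2 := divr_ge0 (ltW a0) (ler0n _ 2).
rewrite normrM (ger0_norm a2).
have pm : `|p - m| <= p + m by rewrite ler_norml; lra.
by have := ler_wpM2l a2 pm; lra.
Qed.

(** From [W'' = a^2 (W - g)] with [g] nonnegative comes [W'' <= a^2 W]. Averages at rate [a] are the
    source of all nonconstant slowly varying functions below. *)
Lemma W_slow a g : 0 < a -> bcont g -> (forall x, 0 <= g x) -> slow a (W a g).
Proof.
move=> a0 bg g0; have [w1 [d1 d2 b1] h] := W_deriv a0 bg.
have bW := W_bcont a0 bg; have W0 x : 0 <= W a g x.
  by apply: mulr_ge0; [rewrite invr_ge0 ler0n|apply: addr_ge0; exact: resv_ge0].
exists w1, (fun x => a ^+ 2 * (W a g x - g x)); split.
  by split => //; apply: bcontZ; exact: bcontB.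
by move=> x; split => //; [exact: h|rewrite ler_wpM2l ?sqr_ge0// lerBlDr lerDl].
Qed.

Lemma WD a f g x : 0 < a -> bcont f -> bcont g ->
  W a (fun x => f x + g x) x = W a f x + W a g x.
Proof. by move=> a0 bf bg; rewrite /W !resvD//; lra. Qed.

Lemma WZ a c f x : 0 < a -> bcont f -> W a (fun x => c * f x) x = c * W a f x.
Proof. by move=> a0 bf; rewrite /W !resvZ//; lra. Qed.

Lemma W_norm a g x : 0 < a -> bcont g -> `|W a g x| <= W a (fun x => `|g x|) x.
Proof.
move=> a0 bg; rewrite /W normrM ger0_norm ?invr_ge0// ler_wpM2l ?invr_ge0//.
by rewrite (le_trans (ler_normD _ _))// lerD// resv_norm.
Qed.

Lemma W_mono a f g x : 0 < a -> bcont f -> bcont g -> (forall x, f x <= g x) -> W a f x <= W a g x.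
Proof.
by move=> a0 bf bg fg; rewrite /W ler_wpM2l ?invr_ge0// lerD// resv_mono.
Qed.

Lemma W_sqr a g x : 0 < a -> bcont g -> W a g x ^+ 2 <= W a (fun x => g x ^+ 2) x.
Proof.
move=> a0 bg; have := resv_sqr true x a0 bg; have := resv_sqr false x a0 bg.
rewrite /W; set p := resv true a g x; set m := resv false a g x.
have := sqr_ge0 (p - m); nra.
Qed.

Lemma W_sum a (I : Type) (r : seq I) (f : I -> R -> R) x : 0 < a ->
  (forall i, bcont (f i)) -> W a (fun x => \sum_(i <- r) f i x) x = \sum_(i <- r) W a (f i) x.
Proof.
move=> a0 bf; elim: r => [|i r ih].
  rewrite big_nil; under eq_fun do rewrite big_nil.
  by rewrite /W !resv_cst// addr0 mulr0.
rewrite big_cons -ih -WD//; last by apply: bcont_sum.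
by congr (W a _ x); apply/funext => y; rewrite big_cons.
Qed.

Lemma bcont_cos l : bcont (fun x => cos (l * x)).
Proof.
split; first exact: (deriv_continuous (deriv_cos l)).
by exists 1 => x; rewrite ler_norml cos_geN1 cos_le1.
Qed.

Lemma bcont_sin l : bcont (fun x => sin (l * x)).
Proof.
split; first exact: (deriv_continuous (deriv_sin l)).
by exists 1 => x; rewrite ler_norml sin_geN1 sin_le1.
Qed.

Let den_neq0 a l : 0 < a -> a ^+ 2 + l ^+ 2 != 0.
Proof. by move=> a0; rewrite gt_eqF// ltr_wpDr ?sqr_ge0// exprn_gt0. Qed.

Lemma resv_cos s a l x : 0 < a ->
  resv s a (fun x => cos (l * x)) x =
  (a ^+ 2 + l ^+ 2)^-1 * (a ^+ 2 * cos (l * x) - sg s * a * l * sin (l * x)).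
Proof.
move=> a0; have D0 := den_neq0 l a0; have bc := bcont_cos l; have bs := bcont_sin l.
have dz := deriv_scale (a ^+ 2 + l ^+ 2)^-1 (deriv_sub (deriv_scale (a ^+ 2) (deriv_cos l)) (deriv_scale (sg s * a * l) (deriv_sin l))).
have [_ [M zM]] : bcont (fun x => (a ^+ 2 + l ^+ 2)^-1 * (a ^+ 2 * cos (l * x) - sg s * a * l * sin (l * x))).
  by apply: bcontZ; apply: bcontB; exact: bcontZ.
apply: (@resv_unique s a _ _ M a0 bc zM).
apply: deriv_ext dz => // y.
have s2 : sg s * sg s = 1 by rewrite /sg; case: s {zM} => /=; rewrite ?mulrNN mul1r.
have -> : sg s * a * ((a ^+ 2 + l ^+ 2)^-1 * (a ^+ 2 * cos (l * y) - sg s * a * l * sin (l * y)) - cos (l * y)) =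
 sg s * a * ((a ^+ 2 + l ^+ 2)^-1 * (a ^+ 2 * cos (l * y)) - cos (l * y)) - (sg s * sg s) * (a * a * ((a ^+ 2 + l ^+ 2)^-1 * (l * sin (l * y)))) by ring.
by rewrite s2; field.
Qed.

Lemma resv_sin s a l x : 0 < a ->
  resv s a (fun x => sin (l * x)) x =
  (a ^+ 2 + l ^+ 2)^-1 * (a ^+ 2 * sin (l * x) + sg s * a * l * cos (l * x)).
Proof.
move=> a0; have D0 := den_neq0 l a0; have bc := bcont_cos l; have bs := bcont_sin l.
have dz := deriv_scale (a ^+ 2 + l ^+ 2)^-1 (deriv_add (deriv_scale (a ^+ 2) (deriv_sin l)) (deriv_scale (sg s * a * l) (deriv_cos l))).
have [_ [M zM]] : bcont (fun x => (a ^+ 2 + l ^+ 2)^-1 * (a ^+ 2 * sin (l * x) + sg s * a * l * cos (l * x))).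
  by apply: bcontZ; apply: bcontD; exact: bcontZ.
apply: (@resv_unique s a _ _ M a0 bs zM).
apply: deriv_ext dz => // y.
have s2 : sg s * sg s = 1 by rewrite /sg; case: s {zM} => /=; rewrite ?mulrNN mul1r.
have -> : sg s * a * ((a ^+ 2 + l ^+ 2)^-1 * (a ^+ 2 * sin (l * y) + sg s * a * l * cos (l * y)) - sin (l * y)) =
 sg s * a * ((a ^+ 2 + l ^+ 2)^-1 * (a ^+ 2 * sin (l * y)) - sin (l * y)) + (sg s * sg s) * (a * a * ((a ^+ 2 + l ^+ 2)^-1 * (l * cos (l * y)))) by ring.
by rewrite s2; field.
Qed.

Lemma W_cos a l x : 0 < a ->
  W a (fun x => cos (l * x)) x = a ^+ 2 / (a ^+ 2 + l ^+ 2) * cos (l * x).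
Proof. by move=> a0; rewrite /W !resv_cos// /sg; field; exact: den_neq0. Qed.

Lemma W_sin a l x : 0 < a ->
  W a (fun x => sin (l * x)) x = a ^+ 2 / (a ^+ 2 + l ^+ 2) * sin (l * x).
Proof. by move=> a0; rewrite /W !resv_sin// /sg; field; exact: den_neq0. Qed.

End Resolvent.

(** * The maximal inequality *)

Section Maximal.
Variable R : realType.
Implicit Types (f g h : R -> R) (x y : R) (s : bool).

Definition bigmax (I : Type) (r : seq I) (v : I -> R) : R := \big[Num.max/0]_(i <- r) v i.

Lemma bigmax_cons (I : Type) (i : I) (r : seq I) (v : I -> R) :
  bigmax (i :: r) v = Num.max (v i) (bigmax r v).
Proof. by rewrite /bigmax big_cons. Qed.

Lemma bigmax_ge0 (I : Type) (r : seq I) (v : I -> R) : 0 <= bigmax r v.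
Proof.
elim: r => [|i r ih]; first by rewrite /bigmax big_nil.
by rewrite bigmax_cons le_max ih orbT.
Qed.

Lemma le_bigmax_in (I : eqType) (r : seq I) (v : I -> R) i : i \in r -> v i <= bigmax r v.
Proof.
elim: r => // j r ih; rewrite inE bigmax_cons le_max => /predU1P[->|/ih ->].
  by rewrite lexx.
by rewrite orbT.
Qed.

Lemma bigmax_seq_le (I : eqType) (r : seq I) (v : I -> R) c : 0 <= c ->
  (forall i, i \in r -> v i <= c) -> bigmax r v <= c.
Proof.
move=> c0; elim: r => [_|j r ih h]; first by rewrite /bigmax big_nil.
rewrite bigmax_cons ge_max h ?mem_head//=.
by apply: ih => i ir; apply: h; rewrite inE ir orbT.
Qed.

Lemma bigmax_attained (I : eqType) (r : seq I) (v : I -> R) : r != [::] ->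
  (forall i, 0 <= v i) -> exists2 i, i \in r & bigmax r v = v i.
Proof.
move=> r0 v0; elim: r r0 => // j r ih _; rewrite bigmax_cons.
have [->|/ih[i ir ->]] := eqVneq r [::].
  by exists j; rewrite ?mem_head// /bigmax big_nil; apply/max_idPl.
have [h|h] := leP (v i) (v j).
  by exists j; rewrite ?mem_head//; apply/max_idPl.
by exists i; rewrite ?inE ?ir ?orbT//; apply/max_idPr/ltW.
Qed.

Lemma bcontV f e : 0 < e -> bcont f -> (forall x, e <= f x) -> bcont (fun x => (f x)^-1).
Proof.
move=> e0 [cf _] fe; have f0 x : 0 < f x := lt_le_trans e0 (fe x).
split; last first.
  exists e^-1 => x; rewrite ger0_norm; last by rewrite invr_ge0 ltW.
  by rewrite lef_pV2 ?posrE.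
by move=> x; apply: cvgV; [rewrite gt_eqF|exact: cf].
Qed.

Lemma young2 (c a b : R) : 0 < c -> a * b <= c * a ^+ 2 + (4 * c)^-1 * b ^+ 2.
Proof.
move=> c0; have := sqr_ge0 (2 * c * a - b); rewrite sqrrB => h.
have i0 : 0 < (4 * c)^-1 by rewrite invr_gt0 mulr_gt0.
have : 0 <= (4 * c)^-1 * ((2 * c * a) ^+ 2 - 2 * c * a * b *+ 2 + b ^+ 2).
  by rewrite mulr_ge0// ltW.
have -> : (4 * c)^-1 * ((2 * c * a) ^+ 2 - 2 * c * a * b *+ 2 + b ^+ 2) =
  c * a ^+ 2 + (4 * c)^-1 * b ^+ 2 - a * b by field; rewrite gt_eqF.
by rewrite subr_ge0.
Qed.

Lemma E_cst0 y : E y (fun=> 0) = 0 :> R.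
Proof.
transitivity (E y (fun x : R => 0 * (fun=> 0) x)); first by apply: E_eq => x; rewrite mul0r.
by rewrite EZ ?mul0r//; exact: bcont_cst.
Qed.

Section L2.
Variables (I : eqType) (r : seq I) (a : I -> R) (s : bool) (g : R -> R).
Hypotheses (a1 : forall i, 1 <= a i) (bg : bcont g) (g0 : forall x, 0 <= g x).

Let a0 i : 0 < a i. Proof. exact: lt_le_trans (a1 i). Qed.
Let v i : R -> R := resv s (a i) g.
Let v0 i x : 0 <= v i x. Proof. exact: resv_ge0. Qed.
Let bv i : bcont (v i). Proof. exact: resv_bcont. Qed.
Let M x := bigmax r (fun i => v i x).
Let M0 x : 0 <= M x. Proof. exact: bigmax_ge0. Qed.
Let bM : bcont M. Proof. exact: bcont_bigmax. Qed.

Let alg1 (t b p q r' w : R) :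
  - t * b * (p - q) * r' + p * (t * b * (r' - w)) = t * b * (q * r' - p * w).
Proof. by ring. Qed.

Let alg2 (t b c p q p' q' : R) :
  - t * b * (p - q) * p' + p * (- t * c * (p' - q')) =
  t * (b * (q * p') + c * (q' * p) - (b + c) * (p * p')).
Proof. by ring. Qed.

(* Linearise the maximum as [M ~ \sum_i u i] with [u i] carried by [v i >= M - e], and let [A i] be the
   average of [u i] in the opposite direction.  The derivatives of [A i * v i] and of [A i * A j] are
   explicit, and [E] of a derivative is small, which is a duality argument without Fubini. *)
Lemma maximal_L2_eps y e : 0 < e ->
  E y (fun x => M x ^+ 2) <= 16 * E y (fun x => g x ^+ 2) + 2 * e * E y M.
Proof.
move=> e0.
have [r0|r0] := eqVneq r [::].
  have -> : M = fun=> 0 by apply/funext => x; rewrite /M r0 /bigmax big_nil.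
  rewrite expr0n /= E_cst0.
  rewrite mulr0 addr0 mulr_ge0//; apply: E_ge0; first exact: bcontX.
  by move=> x; exact: sqr_ge0.
(* The quotients [d i / S] form a partition of unity in which [v i] is within [e] of the maximum
   wherever [d i] is positive. The margin [e] keeps them continuous and, since the maximum is
   attained, keeps [S] above [e]. *)
pose d i x := Num.max (v i x - M x + e) 0.
pose S x := \sum_(i <- r) d i x.
have d0 i x : 0 <= d i x by rewrite le_max lexx orbT.
have bd i : bcont (d i).
  by apply: bcont_max; [apply: bcontD; [exact: bcontB|exact: bcont_cst]|exact: bcont_cst].
have bS : bcont S by apply: bcont_sum.
have Se x : e <= S x.
  have [i ir Mi] := bigmax_attained r0 (fun i => v0 i x).
  have : d i x = e by rewrite /d /M Mi subrr add0r; apply/max_idPl/ltW.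
  move=> <-; rewrite /S; elim: r ir => // j r' ih; rewrite inE big_cons => /predU1P[->|/ih h].
    by rewrite lerDl sumr_ge0.
  by rewrite (le_trans h)// lerDr.
have S0 x : 0 < S x := lt_le_trans e0 (Se x).
have bV := bcontV e0 bS Se.
pose u i x := d i x * (S x)^-1 * M x.
have u0 i x : 0 <= u i x.
  by rewrite /u; apply: mulr_ge0 => //; apply: mulr_ge0 => //; rewrite invr_ge0 ltW.
have bu i : bcont (u i) by apply: bcontM => //; exact: bcontM.
have sumu x : \sum_(i <- r) u i x = M x.
  by rewrite /u -!mulr_suml -/(S x) mulfV ?mul1r// gt_eqF.
have sumuv x : M x ^+ 2 - e * M x <= \sum_(i <- r) u i x * v i x.
  have -> : M x ^+ 2 - e * M x = \sum_(i <- r) u i x * (M x - e).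
    by rewrite -mulr_suml sumu; ring.
  apply: ler_sum => i _; have [di|di] := leP (v i x - M x + e) 0.
    by rewrite /u /d; move/max_idPr: di => ->; rewrite !mul0r.
  by apply: ler_wpM2l => //; lra.
pose A i : R -> R := resv (~~ s) (a i) (u i).
have A0 i x : 0 <= A i x by exact: resv_ge0.
have bA i : bcont (A i) by exact: resv_bcont.
have sgN : sg R (~~ s) = - sg R s by rewrite /sg; case: s; rewrite ?opprK.
have sg1 : `|sg R s| = 1 by rewrite /sg; case: s; rewrite ?normrN normr1.
have dv i : deriv_of (v i) (fun x => sg R s * a i * (v i x - g x)) := resv_deriv s (a0 i) bg.
have dA i : deriv_of (A i) (fun x => - sg R s * a i * (A i x - u i x)).
  by rewrite -sgN; exact: (resv_deriv (~~ s) (a0 i) (bu i)).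
move: A A0 bA dA => A A0 bA dA.
pose AA x := \sum_(i <- r) A i x.
have AA0 x : 0 <= AA x by exact: sumr_ge0.
have bAA : bcont AA by exact: bcont_sum.
(* Up to sign the derivative of [A i * v i] is [a i * (u i * v i - A i * g)], so the average passes
   from [g] to [u i]. The error of [E_ibp] gets divided by [a i >= 1]. *)
have step1 i : i \in r -> E y (fun x => u i x * v i x) <=
    E y (fun x => A i x * g x) + 32^-1 * E y (fun x => A i x * M x).
  move=> ir; have d1 := deriv_mul (dA i) (dv i).
  pose H' x := sg R s * a i * (u i x * v i x - A i x * g x).
  have dH : deriv_of (fun x => A i x * v i x) H'.
    by apply: deriv_ext d1 => x; [reflexivity|exact: alg1].
  have b1 : bcont (fun x => u i x * v i x) by exact: bcontM.
  have b2 : bcont (fun x => A i x * g x) by exact: bcontM.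
  have := E_ibp y (bcontM (bA i) (bv i)) (bcontZ _ (bcontB b1 b2)) dH.
  rewrite EZ; last exact: bcontB.
  rewrite EB// normrM normrM sg1 mul1r (ger0_norm (ltW (a0 i))) => h.
  have h2 : E y (fun x => `|A i x * v i x|) <= E y (fun x => A i x * M x).
    apply: E_mono; [exact/bcont_norm/bcontM|exact: bcontM|] => x.
    rewrite ger0_norm ?mulr_ge0//; apply: ler_wpM2l => //; exact: (le_bigmax_in (fun i => v i x) ir).
  have h3 := ler_peMl (normr_ge0 (E y (fun x => u i x * v i x) - E y (fun x => A i x * g x))) (a1 i).
  have := ler_norm (E y (fun x => u i x * v i x) - E y (fun x => A i x * g x)); lra.
have S1 : E y (fun x => M x ^+ 2) - e * E y M <= E y (fun x => AA x * g x) + 32^-1 * E y (fun x => AA x * M x).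
  have bM2 := bcontX 2 bM.
  rewrite -EZ// -EB//; last exact: bcontZ.
  apply: le_trans (E_mono y _ _ sumuv) _.
  - by apply: bcontB => //; exact: bcontZ.
  - by apply: bcont_sum => i _; exact: bcontM.
  rewrite E_sum; last by move=> i _; exact: bcontM.
  have -> : E y (fun x => AA x * g x) = \sum_(i <- r) E y (fun x => A i x * g x).
    rewrite -E_sum; last by move=> i _; exact: bcontM.
    by apply: E_eq => x; rewrite mulr_suml.
  have -> : E y (fun x => AA x * M x) = \sum_(i <- r) E y (fun x => A i x * M x).
    rewrite -E_sum; last by move=> i _; exact: bcontM.
    by apply: E_eq => x; rewrite mulr_suml.
  rewrite mulr_sumr -big_split /= big_seq [leRHS]big_seq.
  by apply: ler_sum => i ir; exact: step1.
(* The derivative of [A i * A j] gives [(a i + a j) * E (A i * A j)] as [a i * E (u i * A j) + a j *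
   E (u j * A i)] up to an error. After division both coefficients are at most 1, and the error is
   at most 1/32 over [a i + a j >= 2]. Summing over [i] and [j] turns the [u] into [M]. *)
have step2 i j : E y (fun x => A i x * A j x) <=
    E y (fun x => u i x * A j x) + E y (fun x => u j x * A i x) + 64^-1 * E y (fun x => A i x * A j x).
  have d1 := deriv_mul (dA i) (dA j).
  pose H' x := sg R s * (a i * (u i x * A j x) + a j * (u j x * A i x) - (a i + a j) * (A i x * A j x)).
  have dH : deriv_of (fun x => A i x * A j x) H'.
    by apply: deriv_ext d1 => x; [reflexivity|exact: alg2].
  have b1 : bcont (fun x => u i x * A j x) by exact: bcontM.
  have b2 : bcont (fun x => u j x * A i x) by exact: bcontM.
  have b3 : bcont (fun x => A i x * A j x) by exact: bcontM.
  have b4 := bcontD (bcontZ (a i) b1) (bcontZ (a j) b2).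
  have := E_ibp y b3 (bcontZ (sg R s) (bcontB b4 (bcontZ (a i + a j) b3))) dH.
  rewrite EZ; last by apply: bcontB => //; exact: bcontZ.
  rewrite EB//; last exact: bcontZ.
  rewrite ED; [|exact: bcontZ|exact: bcontZ].
  rewrite !EZ// normrM sg1 mul1r.
  have -> : E y (fun x => `|A i x * A j x|) = E y (fun x => A i x * A j x).
    by apply: E_eq => x; rewrite ger0_norm// mulr_ge0.
  have n1 : 0 <= E y (fun x => u i x * A j x) by apply: E_ge0 => // x; exact: mulr_ge0.
  have n2 : 0 <= E y (fun x => u j x * A i x) by apply: E_ge0 => // x; exact: mulr_ge0.
  have n3 : 0 <= E y (fun x => A i x * A j x) by apply: E_ge0 => // x; exact: mulr_ge0.
  move: n1 n2 n3; set p := E y _; set q := E y _; set t := E y _ => p0 q0 t0.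
  rewrite ler_norml => /andP[h _]; have ai := a1 i; have aj := a1 j.
  have aij : 0 < a i + a j by lra.
  rewrite -(ler_pM2l aij); have := ler_wpM2r t0 ai; have := ler_wpM2r t0 aj.
  have := mulr_ge0 (ltW (a0 i)) q0; have := mulr_ge0 (ltW (a0 j)) p0; lra.
have S2 : E y (fun x => AA x ^+ 2) <= 2 * E y (fun x => AA x * M x) + 64^-1 * E y (fun x => AA x ^+ 2).
  have sumE (f h : I -> R -> R) (F G : R -> R) : (forall i, bcont (f i)) -> (forall i, bcont (h i)) ->
      (forall x, \sum_(i <- r) f i x = F x) -> (forall x, \sum_(i <- r) h i x = G x) ->
      E y (fun x => F x * G x) = \sum_(i <- r) \sum_(j <- r) E y (fun x => f i x * h j x).
    move=> bf bh fF hG; have bfh i j : bcont (fun x => f i x * h j x) by exact: bcontM.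
    under eq_bigr do rewrite -E_sum//; rewrite -E_sum; last by move=> i _; exact: bcont_sum.
    apply: E_eq => x; rewrite -fF -hG mulr_suml; apply: eq_bigr => i _.
    by rewrite mulr_sumr.
  have -> : E y (fun x => AA x ^+ 2) = \sum_(i <- r) \sum_(j <- r) E y (fun x => A i x * A j x).
    by rewrite -(sumE A A AA AA)//.
  have e1 : E y (fun x => AA x * M x) = \sum_(i <- r) \sum_(j <- r) E y (fun x => u i x * A j x).
    rewrite -(sumE u A M AA bu bA sumu (fun x => erefl)).
    by apply: E_eq => x; rewrite mulrC.
  have e2 : E y (fun x => AA x * M x) = \sum_(i <- r) \sum_(j <- r) E y (fun x => u j x * A i x).
    by rewrite e1 exchange_big.
  have -> : 2 * E y (fun x => AA x * M x) = E y (fun x => AA x * M x) + E y (fun x => AA x * M x) by ring.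
  rewrite {1}e1 e2 mulr_sumr -!big_split /=.
  apply: ler_sum => i _; rewrite mulr_sumr -!big_split /=; apply: ler_sum => j _; exact: step2.
have bAM := bcontM bAA bM; have bA2 := bcontX 2 bAA; have bM2 := bcontX 2 bM; have bg2 := bcontX 2 bg.
(* With these Young weights [S2] bounds the mean of [AA ^+ 2] by less than 5 times that of [M ^+ 2].
   In [S1] the mean of [M ^+ 2] then returns with a total coefficient below 1 and is absorbed, which
   leaves room under the constant 16. *)
have Z1 : E y (fun x => AA x * M x) <= 4^-1 * E y (fun x => AA x ^+ 2) + E y (fun x => M x ^+ 2).
  rewrite -EZ// -ED//; last exact: bcontZ.
  apply: E_mono => // [|x]; first by apply: bcontD => //; exact: bcontZ.
  have := young2 (AA x) (M x) (c := 4^-1) (ltac:(by rewrite invr_gt0)).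
  by rewrite mulfV ?invr1 ?mul1r.
have F1 : E y (fun x => AA x * g x) <= 40^-1 * E y (fun x => AA x ^+ 2) + 10 * E y (fun x => g x ^+ 2).
  rewrite -!EZ// -ED//; [|exact: bcontZ|exact: bcontZ].
  apply: E_mono => // [| |x]; first exact: bcontM.
    by apply: bcontD; exact: bcontZ.
  have := young2 (AA x) (g x) (c := 40^-1) (ltac:(by rewrite invr_gt0)).
  have -> : (4 * 40^-1)^-1 = 10 :> R by field.
  by [].
have MM : 0 <= E y M by exact: E_ge0.
have M20 : 0 <= E y (fun x => M x ^+ 2) by apply: E_ge0 => // x; exact: sqr_ge0.
have := mulr_ge0 (ltW e0) MM; have := E_ge0 y bg2 (fun x => sqr_ge0 _).
lra.
Qed.

Lemma maximal_L2 y : E y (fun x => M x ^+ 2) <= 16 * E y (fun x => g x ^+ 2).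
Proof.
apply/ler_addgt0Pr => e e0.
have MM : 0 <= E y M by exact: E_ge0.
have d0 : 0 < e / (2 * (E y M + 1)) by rewrite divr_gt0// mulr_gt0// ltr_wpDl.
apply: le_trans (maximal_L2_eps y d0) _; rewrite lerD2l.
have -> : 2 * (e / (2 * (E y M + 1))) * E y M = e * (E y M / (E y M + 1)).
  by field; rewrite gt_eqF// ltr_wpDl.
apply: ler_piMr; first exact: ltW.
by rewrite ler_pdivrMr ?ltr_wpDl// mul1r lerDl.
Qed.

End L2.

(** Jensen bounds the square of the maximal function of [g] by the maximal function of [g ^+ 2], so
    doubling the exponent amounts to replacing [g] by its square, and the constant stays 16. *)
Lemma maximal_pow (I : eqType) (r : seq I) (a : I -> R) s g m y :
  (forall i, 1 <= a i) -> bcont g -> (forall x, 0 <= g x) ->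
  E y (fun x => bigmax r (fun i => resv s (a i) g x) ^+ (2 ^ m.+1)) <=
  16 * E y (fun x => g x ^+ (2 ^ m.+1)).
Proof.
move=> a1; have a0 i : 0 < a i := lt_le_trans ltr01 (a1 i).
elim: m g => [|m ih] g bg g0; first exact: maximal_L2.
have bg2 := bcontX 2 bg.
apply: le_trans (_ : _ <= 16 * E y (fun x => (g x ^+ 2) ^+ (2 ^ m.+1))) _; last first.
  by under eq_fun do rewrite -exprM -expnS.
apply: le_trans (ih _ bg2 (fun x => sqr_ge0 _)).
apply: E_mono.
- apply: bcontX; apply: bcont_bigmax => i; exact: resv_bcont.
- apply: bcontX; apply: bcont_bigmax => i; exact: resv_bcont.
move=> x; rewrite expnS exprM lerXn2r ?nnegrE ?exprn_ge0 ?bigmax_ge0//.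
have [r0|r0] := eqVneq r [::]; first by rewrite r0 /bigmax !big_nil expr0n.
have [i ir ->] := bigmax_attained r0 (fun i => resv_ge0 s (a0 i) bg g0 x).
apply: le_trans (resv_sqr s x (a0 i) bg) _.
exact: (le_bigmax_in (fun i => resv s (a i) (fun x => g x ^+ 2) x)).
Qed.

Let le_add16 (z p q t : R) : z <= p + q -> p <= 16 * t -> q <= 16 * t -> z <= 32 * t.
Proof. lra. Qed.

Lemma maximal_W (I : eqType) (r : seq I) (a : I -> R) g m y :
  (forall i, 1 <= a i) -> bcont g -> (forall x, 0 <= g x) ->
  E y (fun x => bigmax r (fun i => W (a i) g x) ^+ (2 ^ m.+1)) <=
  32 * E y (fun x => g x ^+ (2 ^ m.+1)).
Proof.
move=> a1 bg g0; have a0 i : 0 < a i := lt_le_trans ltr01 (a1 i).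
have bR s : bcont (fun x => bigmax r (fun i => resv s (a i) g x) ^+ (2 ^ m.+1)).
  by apply: bcontX; apply: bcont_bigmax => i; exact: resv_bcont.
apply: le_add16 (maximal_pow r true m y a1 bg g0) (maximal_pow r false m y a1 bg g0).
rewrite -ED//; apply: E_mono.
- by apply: bcontX; apply: bcont_bigmax => i; exact: W_bcont.
- exact: bcontD.
move=> x; set p := bigmax r (fun i => resv true _ _ _); set q := bigmax r (fun i => resv false _ _ _).
have p0 : 0 <= p := bigmax_ge0 _ _; have q0 : 0 <= q := bigmax_ge0 _ _.
have h : bigmax r (fun i => W (a i) g x) <= Num.max p q.
  apply: bigmax_seq_le => [|i ir]; first by rewrite le_max p0.
  have := le_bigmax_in (fun i => resv true (a i) g x) ir; rewrite -/p => hp.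
  have := le_bigmax_in (fun i => resv false (a i) g x) ir; rewrite -/q => hq.
  have pm : p <= Num.max p q by rewrite le_max lexx.
  have qm : q <= Num.max p q by rewrite le_max lexx orbT.
  by rewrite /W; lra.
have := lerXn2r (2 ^ m.+1) _ _ h; rewrite !nnegrE bigmax_ge0 le_max p0 => /(_ isT isT) h2.
apply: (le_trans h2).
by have [pq|pq] := leP p q; rewrite ?lerDl ?lerDr exprn_ge0.
Qed.

End Maximal.

(** * Littlewood-Paley pieces *)

Section LittlewoodPaley.
Variable R : realType.
Implicit Types (g h : R -> R) (x y : R).

Lemma exprB_le (u v : R) m : 0 <= u <= v -> v ^+ m - u ^+ m <= m%:R * (v - u) * v ^+ m.-1.
Proof.
move=> /andP[u0 uv]; have v0 := le_trans u0 uv.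
case: m => [|m]; first by rewrite !expr0 subrr !mul0r.
rewrite subrXX -mulrA mulrCA ler_wpM2l ?subr_ge0//=.
rewrite [leRHS]mulr_natl -[in leRHS](card_ord m.+1) -sumr_const.
apply: ler_sum => i _ /=.
apply: (@le_trans _ _ (v ^+ (m - i) * v ^+ i)).
  by rewrite ler_wpM2l ?exprn_ge0// lerXn2r ?nnegrE.
by rewrite -exprD subnK// -ltnS.
Qed.

(** The discrete form of [d (B^(m+1)) = (m+1) B^m dB], with the increasing factor taken at the right
    end of each step. *)
Lemma sum_expr_le (b : nat -> R) m n : (forall j, 0 <= b j) ->
  (\sum_(j < n) b j) ^+ m.+1 <= m.+1%:R * \sum_(j < n) b j * (\sum_(i < j.+1) b i) ^+ m.
Proof.
move=> b0; elim: n => [|n ih]; first by rewrite !big_ord0 expr0n mulr0.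
rewrite [in leRHS]big_ord_recr /= mulrDr.
set t := \sum_(i < n.+1) b i; set u := \sum_(j < n) b j in ih *.
have tu : t = u + b n by rewrite /t big_ord_recr.
have := @exprB_le u t m.+1; rewrite tu lerDl b0 sumr_ge0// => /(_ isT).
have -> : u + b n - u = b n by rewrite addrC addKr.
by rewrite /= -mulrA; lra.
Qed.

(** Two factors are peeled off and the sum is ordered so that the tail [j >= l] multiplies a product
    of terms of index at most [l]. For [b = Lb] that product varies no faster than scale [l], which
    is what lets the tail be averaged through it. *)
Lemma sum_expr_le2 (b : nat -> R) m n : (forall j, 0 <= b j) ->
  (\sum_(j < n) b j) ^+ m.+2 <= (m.+2 * m.+1)%:R *
    \sum_(l < n) b l * (\sum_(i < l.+1) b i) ^+ m * \sum_(j < n | (l <= j)%N) b j.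
Proof.
move=> b0; apply: le_trans (sum_expr_le m.+1 n b0) _.
rewrite natrM -mulrA ler_wpM2l// mulr_sumr.
have h (j : 'I_n) : b j * (\sum_(i < j.+1) b i) ^+ m.+1 <=
    \sum_(l < n | (l <= j)%N) m.+1%:R * (b l * (\sum_(i < l.+1) b i) ^+ m * b j).
  rewrite mulrC; have := ler_wpM2r (b0 j) (sum_expr_le m j.+1 b0) => h2.
  apply: (le_trans h2); rewrite -mulrA mulr_suml mulr_sumr.
  rewrite (big_ord_widen n (fun i => m.+1%:R * (b i * (\sum_(i0 < i.+1) b i0) ^+ m * b j)))//.
apply: le_trans (ler_sum _ (fun j _ => h j)) _.
rewrite (exchange_big_dep xpredT)//=.
apply: ler_sum => l _; rewrite -mulr_sumr ler_wpM2l//.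
by rewrite -mulr_sumr.
Qed.

Definition rate (j : nat) : R := 2 ^+ j.

Lemma rate_gt0 j : 0 < rate j. Proof. exact: exprn_gt0. Qed.
Lemma rate_ge1 j : 1 <= rate j. Proof. exact: exprn_ege1 (ler1n _ 2). Qed.
Lemma rateS j : rate j.+1 = 2 * rate j. Proof. exact: exprS. Qed.
Lemma rate_le i j : (i <= j)%N -> rate i <= rate j.
Proof. by move=> ij; apply: ler_weXn2l => //; exact: ler1n. Qed.

Variable f : R -> R.
Hypothesis bf : bcont f.

(* With [X j := LX j] and [w j := Lw j] one has [w j '' = 4/3 * 4^j * (X j - X j.+1)], so that [Lg j] is,
   up to a second derivative, a telescoping difference of squares. *)
Definition LX j : R -> R := W (rate j) f.
Definition Lg j x : R := (LX j.+1 x - LX j x) ^+ 2.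
Definition Lb j : R -> R := W (rate j) (Lg j).
Definition Lw j x : R := 3^-1 * (4 * LX j x - LX j.+1 x).

Lemma bLX j : bcont (LX j). Proof. exact: W_bcont (rate_gt0 j) bf. Qed.
Lemma bLg j : bcont (Lg j). Proof. by apply: bcontX; apply: bcontB; exact: bLX. Qed.
Lemma Lg_ge0 j x : 0 <= Lg j x. Proof. exact: sqr_ge0. Qed.
Lemma bLb j : bcont (Lb j). Proof. exact: W_bcont (rate_gt0 j) (bLg j). Qed.
Lemma Lb_slow j : slow (rate j) (Lb j).
Proof. exact: W_slow (rate_gt0 j) (bLg j) (Lg_ge0 j). Qed.
Lemma Lb_ge0 j x : 0 <= Lb j x. Proof. exact: slow_ge0 (Lb_slow j). Qed.

Let algLw (X Y a f' : R) : 3^-1 * (4 * (a ^+ 2 * (X - f')) - (2 * a) ^+ 2 * (Y - f')) =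
  4 / 3 * a ^+ 2 * (X - Y).
Proof. by field. Qed.

(** The coefficients are those for which the remainder is a multiple of [w * w''], with [w = Lw j];
    and [w * w''] is at most half the second derivative of [w ^+ 2]. The difference of squares
    telescopes in [j]. *)
Let algLg (X Y : R) : (Y - X) ^+ 2 = 3 / 5 * (Y ^+ 2 - X ^+ 2) + 9 / 10 * (3^-1 * (4 * X - Y) * (4 / 3 * (X - Y))).
Proof. by field. Qed.

Let algw2 (z c : R) : z != 0 -> 4 / 3 * c = (z ^+ 2)^-1 * (4 / 3 * z ^+ 2 * c).
Proof. by move=> z0; field. Qed.

Let alglin (P G a b X Y Z u : R) : P * G <= P * (a * (X - Y) + b * (Z * u)) ->
  P * G <= a * (P * X - P * Y) + b * Z * (P * u).
Proof. by move=> /le_trans; apply; rewrite le_eqVlt; apply/orP; left; apply/eqP; ring. Qed.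

Let algNw (X Y n : R) : X ^+ 2 <= n -> Y ^+ 2 <= n -> (3^-1 * (4 * X - Y)) ^+ 2 <= 25 / 9 * n.
Proof. by have := sqr_ge0 (X + Y); rewrite !expr2; lra. Qed.

Let algE (G X Y T V u w n : R) : G <= 3 / 5 * (X - Y) + 9 / 20 * T * u ->
  u <= V * w -> w <= 25 / 9 * n -> 0 <= T -> 0 <= V -> G <= 3 / 5 * (X - Y) + 5 / 4 * (V * T) * n.
Proof.
move=> h1 h2 h3 T0 V0; have h4 := ler_wpM2l T0 (le_trans h2 (ler_wpM2l V0 h3)); lra.
Qed.

Let algS (S k l n X X1 g : R) : S <= 3 / 5 * X + 5 / 3 * (l - k) * n ->
  g <= 3 / 5 * (X1 - X) + 5 / 4 * k * n -> S + g <= 3 / 5 * X1 + 5 / 3 * (l - 4^-1 * k) * n.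
Proof. lra. Qed.

Let algT (S k l n X : R) : X <= n -> l * n <= 2^-1 * n -> 0 <= k * n -> 0 <= n ->
  S <= 3 / 5 * X + 5 / 3 * (l - k) * n -> 2 * S <= 3 * n.
Proof. lra. Qed.

Let E_lin3 y a b g h k : bcont g -> bcont h -> bcont k ->
  E y (fun x => a * (g x - h x) + b * k x) = a * (E y g - E y h) + b * E y k.
Proof.
move=> bg bh bk; rewrite ED; [|by apply: bcontZ; exact: bcontB|exact: bcontZ].
by rewrite !EZ ?EB//; exact: bcontB.
Qed.

Let Lg_identity j : exists u1 u2, [/\ deriv_of (fun x => Lw j x ^+ 2) u1, deriv_of u1 u2,
   bcont u1, bcont u2 &
   forall x, Lg j x <= 3 / 5 * (LX j.+1 x ^+ 2 - LX j x ^+ 2) + 9 / 20 * ((rate j ^+ 2)^-1 * u2 x)].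
Proof.
have r0 := rate_gt0 j; have [v1 [d1 d1' b1] _] := W_deriv r0 bf.
have [v2 [d2 d2' b2] _] := W_deriv (rate_gt0 j.+1) bf.
pose w1 x := 3^-1 * (4 * v1 x - v2 x).
pose w2 x := 4 / 3 * rate j ^+ 2 * (LX j x - LX j.+1 x).
have dw : deriv_of (Lw j) w1 := deriv_scale 3^-1 (deriv_sub (deriv_scale 4 d1) d2).
have dw1 : deriv_of w1 w2.
  apply: deriv_ext (deriv_scale 3^-1 (deriv_sub (deriv_scale 4 d1') d2')) => x; first by [].
  by rewrite rateS -/(LX j x) algLw /w2 /LX rateS.
have bw : bcont (Lw j) by apply: bcontZ; apply: bcontB; [apply: bcontZ; exact: bLX|exact: bLX].
have bw1 : bcont w1 by apply: bcontZ; apply: bcontB => //; exact: bcontZ.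
have bw2 : bcont w2 by apply: bcontZ; apply: bcontB; exact: bLX.
exists (fun x => 2 * (Lw j x * w1 x)), (fun x => 2 * (w1 x * w1 x + Lw j x * w2 x)); split.
- apply: deriv_ext (deriv_mul dw dw) => x; first by rewrite expr2.
  by rewrite mulr_natl mulr2n [w1 x * _]mulrC.
- apply: deriv_ext (deriv_scale 2 (deriv_mul dw dw1)) => x; reflexivity.
- by apply: bcontZ; exact: bcontM.
- by apply: bcontZ; apply: bcontD; exact: bcontM.
move=> x; rewrite /Lg algLg lerD2l.
have -> : 4 / 3 * (LX j x - LX j.+1 x) = (rate j ^+ 2)^-1 * w2 x.
  by rewrite /w2; apply: algw2; rewrite gt_eqF.
have i0 : 0 <= (rate j ^+ 2)^-1 by rewrite invr_ge0 sqr_ge0.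
have := mulr_ge0 i0 (sqr_ge0 (w1 x)); rewrite -/(Lw j x); move: (_^-1) (w1 x) (w2 x) (Lw j x) => A B C D; rewrite expr2; lra.
Qed.

(** [Lb] solves [Lb'' = rate^2 (Lb - Lg)]. Moving the two derivatives onto [Psi] costs at most half
    of [rate^2], so half of the [Lb] term is absorbed: averaging at a rate well above [rho] passes
    through [Psi]. *)
Lemma E_Lb_le y rho Psi j : 0 <= rho -> slow rho Psi -> 2 * (rho + 16^-1) ^+ 2 <= rate j ^+ 2 ->
  E y (fun x => Psi x * Lb j x) <= 2 * E y (fun x => Psi x * Lg j x).
Proof.
move=> r0 sP rj; have [b1 [d1 d2 bb1] _] := W_deriv (rate_gt0 j) (bLg j).
have bP := slow_bcont sP; have bb2 := bcontZ (rate j ^+ 2) (bcontB (bLb j) (bLg j)).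
have := E_slow_ibp y r0 sP d1 d2 (bLb j) bb1 bb2 (Lb_ge0 j).
have bPb := bcontM bP (bLb j); have bPg := bcontM bP (bLg j).
have -> : E y (fun x => Psi x * (rate j ^+ 2 * (Lb j x - Lg j x))) =
   rate j ^+ 2 * (E y (fun x => Psi x * Lb j x) - E y (fun x => Psi x * Lg j x)).
  rewrite -EB// -EZ; last exact: bcontB.
  by apply: E_eq => x; rewrite mulrCA mulrBr.
have p0 : 0 <= E y (fun x => Psi x * Lb j x).
  by apply: E_ge0 => // x; apply: mulr_ge0; [exact: slow_ge0 sP|exact: Lb_ge0].
have rr : 0 < rate j ^+ 2 by rewrite exprn_gt0// rate_gt0.
move: p0; set p := E y _; set q := E y _ => p0 h.
rewrite -(ler_pM2l rr); have := ler_wpM2r p0 rj; move: h; rewrite -/(Lb j) -/p.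
set t := (_ + _) ^+ 2; set z := rate j ^+ 2; lra.
Qed.

Let E_Lg_le y rho Psi N j : 0 <= rho -> slow rho Psi -> bcont N ->
  (forall x, LX j x ^+ 2 <= N x) -> (forall x, LX j.+1 x ^+ 2 <= N x) ->
  E y (fun x => Psi x * Lg j x) <= 3 / 5 * (E y (fun x => Psi x * LX j.+1 x ^+ 2) - E y (fun x => Psi x * LX j x ^+ 2))
   + 5 / 4 * ((rho + 16^-1) ^+ 2 / rate j ^+ 2) * E y (fun x => Psi x * N x).
Proof.
move=> r0 sP bN N1 N2; have [u1 [u2 [d1 d2 bu1 bu2 h]]] := Lg_identity j.
have bP := slow_bcont sP; have P0 x : 0 <= Psi x := slow_ge0 x sP.
have bw2 : bcont (fun x => Lw j x ^+ 2).
  by apply: bcontX; apply: bcontZ; apply: bcontB; [apply: bcontZ; exact: bLX|exact: bLX].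
have := E_slow_ibp y r0 sP d1 d2 bw2 bu1 bu2 (fun x => sqr_ge0 _).
have bX1 := bcontM bP (bcontX 2 (bLX j.+1)); have bX := bcontM bP (bcontX 2 (bLX j)).
have bPu := bcontM bP bu2; have bPN := bcontM bP bN; have bPw := bcontM bP bw2.
have h1 : E y (fun x => Psi x * Lg j x) <= E y (fun x => 3 / 5 * (Psi x * LX j.+1 x ^+ 2 - Psi x * LX j x ^+ 2)
   + 9 / 20 * (rate j ^+ 2)^-1 * (Psi x * u2 x)).
  apply: E_mono; [exact: bcontM bP (bLg j)|by apply: bcontD; apply: bcontZ => //; exact: bcontB|] => x.
  exact: alglin (ler_wpM2l (P0 x) (h x)).
rewrite E_lin3// in h1.
have h2 : E y (fun x => Psi x * Lw j x ^+ 2) <= 25 / 9 * E y (fun x => Psi x * N x).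
  rewrite -EZ//; apply: E_mono => //; first exact: bcontZ.
  move=> x; rewrite [leRHS]mulrCA; apply: ler_wpM2l => //; exact: algNw.
have i0 : 0 <= (rate j ^+ 2)^-1 by rewrite invr_ge0 sqr_ge0.
move=> h3; exact: algE h1 h3 h2 i0 (sqr_ge0 _).
Qed.

(** The differences of squares telescope to the top scale, and the errors are proportional to
    [rate j ^- 2], a geometric series dominated by its first term, which the hypothesis on [rate l]
    makes at most 1/2. *)
Lemma E_sum_Lb_le y rho Psi N l J : 0 <= rho -> slow rho Psi -> bcont N ->
  (forall j x, (j <= J)%N -> LX j x ^+ 2 <= N x) ->
  2 * (rho + 16^-1) ^+ 2 <= rate l ^+ 2 ->
  E y (fun x => Psi x * \sum_(j < J | (l <= j)%N) Lb j x) <= 3 * E y (fun x => Psi x * N x).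
Proof.
move=> r0 sP bN hN rl; have bP := slow_bcont sP; have P0 x : 0 <= Psi x := slow_ge0 x sP.
have N0 x : 0 <= N x := le_trans (sqr_ge0 _) (hN 0%N x (leq0n _)).
have EN0 : 0 <= E y (fun x => Psi x * N x).
  by apply: E_ge0; [exact: bcontM|move=> x; exact: mulr_ge0].
have -> : E y (fun x => Psi x * \sum_(j < J | (l <= j)%N) Lb j x) =
    \sum_(j < J | (l <= j)%N) E y (fun x => Psi x * Lb j x).
  rewrite -E_sum; last by move=> j _; exact: bcontM bP (bLb j).
  by apply: E_eq => x; rewrite mulr_sumr.
apply: (@le_trans _ _ (2 * \sum_(j < J | (l <= j)%N) E y (fun x => Psi x * Lg j x))).
  rewrite mulr_sumr; apply: ler_sum => j lj; apply: E_Lb_le r0 sP _.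
  by apply: le_trans rl _; rewrite lerXn2r ?nnegrE ?(ltW (rate_gt0 _))// rate_le.
pose kap (j : nat) := (rho + 16^-1) ^+ 2 / rate j ^+ 2.
have kap0 j : 0 <= kap j by rewrite divr_ge0 ?sqr_ge0.
have kapS j : kap j.+1 = 4^-1 * kap j.
  by rewrite /kap rateS; field; rewrite gt_eqF// rate_gt0.
have kapl : kap l <= 2^-1.
  by rewrite /kap ler_pdivrMr ?exprn_gt0 ?rate_gt0//; lra.
(* As [kap] is divided by 4 at each scale, [5 / 4 * kap j] equals [5 / 3 * (kap j - kap j.+1)], and
   the errors telescope as well. *)
have key n : (n <= J)%N -> (l <= n)%N -> \sum_(j < n | (l <= j)%N) E y (fun x => Psi x * Lg j x) <=
   3 / 5 * E y (fun x => Psi x * LX n x ^+ 2) + 5 / 3 * (kap l - kap n) * E y (fun x => Psi x * N x).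
  elim: n => [_|n ih nJ].
    rewrite leqn0 => /eqP ->; rewrite big_ord0 subrr mulr0 mul0r addr0; apply: mulr_ge0; first by rewrite divr_ge0.
    apply: E_ge0 => [|x]; first by apply: bcontM bP _; exact: bcontX 2 (bLX 0).
    by apply: mulr_ge0 => //; exact: sqr_ge0.
  rewrite leq_eqVlt => /predU1P[ln|ln].
    rewrite big1 => [|j]; last by rewrite ln leqNgt ltn_ord.
    rewrite ln subrr mulr0 mul0r addr0; apply: mulr_ge0; first by rewrite divr_ge0.
    apply: E_ge0 => [|x]; first by apply: bcontM bP _; exact: bcontX 2 (bLX _).
    by apply: mulr_ge0 => //; exact: sqr_ge0.
  have IH := ih (ltnW nJ) ln.
  rewrite big_mkcond big_ord_recr /= -big_mkcond /= (ln : (l <= n)%N).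
  have := E_Lg_le y r0 sP bN (hN n ^~ (ltnW nJ)) (hN n.+1 ^~ nJ).
  by rewrite -/(kap n) kapS; exact: algS IH.
have [lJ|lJ] := leqP l J; last first.
  rewrite big1 => [|j lj]; first by rewrite mulr0 mulr_ge0.
  by have := leq_trans lj (ltnW (ltn_ord j)); rewrite leqNgt lJ.
have := key J (leqnn _) lJ.
have h : E y (fun x => Psi x * LX J x ^+ 2) <= E y (fun x => Psi x * N x).
  apply: E_mono => [||x]; [by apply: bcontM bP _; exact: bcontX 2 (bLX _)|exact: bcontM|].
  by apply: ler_wpM2l => //; exact: hN.
by exact: algT h (ler_wpM2r EN0 kapl) (mulr_ge0 (kap0 J) EN0) EN0.
Qed.

Lemma young_pow (c u v : R) m : 0 < c -> 0 <= u -> 0 <= v ->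
  u ^+ m * v <= c^-1 * u ^+ m.+1 + c ^+ m * v ^+ m.+1.
Proof.
move=> c0 u0 v0; have [h|h] := leP (c * v) u.
  apply: (@le_trans _ _ (c^-1 * u ^+ m.+1)); last first.
    by rewrite lerDl mulr_ge0 ?exprn_ge0// ltW.
  rewrite exprSr mulrCA ler_wpM2l ?exprn_ge0//.
  by rewrite ler_pdivlMl.
apply: (@le_trans _ _ (c ^+ m * v ^+ m.+1)); last first.
  by rewrite lerDr mulr_ge0 ?exprn_ge0// invr_ge0 ltW.
rewrite exprSr mulrA -exprMn ler_wpM2r// lerXn2r ?nnegrE ?mulr_ge0// ltW//.
Qed.

(* [m.+3] is the number of scales [j] above [l] that are too close to [l] for averaging at rate
   [2 ^+ j] to pass through a function varying at rate [m.+1%:R * 2 ^+ l]. *)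
Definition LC (m : nat) : R := 2 * ((m.+2 * m.+1)%:R * (m.+3 + 3)%:R).

(** After [sum_expr_le2] each tail meets [Psi l], which varies at rate [m.+1%:R * rate l]. The
    scales too close to [l] are bounded one by one by [N], the remaining ones by [E_sum_Lb_le]. A
    Young inequality then returns a power of the square function. *)
Lemma E_LP_ge2 y N m J : bcont N ->
  (forall j x, (j <= J)%N -> LX j x ^+ 2 <= N x) ->
  (forall j x, (j < J)%N -> Lb j x <= N x) ->
  E y (fun x => (\sum_(j < J) Lb j x) ^+ m.+2) <= LC m ^+ m.+2 * E y (fun x => N x ^+ m.+2).
Proof.
move=> bN hN hb; have N0 x : 0 <= N x := le_trans (sqr_ge0 _) (hN 0%N x (leq0n _)).
pose A x := \sum_(j < J) Lb j x.
have bA : bcont A by apply: bcont_sum => j _; exact: bLb.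
have A0 x : 0 <= A x by apply: sumr_ge0 => j _; exact: Lb_ge0.
pose Al l x := \sum_(i < l.+1) Lb i x.
pose Psi l x := Lb l x * Al l x ^+ m.
pose d := m.+3.
have sPsi l : slow (m.+1%:R * rate l) (Psi l).
  have r0 := ltW (rate_gt0 l).
  have sA : slow (rate l) (Al l).
    apply: slow_sum => // i _; apply: slow_le (Lb_slow i).
    by rewrite (ltW (rate_gt0 i)) rate_le// -ltnS.
  have := slowM (Lb_slow l) (slowX m sA).
  by have -> : rate l + m%:R * rate l = m.+1%:R * rate l by rewrite -natr1; ring.
have P0 l x : 0 <= Psi l x := slow_ge0 x (sPsi l).
have bP l : bcont (Psi l) := slow_bcont (sPsi l).
have rl l : 2 * (m.+1%:R * rate l + 16^-1) ^+ 2 <= rate (l + d) ^+ 2.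
  have r1 := rate_ge1 l.
  have h1 : m.+1%:R * rate l + 16^-1 <= m.+2%:R * rate l by rewrite -[m.+2%:R]natr1; lra.
  have h0 : 0 <= m.+1%:R * rate l + 16^-1 by rewrite addr_ge0// mulr_ge0// ltW// rate_gt0.
  have h2 : 2 * (m.+2%:R * rate l) <= rate (l + d).
    rewrite /rate exprD [leRHS]mulrC mulrA ler_wpM2r ?exprn_ge0//.
    by rewrite -natrM -natrX ler_nat /d expnS leq_mul2l /= ltnW// ltn_expl.
  have h3 : (2 * (m.+1%:R * rate l + 16^-1)) ^+ 2 <= rate (l + d) ^+ 2.
    by rewrite lerXn2r ?nnegrE ?mulr_ge0 ?(ltW (rate_gt0 _))//; lra.
  by move: h3; rewrite exprMn; have := sqr_ge0 (m.+1%:R * rate l + 16^-1); lra.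
have bPN l : bcont (fun x => Psi l x * N x) by exact: bcontM.
have PN0 l : 0 <= E y (fun x => Psi l x * N x).
  by apply: E_ge0 => // x; exact: mulr_ge0.
have step l : E y (fun x => Psi l x * \sum_(j < J | (l <= j)%N) Lb j x) <= (d + 3)%:R * E y (fun x => Psi l x * N x).
  have bs : bcont (fun x => Psi l x * \sum_(j < J | (l + d <= j)%N) Lb j x).
    by apply: bcontM (bP l) _; apply: bcont_sum => j _; exact: bLb.
  apply: (@le_trans _ _ (E y (fun x => d%:R * (Psi l x * N x) + Psi l x * \sum_(j < J | (l + d <= j)%N) Lb j x))).
    apply: E_mono => [||x].
    - by apply: bcontM (bP l) _; apply: bcont_sum => j _; exact: bLb.
    - by apply: bcontD => //; exact: bcontZ.
    rewrite mulrCA -mulrDr ler_wpM2l//.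
    rewrite (bigID (fun j : 'I_J => (l + d <= j)%N)) /= addrC lerD//.
      apply: (@le_trans _ _ (\sum_(j < J | (l <= j)%N && ~~ (l + d <= j)%N) N x)).
        by apply: ler_sum => j _; exact: hb.
      rewrite sumr_const -[N x *+ _]mulr_natl ler_wpM2r// ler_nat.
      rewrite -[X in (_ <= X)%N](size_iota l) cardE -(size_map val).
      apply: uniq_leq_size; first by rewrite map_inj_uniq ?enum_uniq//; exact: val_inj.
      move=> i /mapP[j jm ->]; move: jm; rewrite mem_enum => /andP[lj]; rewrite -ltnNge => jl.
      by rewrite mem_iota lj.
    rewrite [leRHS]big_mkcond [leLHS]big_mkcond; apply: ler_sum => j _.
    case: ifP => [/andP[_ ->]//|_]; case: ifP => // _; exact: Lb_ge0.
  rewrite ED ?EZ//; last exact: bcontZ.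
  have := E_sum_Lb_le y (mulr_ge0 (ler0n R m.+1) (ltW (rate_gt0 l))) (sPsi l) bN hN (rl l).
  by rewrite natrD mulrDl; lra.
have sumPsi x : \sum_(l < J) Psi l x <= A x ^+ m.+1.
  rewrite exprS [leRHS]mulrC mulr_sumr; apply: ler_sum => l _.
  rewrite /Psi [leLHS]mulrC ler_wpM2r ?Lb_ge0// lerXn2r ?nnegrE ?A0//.
    by apply: sumr_ge0 => i _; exact: Lb_ge0.
  rewrite /Al /A (big_ord_widen J (fun i => Lb i x))// [leRHS](bigID (fun i : 'I_J => (i < l.+1)%N))/=.
  by rewrite lerDl sumr_ge0// => i _; exact: Lb_ge0.
have K0 : 0 < (m.+2 * m.+1)%:R * (m.+3 + 3)%:R :> R by rewrite mulr_gt0// ltr0n.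
set K := (m.+2 * m.+1)%:R * (m.+3 + 3)%:R in K0 *.
have main : E y (fun x => A x ^+ m.+2) <= K * E y (fun x => A x ^+ m.+1 * N x).
  apply: (@le_trans _ _ (E y (fun x => (m.+2 * m.+1)%:R * \sum_(l < J) Psi l x * \sum_(j < J | (l <= j)%N) Lb j x))).
    apply: E_mono => [||x]; first exact: bcontX.
      apply: bcontZ; apply: bcont_sum => l _; apply: bcontM => //.
      by apply: bcont_sum => j _; exact: bLb.
    exact: (@sum_expr_le2 (fun j => Lb j x) m J (fun j => Lb_ge0 j x)).
  have bPs l : bcont (fun x => Psi l x * \sum_(j < J | (l <= j)%N) Lb j x).
    by apply: bcontM => //; apply: bcont_sum => j _; exact: bLb.
  rewrite EZ; last by apply: bcont_sum => l _; exact: bPs.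
  rewrite E_sum// /K -mulrA ler_wpM2l//.
  apply: (@le_trans _ _ (\sum_(l < J) (d + 3)%:R * E y (fun x => Psi l x * N x))).
    by apply: ler_sum => l _; exact: step.
  rewrite -mulr_sumr ler_wpM2l// -E_sum//; apply: E_mono => [||x].
  - by apply: bcont_sum => l _.
  - by apply: bcontM => //; exact: bcontX.
  by rewrite -mulr_suml ler_wpM2r.
have bAm : bcont (fun x => A x ^+ m.+2) by exact: bcontX.
have bNm : bcont (fun x => N x ^+ m.+2) by exact: bcontX.
(* The constant [2 * K] is chosen so that, after multiplication by [K], half of the left-hand side
   of [main] comes back and is absorbed. *)
have yg : E y (fun x => A x ^+ m.+1 * N x) <= (2 * K)^-1 * E y (fun x => A x ^+ m.+2) + (2 * K) ^+ m.+1 * E y (fun x => N x ^+ m.+2).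
  rewrite -!EZ// -ED; [|exact: bcontZ|exact: bcontZ].
  apply: E_mono => [||x]; first by apply: bcontM => //; exact: bcontX.
    by apply: bcontD; exact: bcontZ.
  by apply: young_pow => //; rewrite mulr_gt0.
rewrite /LC -/K -/A exprS -2!mulrA.
move: main yg; set a := E y _; set b := E y _; set c := E y _ => main yg.
have := le_trans main (ler_wpM2l (ltW K0) yg).
have -> : K * ((2 * K)^-1 * a + (2 * K) ^+ m.+1 * c) = 2^-1 * a + K * ((2 * K) ^+ m.+1 * c).
  by field; rewrite gt_eqF.
move: (K * _) => z; lra.
Qed.

End LittlewoodPaley.

(** * Powers of the Littlewood-Paley square function *)

Section LPfinal.
Variable R : realType.
Implicit Types (f g h : R -> R) (x y : R).

Lemma exprD_le (u v : R) n : 0 <= u -> 0 <= v -> (u + v) ^+ n <= 2 ^+ n * (u ^+ n + v ^+ n).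
Proof.
move=> u0 v0; apply: (@le_trans _ _ ((2 * Num.max u v) ^+ n)).
  rewrite lerXn2r ?nnegrE ?addr_ge0 ?mulr_ge0 ?le_max ?u0//.
  have um : u <= Num.max u v by rewrite le_max lexx.
  have vm : v <= Num.max u v by rewrite le_max lexx orbT.
  lra.
rewrite exprMn ler_wpM2l ?exprn_ge0//.
by have [uv|uv] := leP u v; rewrite ?lerDl ?lerDr exprn_ge0.
Qed.

Let LC_ge0 m : 0 <= LC R m.
Proof. by rewrite /LC mulr_ge0// mulr_ge0. Qed.

Let algF (p u v c : R) : u <= 32 * p -> v <= 32 * (c * u) -> c * u <= c * (32 * p) ->
  u + v <= (32 + 32 * (c * 32)) * p.
Proof. lra. Qed.

Let algH (e p q : R) : e <= 3 * p -> p <= 32 * q -> e <= 96 * q.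
Proof. lra. Qed.

(** The majorant required by [E_LP_ge2] must dominate both [LX j ^+ 2] and [Lb j]. The first is
    below the squared maximal function [M] of [f]; the second is an average of [Lg j <= 4 * M ^+ 2],
    so a maximal function is taken a second time. For exponent 1 the constant function [Psi = 1] is
    enough. *)
Lemma LP_pow k : exists2 C : R, 0 <= C & forall f J y, bcont f ->
  E y (fun x => (\sum_(j < J) Lb f j x) ^+ (2 ^ k)) <= C * E y (fun x => `|f x| ^+ (2 ^ k.+1)).
Proof.
have a1 j : 1 <= rate R j := rate_ge1 R j; have a0 j : 0 < rate R j := rate_gt0 R j.
pose M f J x := bigmax (iota 0 J.+1) (fun j => W (rate R j) (fun x => `|f x|) x).
have M0 f J x : 0 <= M f J x by exact: bigmax_ge0.
have bM f J : bcont f -> bcont (M f J).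
  by move=> bf; apply: bcont_bigmax => j; exact: W_bcont (a0 j) (bcont_norm bf).
have XM f J j x : bcont f -> (j <= J)%N -> `|LX f j x| <= M f J x.
  move=> bf jJ; apply: le_trans (W_norm x (a0 j) bf) _.
  apply: (le_bigmax_in (fun j => W (rate R j) (fun x => `|f x|) x)).
  by rewrite mem_iota add0n ltnS.
have XM2 f J j x : bcont f -> (j <= J)%N -> LX f j x ^+ 2 <= M f J x ^+ 2.
  by move=> bf jJ; rewrite -[LX f j x ^+ 2]real_normK ?num_real// lerXn2r ?nnegrE// XM.
have EM m f J y : bcont f -> E y (fun x => M f J x ^+ (2 ^ m.+1)) <= 32 * E y (fun x => `|f x| ^+ (2 ^ m.+1)).
  by move=> bf; apply: maximal_W => //; exact: bcont_norm.
case: k => [|k].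
  exists 96; first by rewrite ler0n.
  move=> f J y bf; have bA : bcont (fun x => \sum_(j < J) Lb f j x).
    by apply: bcont_sum => j _; exact: bLb.
  have := @E_sum_Lb_le R f bf y 0 (fun=> 1) (fun x => M f J x ^+ 2) 0%N J (lexx 0)
    (slow_cst ler01 (lexx 0)) (bcontX 2 (bM f J bf)) (fun j x jJ => XM2 f J j x bf jJ) _.
  have -> : (fun x => (\sum_(j < J) Lb f j x) ^+ (2 ^ 0)) = (fun x => 1 * \sum_(j < J | (0 <= j)%N) Lb f j x).
    by apply/funext => x; rewrite mul1r.
  have -> : (fun x => 1 * M f J x ^+ 2) = (fun x => M f J x ^+ (2 ^ 1)).
    by apply/funext => x; rewrite mul1r.
  move=> h; apply: algH (h _) (EM 0%N f J y bf).
  by rewrite /rate expr0 expr1n add0r; lra.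
pose q := (2 ^ k.+1)%N.
have [m qm] : exists m, q = m.+2.
  have q2 : (2 <= q)%N by rewrite /q expnS leq_pmulr// expn_gt0.
  by exists (q - 2)%N; rewrite -addn2 subnK.
exists (LC R m ^+ q * (2 ^+ q * (32 + 32 * (4 ^+ q * 32)))).
  apply: mulr_ge0; first exact: exprn_ge0 (LC_ge0 _).
  apply: mulr_ge0; first exact: exprn_ge0.
  apply: addr_ge0; first exact: ler0n.
  apply: mulr_ge0; first exact: ler0n.
  by apply: mulr_ge0; [exact: exprn_ge0|exact: ler0n].
move=> f J y bf; pose G x := 4 * M f J x ^+ 2.
have bG : bcont G by apply: bcontZ; apply: bcontX; exact: bM.
have G0 x : 0 <= G x by rewrite /G mulr_ge0// sqr_ge0.
pose T x := bigmax (iota 0 J.+1) (fun j => W (rate R j) G x).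
have bT : bcont T by apply: bcont_bigmax => j; exact: W_bcont.
have T0 x : 0 <= T x by exact: bigmax_ge0.
pose N x := M f J x ^+ 2 + T x.
have bN : bcont N by apply: bcontD => //; apply: bcontX; exact: bM.
have hX j x : (j <= J)%N -> LX f j x ^+ 2 <= N x.
  by move=> jJ; apply: le_trans (XM2 _ _ _ _ bf jJ) _; rewrite lerDl.
have hb j x : (j < J)%N -> Lb f j x <= N x.
  move=> jJ; apply: (@le_trans _ _ (W (rate R j) G x)).
    apply: W_mono => //; first exact: bLg.
    move=> z; rewrite /G /Lg.
    have := XM f J j z bf (ltnW jJ); have := XM f J j.+1 z bf jJ.
    move: (LX f j z) (LX f j.+1 z) (M f J z) => X Y Z; rewrite !ler_norml => /andP[h1 h2] /andP[h3 h4].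
    have -> : 4 * Z ^+ 2 = (2 * Z) ^+ 2 by ring.
    rewrite -[(Y - X) ^+ 2]real_normK ?num_real// lerXn2r ?nnegrE//; last first.
      by rewrite ler_norml; apply/andP; split; lra.
    lra.
  apply: (@le_trans _ _ (T x)); last by rewrite lerDr sqr_ge0.
  apply: (le_bigmax_in (fun j => W (rate R j) G x)).
  by rewrite mem_iota add0n ltnS (ltnW jJ).
have := @E_LP_ge2 R f bf y N m J bN hX hb; rewrite -qm => h.
apply: (le_trans h); rewrite -[leRHS]mulrA; apply: ler_wpM2l; first exact: exprn_ge0 (LC_ge0 _).
have bM2 : bcont (fun x => (M f J x ^+ 2) ^+ q) by apply: bcontX; apply: bcontX; exact: bM.
have bTq : bcont (fun x => T x ^+ q) by apply: bcontX.
have h1 : E y (fun x => N x ^+ q) <= 2 ^+ q * (E y (fun x => (M f J x ^+ 2) ^+ q) + E y (fun x => T x ^+ q)).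
  rewrite -ED// -EZ; last exact: bcontD.
  apply: E_mono; [exact: bcontX|by apply: bcontZ; exact: bcontD|] => x.
  by apply: exprD_le; [exact: sqr_ge0|exact: T0].
have h2 : E y (fun x => (M f J x ^+ 2) ^+ q) <= 32 * E y (fun x => `|f x| ^+ (2 ^ k.+2)).
  by have := EM k.+1 f J y bf; under [in X in X -> _]eq_fun do rewrite expnS exprM.
have h3 : E y (fun x => T x ^+ q) <= 32 * E y (fun x => G x ^+ q) by exact: maximal_W.
have h4 : E y (fun x => G x ^+ q) = 4 ^+ q * E y (fun x => (M f J x ^+ 2) ^+ q).
  by rewrite -EZ//; apply: E_eq => x; rewrite /G exprMn.
apply: (le_trans h1); rewrite -[leRHS]mulrA; apply: ler_wpM2l; first by rewrite exprn_ge0.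
rewrite h4 in h3.
have h5 := ler_wpM2l (exprn_ge0 q (ler0n R 4)) h2.
exact: algF h2 h3 h5.
Qed.

End LPfinal.

(** * A band-limited weight *)

Section BandLimited.
Variable R : realType.
Implicit Types (x y l c e : R).

Definition sinc x : R := if x == 0 then 1 else sin x / x.

Lemma sinc_mul x : sinc x * x = sin x.
Proof. by rewrite /sinc; case: eqP => [->|/eqP x0]; rewrite ?sin0 ?mulr0// divfK. Qed.

Lemma sincN x : sinc (- x) = sinc x.
Proof. by rewrite /sinc oppr_eq0; case: eqP => // _; rewrite sinN invrN mulrNN. Qed.

Let sin_le_pos x : 0 <= x -> `|sin x| <= x.
Proof.
move=> x0; have ds : deriv_of (@sin R) cos by move=> z; exact: is_derive_sin.
have di := @deriv_id R.
have h1 := deriv_diff_le ds di x0 (fun z _ => cos_le1 z).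
have h2 := deriv_diff_le (deriv_opp ds) di x0 _.
rewrite ler_norml; move: h1; rewrite sin0 => h1.
have := h2 (fun z _ => ltac:(by rewrite lerNl cos_geN1)); rewrite sin0 /= => h3.
by apply/andP; split; lra.
Qed.

Lemma sin_le x : `|sin x| <= `|x|.
Proof.
have [x0|x0] := leP 0 x; first by rewrite (ger0_norm x0) sin_le_pos.
by rewrite (ltr0_norm x0) -normrN -sinN sin_le_pos// oppr_ge0 ltW.
Qed.

Lemma sinc_sqr_le1 x : sinc x ^+ 2 <= 1.
Proof.
rewrite /sinc; case: eqP => [_|/eqP x0]; first by rewrite expr1n.
rewrite expr_div_n ler_pdivrMr ?exprn_even_gt0// mul1r.
by rewrite -[leLHS]real_normK ?num_real// -[leRHS]real_normK ?num_real// lerXn2r ?nnegrE// sin_le.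
Qed.

Lemma sinc_sqr_le x : sinc x ^+ 2 <= 2 * (1 + x ^+ 2)^-1.
Proof.
rewrite ler_pdivlMr ?sqr1_gt0// mulrDr mulr1 -exprMn sinc_mul.
have := sinc_sqr_le1 x; have := cos2Dsin2 x; have := sqr_ge0 (cos x); lra.
Qed.

Lemma sinc_ge x : 0 <= x <= 1 -> 4^-1 <= sinc x ^+ 2.
Proof.
move=> /andP[x0 x1].
have h z : 0 <= z <= x -> 2^-1 <= cos z.
  move=> /andP[z0 zx]; have -> : z = (z / 2) *+ 2 by rewrite -mulr_natr divfK.
  rewrite cos_mulr2n; have := cos2Dsin2 (z / 2); have := sin_le_pos (divr_ge0 z0 (ler0n _ 2)).
  rewrite ler_norml => /andP[h1 h2]; have : sin (z / 2) ^+ 2 <= (z / 2) ^+ 2 by nra.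
  have : (z / 2) ^+ 2 <= 4^-1 by nra.
  rewrite -mulr_natr; lra.
have ds : deriv_of (@sin R) cos by move=> z; exact: is_derive_sin.
have := deriv_diff_le (deriv_lin 2^-1 0) ds x0 h; rewrite mulr0 addr0 sin0 => h2.
have [->|xn0] := eqVneq x 0; first by rewrite /sinc eqxx expr1n invf_le1// ler1n.
have xp : 0 < x by rewrite lt_neqAle eq_sym xn0.
have : 2^-1 <= sinc x by rewrite /sinc (negbTE xn0) ler_pdivlMr//; lra.
nra.
Qed.

Lemma sinc_continuous : continuous sinc.
Proof.
move=> x; have [->|x0] := eqVneq x 0.
  apply/continuous_withinNx; rewrite {2}/sinc eqxx.
  have [/cvg_ex[l hl] dE] := is_derive_sin (0 : R).
  have lE : l = 1 by rewrite -[RHS](@cos0 R) -dE; apply/esym/cvg_lim.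
  rewrite -lE; apply: cvg_trans hl; apply: near_eq_cvg.
  near=> h; have h0 : h != 0 by near: h; exact: nbhs_dnbhs_neq.
  by rewrite /sinc (negbTE h0) sin0 subr0 /= addr0 /GRing.scale /= mulr1 mulrC.
have : (fun y => sin y / y) @ x --> sin x / x.
  exact: (cvgM (@continuous_sin R x) (cvgV x0 cvg_id)).
rewrite /continuous_at {2}/sinc (negbTE x0); apply: cvg_trans; apply: near_eq_cvg.
near=> h; have h0 : h != 0 by near: h; apply: (cvgr_neq0 x) => //; exact: cvg_id.
by rewrite /sinc (negbTE h0).
Unshelve. all: by end_near. Qed.

(* The Fourier transform of [kern e] is supported in [[- 2 * e, 2 * e]]. *)
Definition kern e x : R := sinc (e * x) ^+ 2.

Lemma kern_le e x : 0 < e <= 1 -> kern e x <= 2 / e ^+ 2 * (1 + x ^+ 2)^-1.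
Proof.
move=> /andP[e0 e1]; apply: le_trans (sinc_sqr_le _) _.
rewrite -mulrA ler_wpM2l// -invfM lef_pV2 ?posrE ?mulr_gt0 ?exprn_gt0 ?sqr1_gt0//.
rewrite mulrDr mulr1 exprMn lerD2r expr_le1// ltW//.
Qed.

Lemma kernN e x : kern (- e) x = kern e x.
Proof. by rewrite /kern mulNr sincN. Qed.

Lemma kern_dominated e : e != 0 -> dominated (kern e).
Proof.
wlog e0 : e / 0 < e.
  move=> h en0; have [/h|en] := ltP 0 e; first exact.
  have -> : kern e = kern (- e) by apply/funext => x; rewrite kernN.
  by apply: h; rewrite ?oppr_eq0// oppr_gt0 lt_neqAle en0.
move=> _; have cs1 : continuous (fun x => sinc (e * x)).
  move=> x; apply: (@continuous_comp _ _ _ (fun x => e * x) sinc); last exact: sinc_continuous.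
  by apply: cvgM; [exact: cvg_cst|exact: cvg_id].
split; first exact: (contM cs1 cs1).
exists (2 * (1 + (e ^+ 2)^-1)) => x; rewrite ger0_norm ?sqr_ge0//.
apply: le_trans (sinc_sqr_le _) _; rewrite -mulrA ler_wpM2l//.
rewrite ler_pdivlMr ?sqr1_gt0// mulrC ler_pdivrMr ?sqr1_gt0//.
have i0 : 0 < (e ^+ 2)^-1 by rewrite invr_gt0 exprn_gt0.
have : (e ^+ 2)^-1 * e ^+ 2 = 1 by rewrite mulVf// gt_eqF// exprn_gt0.
move=> h; have : (e ^+ 2)^-1 * e ^+ 2 * x ^+ 2 = x ^+ 2 by rewrite h mul1r.
rewrite exprMn; move: i0 (sqr_ge0 x) (mulr_ge0 (sqr_ge0 e) (sqr_ge0 x)).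
move: ((e ^+ 2)^-1) (e ^+ 2) (x ^+ 2) => i u v i0 v0 uv; lra.
Qed.

Let S1 : R := intR (kern 1).

Let intR_kern_le e c : 0 < e -> 0 < c -> c * intR (kern (c * e)) <= intR (kern e).
Proof.
move=> e0 c0; have d1 := kern_dominated (lt0r_neq0 e0).
have d2 := kern_dominated (lt0r_neq0 (mulr_gt0 c0 e0)).
have dP := prim_deriv (proj1 d1).
have dQ : deriv_of (fun x => c^-1 * prim (kern e) (c * x + 0)) (kern (c * e)).
  apply: deriv_ext (deriv_scale c^-1 (deriv_compl c 0 dP)) => x; first by [].
  by rewrite mulKf ?gt_eqF// addr0 /kern mulrA [e * c]mulrC.
rewrite mulrC -ler_pdivlMr//; apply: cvgr_to_le (intR_cvg dQ d2) _.
near=> n; rewrite -mulrBr mulrC ler_pM2r ?invr_gt0// !addr0.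
apply: intR_ge_itv dP d1 _ _; first by move=> z; exact: sqr_ge0.
rewrite ler_pM2l//; apply: (@le_trans _ _ 0); by rewrite ?oppr_le0 ler0n.
Unshelve. all: by end_near. Qed.

(** [intR_kern_le] applied in both directions, from [1] to [e] and from [e] to [1]. Only the scaling
    of the integral matters; its value [S1] at [e = 1] stays implicit. *)
Lemma intR_kern e : 0 < e -> intR (kern e) = S1 / e.
Proof.
move=> e0; apply/eqP; rewrite eq_le; apply/andP; split.
  rewrite ler_pdivlMr// mulrC; have := intR_kern_le ltr01 e0; by rewrite mulr1.
have := intR_kern_le e0 (divr_gt0 ltr01 e0); rewrite divfK ?gt_eqF// div1r mulrC.
exact.
Qed.

Lemma intR_odd (h : R -> R) : dominated h -> (forall x, h (- x) = - h x) -> intR h = 0.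
Proof.
move=> dh ho; have dP := prim_deriv (proj1 dh); set P := prim h in dP.
have dQ : deriv_of (fun x => P (-1 * x + 0)) h.
  apply: deriv_ext (deriv_compl (-1) 0 dP) => x; first by [].
  by rewrite addr0 !mulN1r ho opprK.
apply: (intR_unique dP dh).
have -> : (fun n : nat => P n%:R - P (- n%:R)) = fun=> 0.
  apply/funext => n; have := deriv_eq n%:R 0 dP dQ.
  rewrite !addr0 mulN1r mulr0 => e; lra.
exact: cvg_cst.
Qed.

Lemma kern_sin e l : e != 0 -> intR (fun x => sin (l * x) * kern e x) = 0.
Proof.
move=> e0; apply: intR_odd; first by apply: bcont_dominated; [exact: bcont_sin|exact: kern_dominated].
by move=> x; rewrite mulrN sinN /kern mulrN sincN mulNr.
Qed.

(** This is [(1 - cos (l * e * x)) / (e * x) ^+ 2], extended continuously to [x = 0] and written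
    with [kern] so that its integral, proportional to [|l|], follows from the scaling. *)
Let s e l x := l ^+ 2 / 2 * kern (l * e / 2) x.

Let s_dom e l : e != 0 -> dominated (s e l).
Proof.
move=> e0; have [->|l0] := eqVneq l 0.
  by rewrite /s; under eq_fun do rewrite expr0n /= mul0r mul0r; exact: dominated0.
by apply: dominated_scale; apply: kern_dominated; rewrite !mulf_neq0// invr_neq0.
Qed.

Let s_int e l : 0 < e -> intR (s e l) = `|l| * (S1 / e).
Proof.
move=> e0; have [->|l0] := eqVneq l 0.
  rewrite normr0 mul0r -[RHS](intR0 R); apply: eq_intR => x; rewrite /s expr0n/= !mul0r//.
have h : l * e / 2 != 0 by rewrite !mulf_neq0// ?gt_eqF// invr_gt0.
rewrite intRZ; last exact: kern_dominated.
have -> : intR (kern (l * e / 2)) = intR (kern (`|l| * e / 2)).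
  have [l1|l1] := leP 0 l; first by rewrite ger0_norm.
  by rewrite ltr0_norm// !mulNr; apply: eq_intR => x; rewrite kernN.
rewrite intR_kern; last by rewrite !mulr_gt0 ?normr_gt0// invr_gt0.
rewrite -[l ^+ 2]real_normK ?num_real//; field.
by rewrite normr_eq0 l0 gt_eqF.
Qed.

Let trig_id (A x : R) : 2 * sin x ^+ 2 * cos (A *+ 2) = - (2 * sin A ^+ 2) + sin (A + x) ^+ 2 + sin (A - x) ^+ 2.
Proof.
rewrite cos_mulr2n sinD sinB; have := cos2Dsin2 A; have := cos2Dsin2 x.
move: (sin x) (cos x) (sin A) (cos A) => a b c d h1 h2.
have -> : (c * b + d * a) ^+ 2 = c ^+ 2 * b ^+ 2 + d ^+ 2 * a ^+ 2 + 2 * (a * b * c * d) by ring.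
have -> : (c * b - d * a) ^+ 2 = c ^+ 2 * b ^+ 2 + d ^+ 2 * a ^+ 2 - 2 * (a * b * c * d) by ring.
have -> : b ^+ 2 = 1 - a ^+ 2 by lra.
have -> : d ^+ 2 = 1 - c ^+ 2 by lra.
ring.
Qed.

Let kern_cos_id e l x : e != 0 -> cos (l * e * x) * kern e x =
  2^-1 * (- s e l x + 2^-1 * s e (l + 2) x + 2^-1 * s e (l - 2) x).
Proof.
move=> e0; rewrite /s /kern; have [->|x0] := eqVneq x 0.
  by rewrite !mulr0 cos0 /sinc eqxx; field.
have sq l' : l' ^+ 2 / 2 * sinc (l' * e / 2 * x) ^+ 2 * (e * x) ^+ 2 = 2 * sin (l' * e / 2 * x) ^+ 2.
  by rewrite -(sinc_mul (l' * e / 2 * x)); field.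
apply: (@mulIf _ ((e * x) ^+ 2)); first by rewrite expf_neq0// mulf_neq0.
have -> : cos (l * e * x) * sinc (e * x) ^+ 2 * (e * x) ^+ 2 = cos (l * e * x) * sin (e * x) ^+ 2.
  by rewrite -(sinc_mul (e * x)); ring.
have dist (p u v w z : R) : p * (- u + p * v + p * w) * z = p * (- (u * z) + p * (v * z) + p * (w * z)).
  by ring.
rewrite dist !sq; have := trig_id (l * e / 2 * x) (e * x).
have -> : (l * e / 2 * x) *+ 2 = l * e * x by rewrite -mulr_natr; field.
have -> : l * e / 2 * x + e * x = (l + 2) * e / 2 * x by field.
have -> : l * e / 2 * x - e * x = (l - 2) * e / 2 * x by field.
by lra.
Qed.

(** By [kern_cos_id] the integral is a multiple of the second difference of step 2 of the absolute
    value at [m = l / e], which vanishes once [[m - 2, m + 2]] has [0] at most as an end point. The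
    Fourier transform of [kern e] is thus seen to be a tent. *)
Lemma kern_cos e l : 0 < e -> 2 * e <= `|l| -> intR (fun x => cos (l * x) * kern e x) = 0.
Proof.
move=> e0 le; have en0 := lt0r_neq0 e0; pose m := l / e.
have dm m := s_dom m en0; have dd := dominated_scale.
have -> : (fun x => cos (l * x) * kern e x) =
    (fun x => 2^-1 * (- 1 * s e m x + (2^-1 * s e (m + 2) x + 2^-1 * s e (m - 2) x))).
  by apply/funext => x; rewrite mulN1r addrA -kern_cos_id// /m divfK.
rewrite intRZ; last by apply: dominated_add; [|apply: dominated_add]; exact: dd.
rewrite intRD; [|exact: dd|by apply: dominated_add; exact: dd].
rewrite intRD; [|exact: dd|exact: dd].
rewrite (intRZ _ (dm m)) (intRZ _ (dm (m + 2))) (intRZ _ (dm (m - 2))) !s_int//.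
have : 2 <= `|m| by rewrite /m normrM normfV (gtr0_norm e0) ler_pdivlMr.
have [m0|m0] := leP 0 m => m2.
  by rewrite ger0_norm// in m2; rewrite !ger0_norm; lra.
by rewrite ltr0_norm// in m2; rewrite !ler0_norm; lra.
Qed.

End BandLimited.

(** * The Riesz projection of trigonometric sums *)

Section TrigSums.
Variable R : realType.
Local Notation Rc := (R[i]).
Implicit Types (x y l e : R) (z w : Rc) (s t : seq (R * Rc)).

Lemma cmod_ge0 z : 0 <= cmod z.
Proof. by case: z => a b; rewrite /cmod /=; exact: sqrtr_ge0. Qed.

Lemma cmod_sqr z : cmod z ^+ 2 = complex.Re z ^+ 2 + complex.Im z ^+ 2.
Proof. by case: z => a b; rewrite /cmod /= sqr_sqrtr// addr_ge0 ?sqr_ge0. Qed.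

Lemma cmodM z w : cmod (z * w) = cmod z * cmod w.
Proof. exact: ComplexField.Normc.normcM. Qed.

Lemma cmodD z w : cmod (z + w) <= cmod z + cmod w.
Proof. exact: le_normcD. Qed.

Lemma cmodN z : cmod (- z) = cmod z.
Proof. exact: normcN. Qed.

Lemma cmodB z w : cmod (z - w) <= cmod z + cmod w.
Proof. by rewrite -(cmodN w) cmodD. Qed.

Lemma cmod0 : cmod (0 : Rc) = 0.
Proof. exact: ComplexField.Normc.normc0. Qed.

Lemma cmodC (a : R) : cmod a%:C = `|a|.
Proof. by rewrite /cmod /= expr0n/= addr0 sqrtr_sqr. Qed.

Lemma cmod1 : cmod (1 : Rc) = 1.
Proof. exact: ComplexField.Normc.normc1. Qed.

Lemma cmodX z n : cmod (z ^+ n) = cmod z ^+ n.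
Proof. by elim: n => [|n ih]; rewrite ?cmod1// !exprS cmodM ih. Qed.

Lemma cmod_sum (I : Type) (r : seq I) (P : pred I) (F : I -> Rc) :
  cmod (\sum_(i <- r | P i) F i) <= \sum_(i <- r | P i) cmod (F i).
Proof.
elim/big_rec2: _ => [|i a b _ h]; first by rewrite cmod0.
by apply: le_trans (cmodD _ _) _; rewrite lerD2l.
Qed.

Lemma Re_le_cmod z : `|complex.Re z| <= cmod z.
Proof.
rewrite -(@ler_pXn2r _ 2)// ?nnegrE ?cmod_ge0// cmod_sqr real_normK ?num_real//.
by rewrite lerDl sqr_ge0.
Qed.

Lemma Im_le_cmod z : `|complex.Im z| <= cmod z.
Proof.
rewrite -(@ler_pXn2r _ 2)// ?nnegrE ?cmod_ge0// cmod_sqr real_normK ?num_real//.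
by rewrite lerDr sqr_ge0.
Qed.

Lemma cReD z w : complex.Re (z + w) = complex.Re z + complex.Re w.
Proof. by case: z w => ? ? []. Qed.
Lemma cImD z w : complex.Im (z + w) = complex.Im z + complex.Im w.
Proof. by case: z w => ? ? []. Qed.
Lemma cReN z : complex.Re (- z) = - complex.Re z. Proof. by case: z. Qed.
Lemma cImN z : complex.Im (- z) = - complex.Im z. Proof. by case: z. Qed.
Lemma cReM z w : complex.Re (z * w) = complex.Re z * complex.Re w - complex.Im z * complex.Im w.
Proof. by case: z w => ? ? []. Qed.
Lemma cImM z w : complex.Im (z * w) = complex.Re z * complex.Im w + complex.Im z * complex.Re w.
Proof. by case: z w => ? ? []. Qed.

Lemma cRe_sum (I : Type) (r : seq I) (P : pred I) (F : I -> Rc) :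
  complex.Re (\sum_(i <- r | P i) F i) = \sum_(i <- r | P i) complex.Re (F i).
Proof. by elim/big_rec2: _ => //= i a b _ <-; rewrite cReD. Qed.

Lemma cIm_sum (I : Type) (r : seq I) (P : pred I) (F : I -> Rc) :
  complex.Im (\sum_(i <- r | P i) F i) = \sum_(i <- r | P i) complex.Im (F i).
Proof. by elim/big_rec2: _ => //= i a b _ <-; rewrite cImD. Qed.

Lemma cisD x y : cis (x + y) = cis x * cis y.
Proof.
by apply/eqP; rewrite eq_complex /= cosD sinD eqxx /= addrC.
Qed.

Lemma cis0 : cis (0 : R) = 1.
Proof. by rewrite /cis cos0 sin0. Qed.

Lemma cisN x : cis (- x) = (cis x)^*.
Proof. by rewrite /cis cosN sinN. Qed.

Lemma cmod_cis x : cmod (cis x) = 1.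
Proof. by rewrite /cmod /= cos2Dsin2 sqrtr1. Qed.

Lemma cmod_conj z : cmod (z^*) = cmod z.
Proof. by case: z => a b; rewrite /cmod /= sqrrN. Qed.

Lemma conj_mul z : z^* * z = (cmod z ^+ 2)%:C.
Proof.
by rewrite cmod_sqr; case: z => a b; apply/eqP; rewrite eq_complex /=; apply/andP; split; apply/eqP; ring.
Qed.

(* A trigonometric sum is a list of pairs (frequency, coefficient); frequencies may be repeated. *)
Definition tsum s x : Rc := \sum_(p <- s) p.2 * cis (p.1 * x).

Lemma tsum_cat s t x : tsum (s ++ t) x = tsum s x + tsum t x.
Proof. by rewrite /tsum big_cat. Qed.

Lemma tsum_nil x : tsum [::] x = 0. Proof. exact: big_nil. Qed.

Lemma tsum_cons p s x : tsum (p :: s) x = p.2 * cis (p.1 * x) + tsum s x.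
Proof. exact: big_cons. Qed.

Definition tmul s t : seq (R * Rc) := [seq (p.1 + q.1, p.2 * q.2) | p <- s, q <- t].

Lemma tsum_mul s t x : tsum (tmul s t) x = tsum s x * tsum t x.
Proof.
rewrite /tsum big_allpairs_dep mulr_suml /=; apply: eq_bigr => p _.
rewrite mulr_sumr; apply: eq_bigr => q _ /=.
by rewrite mulrDl cisD; ring.
Qed.

Definition tmult (m : R -> Rc) s : seq (R * Rc) := [seq (p.1, m p.1 * p.2) | p <- s].

Lemma tsum_mult m s x : tsum (tmult m s) x = \sum_(p <- s) m p.1 * p.2 * cis (p.1 * x).
Proof. by rewrite /tsum big_map. Qed.

Lemma tsum_scale z s x : tsum (tmult (fun=> z) s) x = z * tsum s x.
Proof. by rewrite tsum_mult mulr_sumr; apply: eq_bigr => p _; rewrite mulrA. Qed.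

Definition tconj s : seq (R * Rc) := [seq (- p.1, p.2^*) | p <- s].

Lemma tsum_conj s x : tsum (tconj s) x = (tsum s x)^*.
Proof.
rewrite /tsum big_map rmorph_sum; apply: eq_bigr => p _ /=.
by rewrite mulNr cisN rmorphM.
Qed.

Definition tshift l s : seq (R * Rc) := [seq (p.1 + l, p.2) | p <- s].

Lemma tsum_shift l s x : tsum (tshift l s) x = cis (l * x) * tsum s x.
Proof.
rewrite /tsum big_map mulr_sumr; apply: eq_bigr => p _ /=.
by rewrite mulrDl cisD; ring.
Qed.

Lemma Re_tsum s x : complex.Re (tsum s x) =
  \sum_(p <- s) (complex.Re p.2 * cos (p.1 * x) + - complex.Im p.2 * sin (p.1 * x)).
Proof. by rewrite cRe_sum; apply: eq_bigr => p _; rewrite cReM /= mulNr. Qed.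

Lemma Im_tsum s x : complex.Im (tsum s x) =
  \sum_(p <- s) (complex.Re p.2 * sin (p.1 * x) + complex.Im p.2 * cos (p.1 * x)).
Proof. by rewrite cIm_sum; apply: eq_bigr => p _; rewrite cImM. Qed.

Lemma bcont_Re_tsum s : bcont (fun x => complex.Re (tsum s x)).
Proof.
under eq_fun do rewrite Re_tsum.
apply: bcont_sum => p _; apply: bcontD; apply: bcontZ; [exact: bcont_cos|exact: bcont_sin].
Qed.

Lemma bcont_Im_tsum s : bcont (fun x => complex.Im (tsum s x)).
Proof.
under eq_fun do rewrite Im_tsum.
apply: bcont_sum => p _; apply: bcontD; apply: bcontZ; [exact: bcont_sin|exact: bcont_cos].
Qed.

Lemma bcont_cmod2_tsum s : bcont (fun x => cmod (tsum s x) ^+ 2).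
Proof.
under eq_fun do rewrite cmod_sqr.
by apply: bcontD; apply: bcontX; [exact: bcont_Re_tsum|exact: bcont_Im_tsum].
Qed.

Definition spec_ge rho s := all (fun p => rho <= p.1) s.

Definition pspec rho (g : R -> Rc) := exists2 s, spec_ge rho s & g =1 tsum s.

Lemma pspecD rho g h : pspec rho g -> pspec rho h -> pspec rho (fun x => g x + h x).
Proof.
move=> [s hs gs] [t ht hgt]; exists (s ++ t) => [|x]; last by rewrite tsum_cat gs hgt.
by rewrite /spec_ge all_cat; apply/andP.
Qed.

Lemma pspec_sum (I : Type) (r : seq I) rho (g : I -> R -> Rc) : (forall i, pspec rho (g i)) ->
  pspec rho (fun x => \sum_(i <- r) g i x).
Proof.
move=> hg; elim: r => [|i r ih].
  by exists [::] => // x; rewrite big_nil tsum_nil.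
have [s hs e] := pspecD (hg i) ih; exists s => // x.
by rewrite -e big_cons.
Qed.

Lemma pspecM rho rho' g h : pspec rho g -> pspec rho' h ->
  pspec (rho + rho') (fun x => g x * h x).
Proof.
move=> [s hs gs] [t ht hgt]; exists (tmul s t) => [|x]; last by rewrite tsum_mul gs hgt.
rewrite /spec_ge /tmul; elim: s hs {gs} => //= p s ih /andP[hp /ih hs].
rewrite all_cat hs andbT all_map; apply: sub_all ht => q hq /=.
by rewrite lerD.
Qed.

Lemma pspecN rho g : pspec rho g -> pspec rho (fun x => - g x).
Proof.
move=> [s hs gs]; exists (tmult (fun=> -1) s) => [|x]; last by rewrite tsum_scale mulN1r gs.
by rewrite /spec_ge all_map; apply: sub_all hs.
Qed.

Lemma pspec_le rho rho' g : rho' <= rho -> pspec rho g -> pspec rho' g.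
Proof. by move=> h [s hs gs]; exists s => //; apply: sub_all hs => p; exact: le_trans. Qed.

Lemma pspecX rho g n : 0 <= rho -> pspec rho g -> pspec rho (fun x => g x ^+ n.+1).
Proof.
move=> r0 hg; elim: n => [|n ih].
  by case: hg => s hs gs; exists s => // x; rewrite expr1.
have le : rho <= rho + rho by rewrite lerDl.
have [s hs e] := pspec_le le (pspecM hg ih).
by exists s => // x; rewrite exprS.
Qed.

Lemma pspec_intR e g : 0 < e -> pspec (2 * e) g ->
  intR (fun x => complex.Re (g x) * kern e x) = 0.
Proof.
move=> e0 [s hs gs]; have en0 := lt0r_neq0 e0.
have dc l : dominated (fun x => cos (l * x) * kern e x).
  by apply: bcont_dominated; [exact: bcont_cos|exact: kern_dominated].
have ds l : dominated (fun x => sin (l * x) * kern e x).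
  by apply: bcont_dominated; [exact: bcont_sin|exact: kern_dominated].
have -> : (fun x => complex.Re (g x) * kern e x) = (fun x => \sum_(p <- s)
    (complex.Re p.2 * (cos (p.1 * x) * kern e x) + - complex.Im p.2 * (sin (p.1 * x) * kern e x))).
  apply/funext => x; rewrite gs Re_tsum mulr_suml; apply: eq_bigr => p _.
  by rewrite mulrDl !mulrA.
rewrite intR_sum; last by move=> p; apply: dominated_add; exact: dominated_scale.
elim: s hs {gs} => [_|p s ih /= /andP[ps /ih h]]; first by rewrite big_nil.
rewrite big_cons h addr0.
rewrite (intRD (dominated_scale _ (dc p.1)) (dominated_scale _ (ds p.1))) (intRZ _ (dc p.1)) (intRZ _ (ds p.1)).
by rewrite kern_sin// kern_cos ?mulr0 ?addr0// ger0_norm// (le_trans _ ps)// mulr_ge0// ltW.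
Qed.

Let cs_step (a b p q S : R) : 0 <= a -> 0 <= b -> 0 <= p -> 0 <= q -> 0 <= S ->
  S ^+ 2 <= p ^+ 2 * q ^+ 2 -> (a * b + S) ^+ 2 <= (a ^+ 2 + p ^+ 2) * (b ^+ 2 + q ^+ 2).
Proof.
move=> a0 b0 p0 q0 S0 h.
have Spq : S <= p * q by rewrite -(@ler_pXn2r _ 2)// ?nnegrE ?mulr_ge0// exprMn.
have := ler_wpM2l (mulr_ge0 a0 b0) Spq; move: h; have := sqr_ge0 (a * q - b * p).
by rewrite !expr2; lra.
Qed.

Lemma cauchy_schwarz (I : Type) (r : seq I) (u v : I -> R) :
  (forall i, 0 <= u i) -> (forall i, 0 <= v i) ->
  (\sum_(i <- r) u i * v i) ^+ 2 <= (\sum_(i <- r) u i ^+ 2) * (\sum_(i <- r) v i ^+ 2).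
Proof.
move=> u0 v0; elim: r => [|i r ih]; first by rewrite !big_nil expr0n/= mul0r.
rewrite !big_cons; have := u0 i; have := v0 i; move: (u i) (v i) => a b b0 a0.
have U0 : 0 <= \sum_(j <- r) u j ^+ 2 by apply: sumr_ge0 => j _; exact: sqr_ge0.
have V0 : 0 <= \sum_(j <- r) v j ^+ 2 by apply: sumr_ge0 => j _; exact: sqr_ge0.
have S0 : 0 <= \sum_(j <- r) u j * v j by apply: sumr_ge0 => j _; exact: mulr_ge0.
rewrite -(sqr_sqrtr U0) -(sqr_sqrtr V0) in ih *.
by apply: cs_step => //; exact: sqrtr_ge0.
Qed.

(** Where [phi <= d ^+ 2 * B], the number [z] lies within [d * B] of [B], and [d] is chosen with
    [Q * d * 2 ^+ n = 2^-1] so that the powers differ by at most half of [B ^+ n.+1]. Elsewhere [B],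
    [phi] and the distance from [z] to [B] are all at most [phi / d ^+ 2], and the last term
    dominates. *)
Lemma riesz_pointwise n : exists2 C : R, 0 <= C & forall (B phi : R) z, 0 <= B -> 0 <= phi ->
  cmod (B%:C - z) ^+ 2 <= phi * B -> 2^-1 * B ^+ n.+1 <= complex.Re (z ^+ n.+1) + C * phi ^+ n.+1.
Proof.
pose Q : R := n.+1%:R; have Q0 : 0 < Q by rewrite ltr0n.
pose d : R := (Q * 2 ^+ n.+1)^-1.
have QQ0 : 0 < Q * 2 ^+ n.+1 by rewrite mulr_gt0// exprn_gt0.
have d0 : 0 < d by rewrite invr_gt0.
have d1 : d <= 1.
  rewrite invf_le1//; apply: mulr_ege1; first by rewrite ler1n.
  by rewrite exprn_ege1// ler1n.
have hQ : Q * d * 2 ^+ n = 2^-1.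
  by rewrite /d exprS; field; rewrite lt0r_neq0 ?exprn_gt0//= lt0r_neq0.
have C0 : 0 <= Q * 2 ^+ n * ((d ^+ 2)^-1) ^+ n.+1.
  apply: mulr_ge0; first exact: mulr_ge0 (ltW Q0) (exprn_ge0 _ (ler0n _ 2)).
  by apply: exprn_ge0; rewrite invr_ge0 sqr_ge0.
exists (Q * 2 ^+ n * ((d ^+ 2)^-1) ^+ n.+1) => //.
move=> B phi z B0 phi0 hs; set s := B%:C - z in hs.
have s0 := cmod_ge0 s.
have zB : cmod z <= B + cmod s.
  have -> : z = B%:C - s by rewrite /s opprB addrC subrK.
  by apply: le_trans (cmodB _ _) _; rewrite cmodC ger0_norm.
have bound : B ^+ n.+1 - complex.Re (z ^+ n.+1) <= Q * cmod s * (B + cmod s) ^+ n.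
  have -> : B ^+ n.+1 - complex.Re (z ^+ n.+1) = complex.Re (B%:C ^+ n.+1 - z ^+ n.+1).
    by rewrite cReD cReN -rmorphXn.
  apply: le_trans (le_trans (ler_norm _) (Re_le_cmod _)) _.
  rewrite subrXX cmodM -/s [Q * _]mulrC -mulrA ler_wpM2l//.
  apply: le_trans (cmod_sum _ _ _) _.
  rewrite [leRHS]mulr_natl -[in leRHS](card_ord n.+1) -sumr_const.
  apply: ler_sum => i _; rewrite cmodM !cmodX cmodC (ger0_norm B0) /=.
  have -> : (B + cmod s) ^+ n = (B + cmod s) ^+ (n - i) * (B + cmod s) ^+ i.
    by rewrite -exprD subnK// -ltnS.
  have Bs : 0 <= B + cmod s by exact: addr_ge0.
  by apply: ler_pM; rewrite ?exprn_ge0 ?cmod_ge0// lerXn2r ?nnegrE ?cmod_ge0// lerDl.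
have [h|h] := leP phi (d ^+ 2 * B).
  have dB0 : 0 <= d * B := mulr_ge0 (ltW d0) B0.
  have sB : cmod s <= d * B.
    rewrite -(@ler_pXn2r _ 2)// ?nnegrE// exprMn.
    by apply: le_trans hs _; rewrite [B ^+ 2]expr2 mulrA ler_wpM2r.
  have dB : d * B <= B by apply: ler_piMl.
  have : Q * cmod s * (B + cmod s) ^+ n <= Q * (d * B) * (2 * B) ^+ n.
    apply: ler_pM; [exact: mulr_ge0 (ltW Q0) s0|by apply: exprn_ge0; exact: addr_ge0|by rewrite ler_pM2l|].
    apply: lerXn2r; rewrite ?nnegrE; [exact: addr_ge0|exact: mulr_ge0|lra].
  have -> : Q * (d * B) * (2 * B) ^+ n = (Q * d * 2 ^+ n) * B ^+ n.+1 by rewrite exprMn exprS; ring.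
  rewrite hQ => h2.
  have : 0 <= Q * 2 ^+ n * ((d ^+ 2)^-1) ^+ n.+1 * phi ^+ n.+1.
    exact: mulr_ge0 C0 (exprn_ge0 _ phi0).
  lra.
pose T := (d ^+ 2)^-1 * phi.
have dd : 0 < d ^+ 2 by exact: exprn_gt0.
have BT : B <= T by rewrite /T ler_pdivlMl// ltW.
have pT : phi <= T by rewrite /T ler_peMl// invf_ge1// expr_le1// ltW.
have T0 : 0 <= T := le_trans phi0 pT.
have sT : cmod s <= T.
  rewrite -(@ler_pXn2r _ 2)// ?nnegrE//; apply: le_trans hs _.
  by rewrite expr2 ler_pM.
have : Q * cmod s * (B + cmod s) ^+ n <= Q * T * (2 * T) ^+ n.
  apply: ler_pM; [exact: mulr_ge0 (ltW Q0) s0|by apply: exprn_ge0; exact: addr_ge0|by rewrite ler_pM2l|].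
  apply: lerXn2r; rewrite ?nnegrE; [exact: addr_ge0|exact: mulr_ge0|lra].
have -> : Q * T * (2 * T) ^+ n = Q * 2 ^+ n * ((d ^+ 2)^-1) ^+ n.+1 * phi ^+ n.+1.
  by rewrite /T !exprMn [(d ^+ 2)^-1 ^+ n.+1]exprS [phi ^+ n.+1]exprS; ring.
have : 0 <= B ^+ n.+1 by exact: exprn_ge0.
lra.
Qed.

(* If [F = a + conj b] with [a], [b] analytic, then [(- a * b) ^+ q] has mean zero, while
   [- a * b = |b| ^+ 2 - F * b] is close to [|b| ^+ 2] wherever [F] is small. *)
Lemma riesz_vector n : exists2 C : R, 0 <= C & forall (I : Type) (r : seq I) e (F b : I -> seq (R * Rc)),
  0 < e -> (forall i, pspec (2 * e) (tsum (b i))) ->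
  (forall i, pspec (2 * e) (fun x => tsum (F i) x - (tsum (b i) x)^*)) ->
  intR (fun x => (\sum_(i <- r) cmod (tsum (b i) x) ^+ 2) ^+ n.+1 * kern e x) <=
  C * intR (fun x => (\sum_(i <- r) cmod (tsum (F i) x) ^+ 2) ^+ n.+1 * kern e x).
Proof.
have [C C0 hC] := riesz_pointwise n; exists (2 * C); first by rewrite mulr_ge0.
move=> I r e F b e0 hb ha; have en0 := lt0r_neq0 e0; have dk := kern_dominated en0.
pose B x := \sum_(i <- r) cmod (tsum (b i) x) ^+ 2.
pose Phi x := \sum_(i <- r) cmod (tsum (F i) x) ^+ 2.
have bB : bcont B by apply: bcont_sum => i _; exact: bcont_cmod2_tsum.
have bP : bcont Phi by apply: bcont_sum => i _; exact: bcont_cmod2_tsum.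
pose z x := - \sum_(i <- r) (tsum (F i) x - (tsum (b i) x)^*) * tsum (b i) x.
have pz : pspec (2 * e) (fun x => z x ^+ n.+1).
  have e2 : 0 <= 2 * e by rewrite mulr_ge0// ltW.
  apply: pspecX => //; apply: pspecN; apply: pspec_sum => i.
  by apply: pspec_le (pspecM (ha i) (hb i)); rewrite lerDl.
have int0 := pspec_intR e0 pz.
have [sz hsz ez] := pz.
have bz : bcont (fun x => complex.Re (z x ^+ n.+1)).
  by under eq_fun do rewrite ez; exact: bcont_Re_tsum.
have k0 x : 0 <= kern e x by exact: sqr_ge0.
have d1 : dominated (fun x => B x ^+ n.+1 * kern e x) by apply: bcont_dominated => //; exact: bcontX.
have d2 : dominated (fun x => Phi x ^+ n.+1 * kern e x) by apply: bcont_dominated => //; exact: bcontX.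
have d3 : dominated (fun x => complex.Re (z x ^+ n.+1) * kern e x) by exact: bcont_dominated.
have main : 2^-1 * intR (fun x => B x ^+ n.+1 * kern e x) <= 0 + C * intR (fun x => Phi x ^+ n.+1 * kern e x).
  rewrite -int0 -!intRZ// -intRD//; last exact: dominated_scale.
  apply: le_intR; [exact: dominated_scale|by apply: dominated_add => //; exact: dominated_scale|] => x.
  rewrite mulrA [C * _]mulrA -mulrDl; apply: ler_wpM2r => //; apply: hC.
  - by apply: sumr_ge0 => i _; exact: sqr_ge0.
  - by apply: sumr_ge0 => i _; exact: sqr_ge0.
  have -> : (B x)%:C - z x = \sum_(i <- r) tsum (F i) x * tsum (b i) x.
    rewrite /B /z opprK rmorph_sum -big_split /=; apply: eq_bigr => i _.
    by rewrite -conj_mul mulrBl addrC subrK.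
  apply: (@le_trans _ _ ((\sum_(i <- r) cmod (tsum (F i) x) * cmod (tsum (b i) x)) ^+ 2)).
    rewrite lerXn2r ?nnegrE ?cmod_ge0//.
      by apply: sumr_ge0 => i _; rewrite mulr_ge0 ?cmod_ge0.
    by apply: le_trans (cmod_sum _ _ _) _; apply: ler_sum => i _; rewrite cmodM.
  by apply: cauchy_schwarz => i; exact: cmod_ge0.
rewrite -/B -/Phi; move: main; move: (intR _) (intR _) => p q; lra.
Qed.

End TrigSums.

(** * Multipliers of sharp and smooth cut-offs *)

Section Multipliers.
Variable R : realType.
Local Notation Rc := (R[i]).
Implicit Types (x y l a : R) (s : seq (R * Rc)).

Definition mW a l : R := a ^+ 2 / (a ^+ 2 + l ^+ 2).

Lemma Re_scaleC a (z : Rc) : complex.Re (a%:C * z) = a * complex.Re z.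
Proof. by rewrite cReM /= mul0r subr0. Qed.

Lemma Im_scaleC a (z : Rc) : complex.Im (a%:C * z) = a * complex.Im z.
Proof. by rewrite cImM /= mul0r addr0. Qed.

Lemma W_Re_tsum a s x : 0 < a ->
  W a (fun x => complex.Re (tsum s x)) x = complex.Re (tsum (tmult (fun l => (mW a l)%:C) s) x).
Proof.
move=> a0; have bc l := bcont_cos l; have bs l := bcont_sin l.
under eq_fun do rewrite Re_tsum.
rewrite W_sum//; last by move=> p; apply: bcontD; apply: bcontZ.
rewrite Re_tsum big_map; apply: eq_bigr => p _.
rewrite WD ?WZ ?W_cos ?W_sin//; [|exact: bcontZ|exact: bcontZ].
rewrite -[RHS]/(complex.Re ((mW a p.1)%:C * p.2) * cos (p.1 * x) + - complex.Im ((mW a p.1)%:C * p.2) * sin (p.1 * x)).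
by rewrite Re_scaleC Im_scaleC /mW; ring.
Qed.

Lemma W_Im_tsum a s x : 0 < a ->
  W a (fun x => complex.Im (tsum s x)) x = complex.Im (tsum (tmult (fun l => (mW a l)%:C) s) x).
Proof.
move=> a0; have bc l := bcont_cos l; have bs l := bcont_sin l.
under eq_fun do rewrite Im_tsum.
rewrite W_sum//; last by move=> p; apply: bcontD; apply: bcontZ.
rewrite Im_tsum big_map; apply: eq_bigr => p _.
rewrite WD ?WZ ?W_cos ?W_sin//; [|exact: bcontZ|exact: bcontZ].
rewrite -[RHS]/(complex.Re ((mW a p.1)%:C * p.2) * sin (p.1 * x) + complex.Im ((mW a p.1)%:C * p.2) * cos (p.1 * x)).
by rewrite Re_scaleC Im_scaleC /mW; ring.
Qed.

(* Symbols of [LX f j], [W (rate j) (LX f j.+1 - LX f j)] and [Lw f j]; [mS j] is what is left of the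
   sharp cut-off at [2 ^+ j] after subtracting [mL j] and dividing by [mH j]. *)
Definition mX j l : R := mW (rate R j) l.
Definition mH j l : R := mX j l * (mX j.+1 l - mX j l).
Definition mL j l : R := 3^-1 * (4 * mX j l - mX j.+1 l).
Definition ratio j l : R := (l / rate R j) ^+ 2.
Definition mS j l : R := if ratio j l <= 1 then 3^-1 * ((5 + ratio j l) * (1 + ratio j l))
  else - (4 / 3) * (1 + (ratio j l)^-1).

Lemma ratio_ge0 j l : 0 <= ratio j l. Proof. exact: sqr_ge0. Qed.

Lemma mXE j l : mX j l = (1 + ratio j l)^-1.
Proof.
rewrite /mX /mW /ratio; have r0 := lt0r_neq0 (rate_gt0 R j).
have h : rate R j ^+ 2 + l ^+ 2 != 0.
  by rewrite gt_eqF// ltr_wpDr ?sqr_ge0// exprn_gt0// rate_gt0.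
by rewrite expr_div_n; field; rewrite r0 h.
Qed.

Lemma mXSE j l : mX j.+1 l = 4 * (4 + ratio j l)^-1.
Proof.
rewrite mXE /ratio rateS; have r0 := lt0r_neq0 (rate_gt0 R j).
have -> : (l / (2 * rate R j)) ^+ 2 = (l / rate R j) ^+ 2 / 4 by field.
have := sqr_ge0 (l / rate R j); move: (_ ^+ 2) => t t0.
by field; rewrite gt_eqF//; lra.
Qed.

Lemma ratio_le1 j l : (ratio j l <= 1) = (`|l| <= 2 ^+ j).
Proof.
rewrite /ratio expr_div_n ler_pdivrMr ?exprn_gt0 ?rate_gt0// mul1r.
rewrite -[l ^+ 2]real_normK ?num_real// ler_pXn2r// nnegrE.
exact: ltW (rate_gt0 R j).
Qed.

(** The combination [mL] is chosen to equal 1 at [l = 0] and to decay like [ratio ^- 2]. Hence the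
    cut-off minus [mL] vanishes at [0] and decays at infinity to the same order as [mH], and the
    quotient [mS] stays bounded. *)
Lemma sharp_factor j l : (`|l| <= 2 ^+ j)%R%:R - mL j l = mS j l * mH j l.
Proof.
rewrite -ratio_le1 /mS /mH /mL mXE mXSE; have := ratio_ge0 j l.
move: (ratio j l) => t t0; have h1 : 1 + t != 0 by rewrite gt_eqF//; lra.
have h4 : 4 + t != 0 by rewrite gt_eqF//; lra.
case: (leP t 1) => t1 /=; rewrite ?mulr1n ?mulr0n; first by field; rewrite h1 h4.
have h0 : t != 0 by rewrite gt_eqF//; lra.
by field; rewrite h0 h1 h4.
Qed.

(* a primitive of the total variation of [mS j] *)
Let vari (u : R) : R := if u < -1 then 4 / 3 * (u ^+ 2)^-1 else
  if u <= 1 then 8 + 6 * (u + 1) else 28 - 4 / 3 * (u ^+ 2)^-1.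

Let mu (u : R) : R := if u ^+ 2 <= 1 then 3^-1 * ((5 + u ^+ 2) * (1 + u ^+ 2))
  else - (4 / 3) * (1 + (u ^+ 2)^-1).

Let inv_bnd (u : R) : 1 < u ^+ 2 -> 0 <= (u ^+ 2)^-1 <= 1.
Proof.
move=> u1; have u0 := lt_trans ltr01 u1; rewrite invr_ge0 ltW//=.
by rewrite invf_le1// ltW.
Qed.

(** On each side outside [[-1, 1]] the function [mu] is monotone; inside its slope is at most 16/3,
    below the slope 6 of [vari]; at [-1] and [1] it jumps by 20/3, as [vari] does. *)
Let mu_vari (u v : R) : u <= v -> `|mu u - mu v| <= vari v - vari u.
Proof.
move=> uv; rewrite /mu /vari.
have out (w : R) : w < -1 \/ 1 < w -> 1 < w ^+ 2 by case=> h; rewrite expr2; nra.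
have inn (w : R) : -1 <= w -> w <= 1 -> w ^+ 2 <= 1 by move=> h1 h2; rewrite expr2; nra.
have [um|um] := ltP u (-1); have [vm|vm] := ltP v (-1).
- have u2 := out u (or_introl um); have v2 := out v (or_introl vm).
  rewrite [u ^+ 2 <= 1]leNgt [v ^+ 2 <= 1]leNgt u2 v2 /=.
  have h : (u ^+ 2)^-1 <= (v ^+ 2)^-1.
    by rewrite lef_pV2 ?posrE ?(lt_trans ltr01)// !expr2; nra.
  by rewrite ler_norml; apply/andP; split; lra.
- have u2 := out u (or_introl um); have /andP[i0 i1] := inv_bnd u2.
  rewrite [u ^+ 2 <= 1]leNgt u2 /=.
  have [v1|v1] := leP v 1.
    have v2 := inn v vm v1; have v20 := sqr_ge0 v; rewrite v2.
    move: (u ^+ 2)^-1 (v ^+ 2) i0 i1 v2 v20 => a b a0 a1 b1 b0.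
    by rewrite ler_norml; apply/andP; split; nra.
  have v2 := out v (or_intror v1); have /andP[j0 j1] := inv_bnd v2.
  rewrite [v ^+ 2 <= 1]leNgt v2 /=.
  by rewrite ler_norml; apply/andP; split; lra.
- by exfalso; lra.
have [u1|u1] := leP u 1; have [v1|v1] := leP v 1.
- rewrite !inn// ler_norml; apply/andP; split.
    have : 0 <= (v - u) * (18 - (u + v) * (6 + u ^+ 2 + v ^+ 2)).
      rewrite mulr_ge0 ?subr_ge0//.
      have := inn u um u1; have := inn v vm v1; have := sqr_ge0 u; have := sqr_ge0 v; nra.
    lra.
  have : 0 <= (v - u) * (18 + (u + v) * (6 + u ^+ 2 + v ^+ 2)).
    rewrite mulr_ge0 ?subr_ge0//.
    have := inn u um u1; have := inn v vm v1; have := sqr_ge0 u; have := sqr_ge0 v; nra.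
  lra.
- have v2 := out v (or_intror v1); have /andP[j0 j1] := inv_bnd v2.
  rewrite [v ^+ 2 <= 1]leNgt v2 /= inn//.
  have u2 := inn u um u1; have u20 := sqr_ge0 u.
  move: (v ^+ 2)^-1 (u ^+ 2) j0 j1 u2 u20 => a b a0 a1 b1 b0.
  by rewrite ler_norml; apply/andP; split; nra.
- by exfalso; lra.
have u2 := out u (or_intror u1); have v2 := out v (or_intror v1).
rewrite [u ^+ 2 <= 1]leNgt [v ^+ 2 <= 1]leNgt u2 v2 /=.
have h : (v ^+ 2)^-1 <= (u ^+ 2)^-1.
  by rewrite lef_pV2 ?posrE ?(lt_trans ltr01)// !expr2; nra.
by rewrite ler_norml; apply/andP; split; lra.
Qed.

Let vari_bnd (u : R) : 0 <= vari u <= 28.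
Proof.
rewrite /vari; have [um|um] := ltP u (-1).
  have u2 : 1 < u ^+ 2 by rewrite expr2; nra.
  by have /andP[i0 i1] := inv_bnd u2; apply/andP; split; lra.
have [u1|u1] := leP u 1; first by apply/andP; split; lra.
have u2 : 1 < u ^+ 2 by rewrite expr2; nra.
by have /andP[i0 i1] := inv_bnd u2; apply/andP; split; lra.
Qed.

Lemma mS_bound j l : `|mS j l| <= 4.
Proof.
rewrite /mS; have := ratio_ge0 j l; move: (ratio j l) => t t0.
have [t1|t1] := leP t 1.
  by rewrite ler_norml; apply/andP; split; nra.
have i0 : 0 <= t^-1 by rewrite invr_ge0.
have i1 : t^-1 <= 1 by rewrite invf_le1 ?ltW// (lt_trans ltr01).
by rewrite ler_norml; apply/andP; split; lra.
Qed.

Lemma mS_variation j (l : nat -> R) n : (forall i, (i < n)%N -> l i <= l i.+1) ->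
  \sum_(i < n) `|mS j (l i) - mS j (l i.+1)| <= 28.
Proof.
move=> hl; have r0 := rate_gt0 R j; pose u i := l i / rate R j.
apply: (@le_trans _ _ (\sum_(i < n) (vari (u i.+1) - vari (u i)))).
  apply: ler_sum => i _; apply: mu_vari.
  by rewrite /u ler_pM2r ?invr_gt0// hl.
have -> : \sum_(i < n) (vari (u i.+1) - vari (u i)) = vari (u n) - vari (u 0%N).
  elim: n {hl} => [|n ih]; first by rewrite big_ord0 subrr.
  by rewrite big_ord_recr /= ih; ring.
by have /andP[_ h1] := vari_bnd (u n); have /andP[h2 _] := vari_bnd (u 0%N); lra.
Qed.

End Multipliers.

(** * Separated frequencies *)

Section PolynomialCase.
Variable R : realType.
Local Notation Rc := (R[i]).
Implicit Types (x y : R) (l : nat -> R) (c d : nat -> Rc) (s : seq (R * Rc)).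

Definition tpoly n l c : seq (R * Rc) := [seq (l i, c i) | i <- iota 0 n].

Lemma big_iota0 (T : nmodType) m (F : nat -> T) : \sum_(i <- iota 0 m) F i = \sum_(i < m) F i.
Proof. by rewrite -[X in iota 0 X]subn0 -/(index_iota 0 m) big_mkord. Qed.

Lemma tpolyE n l c x : tsum (tpoly n l c) x = \sum_(i < n) c i * cis (l i * x).
Proof. by rewrite /tsum big_map big_iota0. Qed.

Lemma spec_ge_terms rho (r : seq nat) l c : (forall i, i \in r -> rho <= l i) ->
  spec_ge rho [seq (l i, c i) | i <- r].
Proof. by move=> h; rewrite /spec_ge all_map; apply/allP => i /h. Qed.

Lemma spec_ge_shift rho a s : spec_ge (rho - a) s -> spec_ge rho (tshift a s).
Proof. by rewrite /spec_ge all_map; apply: sub_all => p /=; lra. Qed.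

Lemma spec_ge_mult rho (m : R -> Rc) s : spec_ge rho s -> spec_ge rho (tmult m s).
Proof. by rewrite /spec_ge all_map; apply: sub_all. Qed.

Lemma cconjK (z : Rc) : ((z^*)^*)%C = z.
Proof. by case: z => a b /=; rewrite opprK. Qed.

Definition sharp n l c (j : nat) x : Rc := \sum_(i < n | `|l i| <= 2 ^+ j) c i * cis (l i * x).

Lemma abel_sum (m : nat -> R) d n :
  \sum_(i < n.+1) (m i)%:C * d i = (m n)%:C * (\sum_(i < n.+1) d i) +
  \sum_(r < n) (m r - m r.+1)%:C * (\sum_(i < r.+1) d i).
Proof.
have rec (F : nat -> Rc) m' : \sum_(i < m'.+1) F i = \sum_(i < m') F i + F m' by rewrite big_ord_recr.
elim: n => [|n ih]; first by rewrite (rec (fun i => (m i)%:C * d i)) (rec d 0%N) !big_ord0 !add0r addr0.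
rewrite (rec (fun i => (m i)%:C * d i)) ih (rec (fun r => (m r - m r.+1)%:C * \sum_(i < r.+1) d i)) (rec d n.+1).
by rewrite rmorphB; ring.
Qed.

Lemma cmodD_sqr (z w : Rc) : cmod (z + w) ^+ 2 <= 2 * cmod z ^+ 2 + 2 * cmod w ^+ 2.
Proof.
apply: (@le_trans _ _ ((cmod z + cmod w) ^+ 2)).
  by rewrite lerXn2r ?nnegrE ?addr_ge0 ?cmod_ge0// cmodD.
by have := sqr_ge0 (cmod z - cmod w); rewrite !expr2; lra.
Qed.

(** Cauchy-Schwarz with the variation of [m] as weight keeps the partial sums in a weighted [l^2]
    sum. This is the form that the vector-valued Riesz estimate accepts, with square roots of the
    variation as scalar factors. *)
Lemma abel_bound (m : nat -> R) d n V K : `|m n| <= V -> \sum_(r < n) `|m r - m r.+1| <= K ->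
  cmod (\sum_(i < n.+1) (m i)%:C * d i) ^+ 2 <= 2 * V ^+ 2 * cmod (\sum_(i < n.+1) d i) ^+ 2 +
  2 * K * \sum_(r < n) `|m r - m r.+1| * cmod (\sum_(i < r.+1) d i) ^+ 2.
Proof.
move=> mV mK; rewrite abel_sum; apply: le_trans (cmodD_sqr _ _) _; rewrite -[2 * V ^+ 2 * _]mulrA -[2 * K * _]mulrA -!mulrDr.
apply: ler_wpM2l => //; apply: lerD.
  rewrite cmodM cmodC exprMn ler_wpM2r ?sqr_ge0// lerXn2r ?nnegrE//.
  exact: le_trans mV.
pose w r := Num.sqrt `|m r - m r.+1|; pose Z r := cmod (\sum_(i < r.+1) d i).
have w0 r : 0 <= w r by exact: sqrtr_ge0.
have wE r : `|m r - m r.+1| = w r ^+ 2 by rewrite sqr_sqrtr.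
apply: (@le_trans _ _ ((\sum_(r < n) w r * (w r * Z r)) ^+ 2)).
  have s0 : 0 <= \sum_(r < n) w r * (w r * Z r).
    by apply: sumr_ge0 => r _; rewrite !mulr_ge0 ?cmod_ge0.
  rewrite lerXn2r ?nnegrE ?cmod_ge0//; apply: le_trans (cmod_sum _ _ _) _.
  by apply: ler_sum => r _; rewrite cmodM cmodC wE mulrA expr2.
apply: le_trans (cauchy_schwarz _ _ _) _.
- by move=> r; exact: w0.
- by move=> r; rewrite mulr_ge0 ?cmod_ge0.
under [X in _ * X]eq_bigr do rewrite exprMn -wE.
apply: ler_wpM2r; first by apply: sumr_ge0 => r _; rewrite mulr_ge0 ?sqr_ge0.
by under eq_bigr do rewrite -wE.
Qed.

Section Fixed.
Variables (n : nat) (l : nat -> R) (c : nat -> Rc) (delta : R).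
Hypotheses (d0 : 0 < delta) (d1 : delta <= 1).
Hypothesis gap : forall i, (i < n)%N -> l i + delta <= l i.+1.

Let s := tpoly n.+1 l c.
Let f1 x := complex.Re (tsum s x).
Let f2 x := complex.Im (tsum s x).
Let bf1 : bcont f1. Proof. exact: bcont_Re_tsum. Qed.
Let bf2 : bcont f2. Proof. exact: bcont_Im_tsum. Qed.
Let d j i : Rc := (mH j (l i))%:C * c i.
Let h j := tpoly n.+1 l (d j).

Let LXE1 j x : LX f1 j x = complex.Re (tsum (tmult (fun v : R => (mX j v)%:C) s) x).
Proof. exact: W_Re_tsum (rate_gt0 R j). Qed.
Let LXE2 j x : LX f2 j x = complex.Im (tsum (tmult (fun v : R => (mX j v)%:C) s) x).
Proof. exact: W_Im_tsum (rate_gt0 R j). Qed.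

Let tmultB (m1 m2 : R -> R) x : tsum (tmult (fun v : R => (m1 v - m2 v)%:C) s) x =
  tsum (tmult (fun v : R => (m1 v)%:C) s) x - tsum (tmult (fun v : R => (m2 v)%:C) s) x.
Proof.
rewrite !tsum_mult -sumrB; apply: eq_bigr => p _.
by rewrite rmorphB /=; ring.
Qed.

Let hE1 j x : complex.Re (tsum (h j) x) = W (rate R j) (fun x => LX f1 j.+1 x - LX f1 j x) x.
Proof.
under eq_fun do rewrite !LXE1 -cReN -cReD -tmultB.
rewrite W_Re_tsum ?rate_gt0//; congr complex.Re; congr tsum.
rewrite /h /tpoly /tmult /s /tpoly -!map_comp; apply: eq_map => i /=.
by rewrite /d /mH rmorphM mulrA.
Qed.

Let hE2 j x : complex.Im (tsum (h j) x) = W (rate R j) (fun x => LX f2 j.+1 x - LX f2 j x) x.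
Proof.
under eq_fun do rewrite !LXE2 -cImN -cImD -tmultB.
rewrite W_Im_tsum ?rate_gt0//; congr complex.Im; congr tsum.
rewrite /h /tpoly /tmult /s /tpoly -!map_comp; apply: eq_map => i /=.
by rewrite /d /mH rmorphM mulrA.
Qed.

(** The factor [mX j] in [mH j] is one more average at rate [rate j], so Jensen bounds the square by
    [Lb], the averaged square to which [LP_pow] applies. *)
Let h_le j x : cmod (tsum (h j) x) ^+ 2 <= Lb f1 j x + Lb f2 j x.
Proof.
rewrite cmod_sqr hE1 hE2; apply: lerD; apply: W_sqr; try exact: rate_gt0.
  by apply: bcontB; exact: bLX.
by apply: bcontB; exact: bLX.
Qed.

Let u j x := tsum (tmult (fun v : R => (mL j v)%:C) s) x.

Let u_split j x : u j x = (3^-1)%:C * (4%:C * tsum (tmult (fun v : R => (mX j v)%:C) s) x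
   - tsum (tmult (fun v : R => (mX j.+1 v)%:C) s) x).
Proof.
rewrite /u !tsum_mult mulr_sumr -sumrB mulr_sumr; apply: eq_bigr => p _.
by rewrite /mL !(rmorphM, rmorphB) /=; ring.
Qed.

Let uE1 j x : complex.Re (u j x) = Lw f1 j x.
Proof. by rewrite u_split Re_scaleC cReD cReN Re_scaleC -!LXE1. Qed.

Let uE2 j x : complex.Im (u j x) = Lw f2 j x.
Proof. by rewrite u_split Im_scaleC cImD cImN Im_scaleC -!LXE2. Qed.

Let D j x : Rc := \sum_(i < n.+1) (mS j (l i))%:C * (d j i * cis (l i * x)).

Let sharpE j x : sharp n.+1 l c j x = u j x + D j x.
Proof.
rewrite /sharp /u tsum_mult /s /tpoly big_map big_iota0.
rewrite -big_split /= big_mkcond /=; apply: eq_bigr => i _ /=.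
have := sharp_factor j (l i) => e.
have -> : (if `|l i| <= 2 ^+ j then c i * cis (l i * x) else 0) = ((`|l i| <= 2 ^+ j)%R%:R : R)%:C * c i * cis (l i * x).
  by case: (_ <= _); rewrite /= ?mulr1n ?mulr0n ?mul1r ?rmorph1 ?rmorph0 ?mul1r ?mul0r.
have -> : ((`|l i| <= 2 ^+ j)%R%:R : R) = mL j (l i) + mS j (l i) * mH j (l i) by rewrite -e addrC subrK.
by rewrite /d !(rmorphM, rmorphD) /=; ring.
Qed.

Let Delta j r : R := `|mS j (l r) - mS j (l r.+1)|.
Let P j r x : Rc := \sum_(i < r.+1) d j i * cis (l i * x).

Let l_le i : (i < n)%N -> l i <= l i.+1.
Proof. by move=> /gap; have := d0; lra. Qed.

Let l_gap i k : (i < k)%N -> (k <= n)%N -> l i + delta <= l k.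
Proof.
elim: k => // k ih; rewrite ltnS leq_eqVlt => /predU1P[->|ik] kn; first exact: gap.
by have := ih ik (ltnW kn); have := gap kn; have := d0; lra.
Qed.

Let l_mono i k : (i <= k)%N -> (k <= n)%N -> l i <= l k.
Proof.
rewrite leq_eqVlt => /predU1P[->//|ik] kn; have := l_gap ik kn; have := d0; lra.
Qed.

Let D_le j x : cmod (D j x) ^+ 2 <= 32 * cmod (tsum (h j) x) ^+ 2 + 56 * \sum_(r < n) Delta j r * cmod (P j r x) ^+ 2.
Proof.
have := @abel_bound (fun i => mS j (l i)) (fun i => d j i * cis (l i * x)) n 4 28
  (mS_bound _ _) (mS_variation _ l_le).
rewrite tpolyE -/(D j x); congr (_ <= _ * _ + _ * _); by rewrite ?expr2; ring.
Qed.

Let idx J := [seq (j, r) | j <- iota 0 J, r <- iota 0 n].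
Let tau r := (l r + l r.+1) / 2.
Let wgt (p : nat * nat) : Rc := (Num.sqrt (Delta p.1 p.2))%:C.
(* Cutting at the midpoint [tau r] of the gap after [l r] separates the frequencies by [delta / 2] on
   each side, which makes the partial sums [P j r] analytic parts for the weight [kern (delta / 4)]. *)
Let Fv (p : nat * nat) := tshift (- tau p.2) (tmult (fun=> wgt p) (h p.1)).
Let bv (p : nat * nat) := tconj (tshift (- tau p.2) (tmult (fun=> wgt p) (tpoly p.2.+1 l (d p.1)))).

Let cmod_wgt p z : cmod (wgt p * z) ^+ 2 = Delta p.1 p.2 * cmod z ^+ 2.
Proof. by rewrite cmodM /wgt cmodC (ger0_norm (sqrtr_ge0 _)) exprMn sqr_sqrtr // normr_ge0. Qed.

Let cmod_Fv p x : cmod (tsum (Fv p) x) ^+ 2 = Delta p.1 p.2 * cmod (tsum (h p.1) x) ^+ 2.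
Proof. by rewrite /Fv tsum_shift tsum_scale cmodM cmod_cis mul1r cmod_wgt. Qed.

Let cmod_bv p x : cmod (tsum (bv p) x) ^+ 2 = Delta p.1 p.2 * cmod (P p.1 p.2 x) ^+ 2.
Proof.
by rewrite /bv tsum_conj cmod_conj tsum_shift tsum_scale cmodM cmod_cis mul1r cmod_wgt tpolyE.
Qed.

Let e := delta / 4.
Let e0 : 0 < e. Proof. by rewrite divr_gt0. Qed.

Let pspec_bv p : (p.2 < n)%N -> pspec (2 * e) (tsum (bv p)).
Proof.
move=> pn; exists (bv p) => //; rewrite /spec_ge /bv /tconj /tshift /tmult /tpoly !all_map.
apply/allP => i; rewrite mem_iota add0n ltnS /= => ip; rewrite /e /tau.
by have := l_mono ip (ltnW pn); have := gap pn; lra.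
Qed.

Let pspec_av p : (p.2 < n)%N -> pspec (2 * e) (fun x => tsum (Fv p) x - ((tsum (bv p) x)^*)%C).
Proof.
move=> pn; pose up := [seq (l i, d p.1 i) | i <- iota p.2.+1 (n - p.2)].
exists (tshift (- tau p.2) (tmult (fun=> wgt p) up)).
  apply/spec_ge_shift/spec_ge_mult/spec_ge_terms => i.
  rewrite mem_iota => /andP[ip]; rewrite addSn (subnKC (ltnW pn)) ltnS => iN; rewrite /e /tau.
  by have := l_mono ip iN; have := gap pn; lra.
move=> x; rewrite /bv tsum_conj cconjK /Fv !tsum_shift !tsum_scale.
have -> : h p.1 = tpoly p.2.+1 l (d p.1) ++ up.
  by rewrite /h /tpoly -map_cat -iotaD addSn subnKC// ltnW.
by rewrite tsum_cat; ring.
Qed.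

Let M (f : R -> R) J x := bigmax (iota 0 J.+1) (fun j => W (rate R j) (fun x => `|f x|) x).
Let H J x := \sum_(j < J) cmod (tsum (h j) x) ^+ 2.
Let G J x := \sum_(p <- idx J) cmod (tsum (bv p) x) ^+ 2.
Let T J x := bigmax (iota 0 J) (fun j => cmod (sharp n.+1 l c j x) ^+ 2).

Let LX_le_max f J j x : bcont f -> (j <= J)%N -> LX f j x ^+ 2 <= M f J x ^+ 2.
Proof.
move=> bf jJ; rewrite -[LX f j x ^+ 2]real_normK ?num_real// lerXn2r ?nnegrE ?bigmax_ge0//.
apply: le_trans (W_norm x (rate_gt0 R j) bf) _.
apply: (le_bigmax_in (fun j => W (rate R j) (fun x => `|f x|) x)).
by rewrite mem_iota add0n ltnS.
Qed.

Let Lw_le f J j x : bcont f -> (j < J)%N -> Lw f j x ^+ 2 <= 3 * M f J x ^+ 2.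
Proof.
move=> bf jJ; have := LX_le_max x bf (ltnW jJ); have := LX_le_max x bf jJ.
rewrite /Lw; move: (LX f j x) (LX f j.+1 x) (M f J x ^+ 2) => X Y m.
have := sqr_ge0 (X + Y); have := sqr_ge0 X; rewrite !expr2; lra.
Qed.

Let T_le J x : T J x <= 112 * ((M f1 J x ^+ 2 + M f2 J x ^+ 2) + (H J x + G J x)).
Proof.
have GE : G J x = \sum_(j < J) \sum_(r < n) Delta j r * cmod (P j r x) ^+ 2.
  rewrite /G /idx big_allpairs_dep /= big_iota0.
  apply: eq_bigr => j _; rewrite big_iota0.
  apply: eq_bigr => r _; exact: (cmod_bv (nat_of_ord j, nat_of_ord r)).
have G0 j : 0 <= \sum_(r < n) Delta j r * cmod (P j r x) ^+ 2.
  apply: sumr_ge0 => r _; exact: mulr_ge0 (normr_ge0 _) (sqr_ge0 _).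
have HJ0 : 0 <= H J x by apply: sumr_ge0 => j _; exact: sqr_ge0.
have GJ0 : 0 <= G J x by rewrite GE; apply: sumr_ge0 => j _.
have m1 := sqr_ge0 (M f1 J x); have m2 := sqr_ge0 (M f2 J x).
apply: bigmax_seq_le => [|j]; first by rewrite mulr_ge0// !addr_ge0.
rewrite mem_iota add0n /= => jJ; rewrite sharpE; apply: le_trans (cmodD_sqr _ _) _.
have u1 : cmod (u j x) ^+ 2 <= 3 * M f1 J x ^+ 2 + 3 * M f2 J x ^+ 2.
  by rewrite cmod_sqr uE1 uE2 lerD// Lw_le.
have h1 : cmod (tsum (h j) x) ^+ 2 <= H J x.
  rewrite /H (bigD1 (Ordinal jJ))//= lerDl; apply: sumr_ge0 => i _; exact: sqr_ge0.
have h2 : \sum_(r < n) Delta j r * cmod (P j r x) ^+ 2 <= G J x.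
  by rewrite GE (bigD1 (Ordinal jJ))//= lerDl; apply: sumr_ge0 => i _.
have := D_le j x; move: u1 h1 h2 m1 m2 HJ0 GJ0.
move: (cmod _ ^+ 2) (cmod _ ^+ 2) (cmod _ ^+ 2) (\sum_(r < n) _) (H J x) (G J x) (M f1 J x ^+ 2) (M f2 J x ^+ 2).
move=> a b p q v w m m'; lra.
Qed.

Let kap : R := 2 / e ^+ 2.

(** The passage from the band-limited weight back to [om]. The factor [kap], of order [delta ^- 2],
    carries the dependence of the final constant on the separation. *)
Let kern_E g : bcont g -> (forall x, 0 <= g x) -> intR (fun x => g x * kern e x) <= kap * E 0 g.
Proof.
move=> bg g0; have dw := bcont_dominated bg (om_dominated 0).
rewrite /E -intRZ//; apply: le_intR.
- apply: bcont_dominated => //; exact: kern_dominated (lt0r_neq0 e0).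
- exact: dominated_scale.
move=> x; rewrite subr0 [leRHS]mulrCA; apply: ler_wpM2l => //.
have e1 : e <= 1 by have := d1; rewrite /e; lra.
apply: le_trans (kern_le x _) _; first by rewrite e0.
by rewrite ler_wpM2l ?om_ge_dom// divr_ge0// sqr_ge0.
Qed.

Let bM f J : bcont f -> bcont (M f J).
Proof. by move=> bf; apply: bcont_bigmax => j; exact: W_bcont (rate_gt0 R j) (bcont_norm bf). Qed.

Let bH J : bcont (H J). Proof. by apply: bcont_sum => j _; exact: bcont_cmod2_tsum. Qed.
Let bG J : bcont (G J). Proof. by apply: bcont_sum => p _; exact: bcont_cmod2_tsum. Qed.

Let bT J : bcont (T J).
Proof.
apply: bcont_bigmax => j.
have -> : (fun x => cmod (sharp n.+1 l c j x) ^+ 2) =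
  (fun x => cmod (tsum (tpoly n.+1 l (fun i => if `|l i| <= 2 ^+ j then c i else 0)) x) ^+ 2).
  apply/funext => x; rewrite tpolyE /sharp big_mkcond /=; congr (cmod _ ^+ 2).
  by apply: eq_bigr => i _; case: ifP; rewrite ?mul0r.
exact: bcont_cmod2_tsum.
Qed.

Lemma sharp_maximal_kern k CL CR J : 0 <= CL -> 0 <= CR ->
  (forall f J y, bcont f -> E y (fun x => (\sum_(j < J) Lb f j x) ^+ (2 ^ k)) <= CL * E y (fun x => `|f x| ^+ (2 ^ k.+1))) ->
  (forall (I : Type) (r : seq I) e (F b : I -> seq (R * Rc)),
    0 < e -> (forall i, pspec (2 * e) (tsum (b i))) ->
    (forall i, pspec (2 * e) (fun x => tsum (F i) x - ((tsum (b i) x)^*)%C)) ->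
    intR (fun x => (\sum_(i <- r) cmod (tsum (b i) x) ^+ 2) ^+ (2 ^ k) * kern e x) <=
    CR * intR (fun x => (\sum_(i <- r) cmod (tsum (F i) x) ^+ 2) ^+ (2 ^ k) * kern e x)) ->
  intR (fun x => T J x ^+ (2 ^ k) * kern (delta / 4) x) <=
  448 ^+ (2 ^ k) * (64 + (1 + CR * 28 ^+ (2 ^ k)) * (2 ^+ (2 ^ k) * (2 * CL))) * (2 / (delta / 4) ^+ 2) *
  E 0 (fun x => (cmod (tsum s x) ^+ 2) ^+ (2 ^ k)).
Proof.
move=> CL0 CR0 hL hR; set q := (2 ^ k)%N; rewrite -/e -/kap.
have kap0 : 0 <= kap by rewrite divr_ge0// sqr_ge0.
have q0 : (0 < q)%N by rewrite expn_gt0.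
set N := E 0 _.
have dk := kern_dominated (lt0r_neq0 e0).
have k0 x : 0 <= kern e x by exact: sqr_ge0.
have bN : bcont (fun x => (cmod (tsum s x) ^+ 2) ^+ q) by apply: bcontX; exact: bcont_cmod2_tsum.
have fN f : bcont f -> (forall x, `|f x| <= cmod (tsum s x)) -> E 0 (fun x => `|f x| ^+ (2 ^ k.+1)) <= N.
  move=> bf fc; apply: E_mono => // [|x]; first by apply: bcontX; exact: bcont_norm.
  by rewrite -exprM -expnS lerXn2r ?nnegrE ?cmod_ge0.
have N1 := fN f1 bf1 (fun x => Re_le_cmod _); have N2 := fN f2 bf2 (fun x => Im_le_cmod _).
have dX g : bcont g -> dominated (fun x => g x ^+ q * kern e x).
  by move=> bg; apply: bcont_dominated => //; exact: bcontX.
have M0 f x : 0 <= M f J x ^+ 2 by exact: sqr_ge0.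
have H0 x : 0 <= H J x by apply: sumr_ge0 => j _; exact: sqr_ge0.
have G0 x : 0 <= G J x by apply: sumr_ge0 => j _; exact: sqr_ge0.
have bM2 f : bcont f -> bcont (fun x => M f J x ^+ 2) by move=> bf; apply: bcontX; exact: bM.
have IM f : bcont f -> E 0 (fun x => `|f x| ^+ (2 ^ k.+1)) <= N -> intR (fun x => (M f J x ^+ 2) ^+ q * kern e x) <= kap * (32 * N).
  move=> bf fNN; apply: le_trans (kern_E _ _) _.
  - by apply: bcontX; exact: bM2.
  - by move=> x; exact: exprn_ge0.
  apply: ler_wpM2l => //; apply: (@le_trans _ _ (32 * E 0 (fun x => `|f x| ^+ (2 ^ k.+1)))); last first.
    by rewrite ler_wpM2l.
  have := maximal_W (iota 0 J.+1) k 0 (fun j => rate_ge1 R j) (bcont_norm bf) (fun x => normr_ge0 _).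
  by apply: le_trans; rewrite le_eqVlt; apply/orP; left; apply/eqP/E_eq => x; rewrite /q expnS exprM.
have IH : intR (fun x => H J x ^+ q * kern e x) <= kap * (2 ^+ q * (2 * CL) * N).
  apply: le_trans (kern_E _ _) _; first exact: bcontX.
    by move=> x; exact: exprn_ge0.
  apply: ler_wpM2l => //.
  pose A f x := \sum_(j < J) Lb f j x.
  have bA f : bcont f -> bcont (A f) by move=> bf; apply: bcont_sum => j _; exact: bLb.
  have A0 f x : bcont f -> 0 <= A f x by move=> bf; apply: sumr_ge0 => j _; exact: Lb_ge0.
  have HA x : H J x <= A f1 x + A f2 x by rewrite /H /A -big_split /=; apply: ler_sum => j _; exact: h_le.
  have bq f : bcont f -> bcont (fun x => A f x ^+ q) by move=> bf; apply: bcontX; exact: bA.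
  apply: (@le_trans _ _ (2 ^+ q * (E 0 (fun x => A f1 x ^+ q) + E 0 (fun x => A f2 x ^+ q)))).
    rewrite -ED; [|exact: bq|exact: bq]; rewrite -EZ; last by apply: bcontD; exact: bq.
    apply: E_mono; [exact: bcontX|by apply: bcontZ; apply: bcontD; exact: bq|] => x.
    apply: (@le_trans _ _ ((A f1 x + A f2 x) ^+ q)); last by apply: exprD_le; exact: A0.
    by rewrite lerXn2r ?nnegrE// addr_ge0// A0.
  rewrite -mulrA; apply: ler_wpM2l; first exact: exprn_ge0.
  have a1 := le_trans (hL f1 J 0 bf1) (ler_wpM2l CL0 N1).
  have a2 := le_trans (hL f2 J 0 bf2) (ler_wpM2l CL0 N2).
  by have := lerD a1 a2; rewrite -/q; congr (_ <= _); ring.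
have IG : intR (fun x => G J x ^+ q * kern e x) <= CR * (28 ^+ q * intR (fun x => H J x ^+ q * kern e x)).
  have in_idx (p : nat * nat) : p \in idx J -> (p.2 < n)%N.
    by move=> /allpairsP[[a b] [/= _ + ->]]; rewrite mem_iota.
  pose ok (p : nat * nat) := (p.2 < n)%N.
  (* The Riesz estimate asks for its spectral conditions at every index, whereas they hold only for
     [p.2 < n]; off that range both families are replaced by the zero sum. *)
  pose F' p := if ok p then Fv p else [::]; pose b' p := if ok p then bv p else [::].
  have pnil (g : R -> Rc) : g =1 (fun=> 0) -> pspec (2 * e) g.
    by move=> g0; exists [::] => // x; rewrite g0 tsum_nil.
  have := hR _ (idx J) e F' b' e0.
  have -> : (fun x => (\sum_(i <- idx J) cmod (tsum (b' i) x) ^+ 2) ^+ q * kern e x) = (fun x => G J x ^+ q * kern e x).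
    apply/funext => x; congr (_ ^+ _ * _); rewrite big_seq [RHS]big_seq; apply: eq_bigr => p /in_idx pn.
    by rewrite /b' /ok pn.
  move=> hRR; apply: le_trans (hRR _ _) _.
  - move=> p; rewrite /b' /ok; case: ifP => [|_]; first exact: pspec_bv.
    by apply: pnil => x; rewrite tsum_nil.
  - move=> p; rewrite /F' /b' /ok; case: ifP => [|_]; first exact: pspec_av.
    by apply: pnil => x; rewrite tsum_nil conjc0 subr0.
  apply: ler_wpM2l => //; rewrite -intRZ; last exact: dX.
  apply: le_intR.
  - apply: bcont_dominated => //; apply: bcontX; apply: bcont_sum => p _; exact: bcont_cmod2_tsum.
  - by apply: dominated_scale; exact: dX.
  move=> x; rewrite mulrA -exprMn ler_wpM2r// lerXn2r ?nnegrE ?mulr_ge0//.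
    by apply: sumr_ge0 => p _; exact: sqr_ge0.
  rewrite /idx big_allpairs_dep /= big_iota0 /H mulr_sumr.
  apply: ler_sum => j _; rewrite big_iota0.
  apply: (@le_trans _ _ ((\sum_(r < n) Delta j r) * cmod (tsum (h j) x) ^+ 2)).
    rewrite mulr_suml; apply: ler_sum => r _.
    by rewrite /F' /ok /= ltn_ord cmod_Fv.
  by rewrite ler_wpM2r ?sqr_ge0// mS_variation.
have main : intR (fun x => T J x ^+ q * kern e x) <= 448 ^+ q *
   ((intR (fun x => (M f1 J x ^+ 2) ^+ q * kern e x) + intR (fun x => (M f2 J x ^+ 2) ^+ q * kern e x)) +
    (intR (fun x => H J x ^+ q * kern e x) + intR (fun x => G J x ^+ q * kern e x))).
  have D1 := dX _ (bM2 f1 bf1); have D2 := dX _ (bM2 f2 bf2); have D3 := dX _ (bH J); have D4 := dX _ (bG J).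
  have D12 := dominated_add D1 D2; have D34 := dominated_add D3 D4.
  rewrite -(intRD D1 D2) -(intRD D3 D4) -(intRD D12 D34) -(intRZ _ (dominated_add D12 D34)).
  apply: le_intR; [exact: dX|by apply: dominated_scale; exact: dominated_add|] => x.
  rewrite -!mulrDl mulrA; apply: ler_wpM2r => //.
  have T0 : 0 <= T J x := bigmax_ge0 _ _.
  have := T_le J x; move: (M0 f1 x) (M0 f2 x) (H0 x) (G0 x) T0.
  move: (M f1 J x ^+ 2) (M f2 J x ^+ 2) (H J x) (G J x) (T J x) => a b u' v t a0 b0 u0 v0 t0 tl.
  apply: (@le_trans _ _ ((112 * ((a + b) + (u' + v))) ^+ q)).
    by rewrite lerXn2r ?nnegrE// mulr_ge0// !addr_ge0.
  (* The four terms of [T_le] are separated by two nested uses of [exprD_le], each costing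
     [2 ^+ q]. *)
  have -> : 448 ^+ q = 112 ^+ q * (2 ^+ q * 2 ^+ q) :> R.
    by rewrite -!exprMn; congr (_ ^+ _); rewrite -!natrM.
  rewrite exprMn -mulrA; apply: ler_wpM2l; first exact: exprn_ge0.
  have p2 : 0 <= 2 ^+ q :> R by exact: exprn_ge0.
  apply: le_trans (exprD_le q (addr_ge0 a0 b0) (addr_ge0 u0 v0)) _.
  rewrite -mulrA; apply: ler_wpM2l => //; rewrite mulrDr.
  by apply: lerD; exact: exprD_le.
have alg (u' m a b r D' : R) : a * (32 * m) + a * (32 * m) + (a * (b * (2 * u') * m) + r * (D' * (a * (b * (2 * u') * m))))
    = (64 + (1 + r * D') * (b * (2 * u'))) * (a * m) by ring.
have fin (v a p t b m : R) : 0 <= a -> p <= t * (b * m) -> v <= a * p -> v <= a * t * b * m.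
  by move=> a0 pt va; rewrite -!mulrA; apply: le_trans va _; apply: ler_wpM2l.
have i1 := IM f1 bf1 N1; have i2 := IM f2 bf2 N2.
have i4 := le_trans IG (ler_wpM2l CR0 (ler_wpM2l (exprn_ge0 q (ler0n R 28)) IH)).
have a0 : 0 <= 448 ^+ q :> R := exprn_ge0 q (ler0n R 448).
refine (fin _ _ _ _ _ _ a0 _ main).
by rewrite -alg; exact: (lerD (lerD i1 i2) (lerD IH i4)).
Qed.

End Fixed.

End PolynomialCase.

(** * The sharp maximal inequality in the uniform local norm *)

Section PolynomialTheorem.
Variable R : realType.
Local Notation Rc := (R[i]).
Implicit Types (x y : R) (l : nat -> R) (c : nat -> Rc).

Lemma prim_shift (g : R -> R) y a b : continuous g ->
  prim (fun x => g (x + y)) b - prim (fun x => g (x + y)) a = prim g (b + y) - prim g (a + y).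
Proof.
move=> cg.
have cs : continuous (fun x => g (x + y)).
  move=> x; apply: (@continuous_comp _ _ _ (fun x => x + y) g); last exact: cg.
  by apply: cvgD; [exact: cvg_id|exact: cvg_cst].
have dg : deriv_of (fun x => prim g (x + y)) (fun x => g (x + y)).
  by apply: deriv_ext (deriv_compl 1 y (prim_deriv cg)) => x; rewrite !mul1r.
exact: (deriv_eq b a (prim_deriv cs) dg).
Qed.

Lemma unif_le_shift (g : R -> R) K y : continuous g -> unif_le g K -> unif_le (fun x => g (x + y)) K.
Proof.
by move=> cg gK z; rewrite prim_shift// addrAC; exact: gK.
Qed.

Lemma sharp_maximal_unif k (delta : R) : 0 < delta -> delta <= 1 ->
  exists2 C : R, 0 <= C & forall n l c, (forall i, (i < n)%N -> l i + delta <= l i.+1) ->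
  forall K, unif_le (fun x => (cmod (tsum (tpoly n.+1 l c) x) ^+ 2) ^+ (2 ^ k)) K ->
  forall J, unif_le (fun x => (bigmax (iota 0 J) (fun j => cmod (sharp n.+1 l c j x) ^+ 2)) ^+ (2 ^ k)) (C * K).
Proof.
move=> d0 d1; have [CL CL0 hL] := LP_pow R k.
have [CR CR0 hR] := riesz_vector R (2 ^ k).-1.
rewrite prednK ?expn_gt0// in hR.
pose A : R := 448 ^+ (2 ^ k) * (64 + (1 + CR * 28 ^+ (2 ^ k)) * (2 ^+ (2 ^ k) * (2 * CL))) * (2 / (delta / 4) ^+ 2).
have A0 : 0 <= A.
  apply: mulr_ge0; last by rewrite divr_ge0// sqr_ge0.
  apply: mulr_ge0; first exact: (exprn_ge0 _ (ler0n R 448)).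
  apply: addr_ge0 => //; apply: mulr_ge0; last by rewrite mulr_ge0 ?exprn_ge0// mulr_ge0.
  by rewrite addr_ge0// mulr_ge0// exprn_ge0.
exists (4 * (A * 512)).
  exact: mulr_ge0 (ler0n R 4) (mulr_ge0 A0 (ler0n R 512)).
move=> n l c gap K cK J y.
(* Translation by [y] only rotates the coefficients, so the frequencies and their gaps are kept and
   the weight can stay centred at [0]. There [kern (delta / 4)] is at least 1/4 on [[0, 1]], whence
   the factor 4. *)
pose c' i := c i * cis (l i * y).
have shiftE i x : c' i * cis (l i * x) = c i * cis (l i * (x + y)).
  by rewrite /c' -mulrA -cisD addrC -mulrDr.
have tE x : tsum (tpoly n.+1 l c') x = tsum (tpoly n.+1 l c) (x + y).
  by rewrite !tpolyE; apply: eq_bigr => i _; exact: shiftE.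
have sE j x : sharp n.+1 l c' j x = sharp n.+1 l c j (x + y).
  by apply: eq_bigr => i _; exact: shiftE.
set q := (2 ^ k)%N in hL hR A A0 cK *.
pose T c x := bigmax (iota 0 J) (fun j => cmod (sharp n.+1 l c j x) ^+ 2).
have bT c0 : bcont (T c0).
  apply: bcont_bigmax => j; have := bcont_cmod2_tsum (tpoly n.+1 l (fun i => if `|l i| <= 2 ^+ j then c0 i else 0)).
  congr bcont; apply/funext => x; rewrite tpolyE /sharp [in RHS]big_mkcond /=; congr (cmod _ ^+ 2).
  by apply: eq_bigr => i _; case: ifP; rewrite ?mul0r.
have bTq c0 : bcont (fun x => T c0 x ^+ q) by exact: bcontX.
have TE : (fun x => T c' x ^+ q) = (fun x => T c (x + y) ^+ q).
  by apply/funext => x; rewrite /T; under [in LHS]eq_fun do rewrite sE.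
have e0 : 0 < delta / 4 by rewrite divr_gt0.
have main : intR (fun x => T c' x ^+ q * kern (delta / 4) x) <= A * (512 * K).
  apply: le_trans (@sharp_maximal_kern R n l c' delta d0 d1 gap k CL CR J CL0 CR0 hL hR) _.
  rewrite -/A; apply: ler_wpM2l => //; apply: unif_le_E.
  - by apply: bcontX; exact: bcont_cmod2_tsum.
  - by move=> x; rewrite !exprn_ge0 ?cmod_ge0.
  - under eq_fun do rewrite tE.
    apply: unif_le_shift cK; have [] // : bcont (fun x => (cmod (tsum (tpoly n.+1 l c) x) ^+ 2) ^+ q).
    by apply: bcontX; exact: bcont_cmod2_tsum.
have dk := bcont_dominated (bTq c') (kern_dominated (lt0r_neq0 e0)).
have k0 z : 0 <= T c' z ^+ q * kern (delta / 4) z.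
  exact: mulr_ge0 (exprn_ge0 _ (bigmax_ge0 _ _)) (sqr_ge0 _).
have [ck _] := dk.
have s1 := intR_ge_itv (prim_deriv ck) dk k0 ler01.
have [cTq _] := bTq c'; have [cT0 _] := bTq c.
have s2 := deriv_diff_le (prim_deriv cTq) (deriv_scale 4 (prim_deriv ck)) ler01.
have := prim_shift y 0 1 cT0; rewrite -TE add0r [1 + y]addrC => <-.
apply: le_trans (s2 _) _.
  move=> z /andP[z0 z1].
  have : 4^-1 <= kern (delta / 4) z.
    rewrite /kern; apply: sinc_ge; apply/andP; split; first exact: mulr_ge0 (ltW e0) z0.
    have e1 : delta / 4 <= 1 by lra.
    by have := ler_pM (ltW e0) z0 e1 z1; rewrite mulr1.
  move: (kern _ z) (T c' z ^+ q) (exprn_ge0 q (bigmax_ge0 _ _ : 0 <= T c' z)) => a b b0 ab.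
  have := mulr_ge0 b0 (_ : 0 <= a - 4^-1); rewrite subr_ge0 => /(_ ab); lra.
have alg (u v w a b : R) : u - v <= w -> w <= b * (512 * a) -> 4 * u - 4 * v <= 4 * (b * 512) * a.
  by move=> h1 h2; have := le_trans h1 h2; lra.
exact: alg s1 main.
Qed.

End PolynomialTheorem.

(** * Uniform local integrals *)

Section UniformIntegrals.
Variable R : realType.
Local Notation Rc := (R[i]).
Local Notation mu := (@lebesgue_measure R).
Implicit Types (x y T : R) (g h : R -> R) (f : R -> Rc).

Definition unif_int g (K : R) := forall x, (\int[mu]_(s in `[x, (x + 1)%R]) (g s)%:E <= K%:E)%E.

Lemma measurable_funE g (D : set R) : measurable_fun [set: R] g -> measurable_fun D (EFin \o g).
Proof. by move=> mg; apply/measurable_EFinP; exact: measurable_funS mg. Qed.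

Lemma unif_int_mono g h K : measurable_fun [set: R] g -> measurable_fun [set: R] h ->
  (forall x, 0 <= g x) -> (forall x, g x <= h x) -> unif_int h K -> unif_int g K.
Proof.
move=> mg mh g0 gh hK x; apply: le_trans (hK x).
by apply: ge0_le_integral => // [s _|||s _]; rewrite ?lee_fin//; exact: measurable_funE.
Qed.

Lemma unif_int_le g K L : K <= L -> unif_int g K -> unif_int g L.
Proof. by move=> KL gK x; apply: le_trans (gK x) _; rewrite lee_fin. Qed.

Lemma unif_int_add g h K L : measurable_fun [set: R] g -> measurable_fun [set: R] h ->
  (forall x, 0 <= g x) -> (forall x, 0 <= h x) -> unif_int g K -> unif_int h L ->
  unif_int (fun x => g x + h x) (K + L).
Proof.
move=> mg mh g0 h0 gK hL x; rewrite EFinD; under eq_integral do rewrite EFinD.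
rewrite ge0_integralD//; [exact: leeD|..]; try (exact: measurable_funE).
  by move=> s _; rewrite lee_fin.
by move=> s _; rewrite lee_fin.
Qed.

Lemma unif_int_scale a g K : 0 <= a -> measurable_fun [set: R] g -> (forall x, 0 <= g x) ->
  unif_int g K -> unif_int (fun x => a * g x) (a * K).
Proof.
move=> a0 mg g0 gK x; under eq_integral do rewrite EFinM.
rewrite ge0_integralZl_EFin//; [|by move=> s _; rewrite lee_fin|exact: measurable_funE].
by rewrite EFinM lee_wpmul2l.
Qed.

Lemma continuous_measurable g : continuous g -> measurable_fun [set: R] g.
Proof. exact: continuous_measurable_fun. Qed.

Lemma unif_int_continuous g K : continuous g -> unif_int g K <-> unif_le g K.
Proof.
move=> cg.
have e x : (\int[mu]_(s in `[x, (x + 1)%R]) (g s)%:E = (prim g (x + 1) - prim g x)%:E)%E.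
  rewrite -(Rintegral_deriv cg (prim_deriv cg)) ?lerDl// /Rintegral fineK//.
  exact: integrable_fin_num (continuous_itv_integrable _ _ cg).
by split=> gK x; have := gK x; rewrite e lee_fin.
Qed.

Lemma unif_int_cst a : unif_int (fun=> a) a.
Proof.
apply/unif_int_continuous; first exact: cst_continuous.
move=> x; have dl : deriv_of (fun x => a * x) (fun=> a).
  by apply: deriv_ext (deriv_scale a (@deriv_id R)) => z; rewrite ?mulr1.
rewrite (deriv_eq (x + 1) x (prim_deriv (@cst_continuous _ _ a)) dl).
by rewrite mulrDr mulr1 addrC addKr.
Qed.

Lemma unif_int_nat g K x n : measurable_fun [set: R] g -> (forall x, 0 <= g x) -> unif_int g K ->
  (\int[mu]_(s in `[x, (x + n%:R)%R]) (g s)%:E <= (n%:R * K)%:E)%E.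
Proof.
move=> mg g0 gK; have G0 s : (0 <= (g s)%:E)%E by rewrite lee_fin.
elim: n => [|n ih]; first by rewrite addr0 set_itv1 integral_set1 mul0r.
have -> : `[x, x + n.+1%:R]%classic = `[x, x + n%:R] `|` `]x + n%:R, x + n.+1%:R]%classic.
  by rewrite -itv_bndbnd_setU// bnd_simp ?lerDl// lerD2l ler_nat.
rewrite ge0_integral_setU//=; last 2 first.
- exact: measurable_funE.
- apply/disj_setPS => s [] /=; rewrite !in_itv /= => /andP[_ a] /andP[b _].
  by have := lt_le_trans b a; rewrite ltxx.
rewrite -[n.+1]addn1 natrD mulrDl mul1r EFinD; apply: leeD => //.
apply: le_trans (gK (x + n%:R)); apply: ge0_subset_integral => //; first exact: measurable_funE.
by move=> s /=; rewrite !in_itv /= addrA => /andP[/ltW -> ->].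
Qed.

Lemma unif_int_mean g h K T : measurable_fun [set: R] g -> measurable_fun [set: R] h ->
  (forall x, `|h x| <= g x) -> unif_int g K -> 1 <= T ->
  mu.-integrable `[- T, T] (fun x => (h x)%:E) /\
  `|(2 * T)^-1 * \int[mu]_(x in `[- T, T]) h x| <= 2 * K.
Proof.
move=> mg mh hg gK T1.
have g0 x : 0 <= g x by exact: le_trans (hg x).
have K0 : 0 <= K.
  by have := gK 0; rewrite -lee_fin; apply: le_trans; apply: integral_ge0 => s _; rewrite lee_fin.
have T2 : 0 < 2 * T by lra.
pose n := (Num.trunc (2 * T)).+1.
have nT : 2 * T <= n%:R <= 2 * T + 1.
  have /andP[a b] := truncn_itv (ltW T2); apply/andP; split; first exact: ltW.
  by rewrite /n -natr1 lerD2r.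
have bd : (\int[mu]_(x in `[(- T)%R, T]) (g x)%:E <= (n%:R * K)%:E)%E.
  apply: le_trans (unif_int_nat (- T) n mg g0 gK).
  apply: ge0_subset_integral => //; first exact: measurable_funE.
    by move=> s _; rewrite lee_fin.
  move=> s /=; rewrite !in_itv /= => /andP[-> sT] /=.
  by move: nT => /andP[nT _]; lra.
have ig : mu.-integrable `[- T, T] (fun x => (h x)%:E).
  apply: (@le_integrable _ _ _ mu _ _ _ (fun x => (g x)%:E)) => //.
  - exact: measurable_funE.
  - by move=> s _; rewrite /= lee_fin (ger0_norm (g0 s)).
  apply/integrableP; split; first exact: measurable_funE.
  under eq_integral do rewrite /= ger0_norm//.
  by apply: le_lt_trans bd _; rewrite ltry.
split=> //; rewrite normrM normfV (gtr0_norm T2) mulrC ler_pdivrMr//.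
apply: (@le_trans _ _ (n%:R * K)); last first.
  have h1 : 0 <= K * (T - 1) by rewrite mulr_ge0// subr_ge0.
  have h2 : 0 <= K * (2 * T + 1 - n%:R) by rewrite mulr_ge0// subr_ge0; move: nT => /andP[].
  by move: h1 h2 K0; clear; move: (n%:R : R) => N; lra.
apply: le_trans (le_normr_Rintegral _ ig) _ => //.
rewrite -lee_fin; apply: le_trans bd; rewrite /Rintegral fineK.
  apply: ge0_le_integral => //; try (by move=> s _; rewrite lee_fin); apply: measurable_funE => //.
  exact: measurableT_comp.
by apply: integrable_fin_num => //; have := integrable_norm ig.
Qed.

(** A substitute for Holder's inequality: local integrals of [u ^+ n.+1] at most [eta ^+ n.+1] give
    local integrals of [u] at most [2 * eta]. *)
Lemma le_cut_pow (u eta : R) n : 0 <= u -> 0 < eta -> u <= eta + u ^+ n.+1 / eta ^+ n.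
Proof.
move=> u0 e0; have [ue|/ltW eu] := leP u eta.
  by apply: le_trans ue _; rewrite lerDl mulr_ge0 ?exprn_ge0// invr_ge0 exprn_ge0// ltW.
rewrite (@le_trans _ _ (u ^+ n.+1 / eta ^+ n))//; last by rewrite lerDr ltW.
rewrite exprS -mulrA ler_peMr// -expr_div_n exprn_ege1// ler_pdivlMr// mul1r //.
Qed.

End UniformIntegrals.

(** * Fourier coefficients *)

Section FourierMeans.
Variable R : realType.
Local Notation Rc := (R[i]).
Local Notation mu := (@lebesgue_measure R).
Implicit Types (x y T l : R) (f : R -> Rc) (s : seq (R * Rc)) (u z : Rc).

Definition coef s l : Rc := \sum_(p <- s | p.1 == l) p.2.

Definition rmean (h : R -> R) T : R := (2 * T)^-1 * \int[mu]_(x in `[- T, T]) h x.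

Lemma tsum_primitive s : exists G A, deriv_of G (fun x => complex.Re (tsum s x) - complex.Re (coef s 0)) /\
  forall x, `|G x| <= A.
Proof.
elim: s => [|[nu c] s [G [A [dG bG]]]].
  exists (fun=> 0), 0; split=> [|x]; last by rewrite normr0.
  by apply: deriv_ext (deriv_cst 0) => // x; rewrite tsum_nil /coef big_nil subrr.
have e x : complex.Re (tsum ((nu, c) :: s) x) =
    complex.Re c * cos (nu * x) - complex.Im c * sin (nu * x) + complex.Re (tsum s x).
  by rewrite tsum_cons cReD cReM.
rewrite /coef; have [nu0|nu0] := eqVneq nu 0.
  exists G, A; split=> //; apply: deriv_ext dG => // x.
  rewrite e big_cons /= nu0 eqxx cReD -/(coef s 0) mul0r cos0 sin0; ring.
exists (fun x => nu^-1 * (complex.Re c * sin (nu * x) + complex.Im c * cos (nu * x)) + G x),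
  (`|nu^-1| * (`|complex.Re c| + `|complex.Im c|) + A); split=> [|x].
  have d1 := deriv_add (deriv_scale (complex.Re c) (deriv_sin nu)) (deriv_scale (complex.Im c) (deriv_cos nu)).
  apply: deriv_ext (deriv_add (deriv_scale nu^-1 d1) dG) => // x.
  rewrite e big_cons /= (negPf nu0) -/(coef s 0).
  move: (cos _) (sin _) (complex.Re (tsum _ _)) (complex.Re (coef _ _)) => C S Z W.
  by field.
apply: le_trans (ler_normD _ _) _; apply: lerD => //.
rewrite normrM ler_wpM2l//; apply: le_trans (ler_normD _ _) _.
by apply: lerD; rewrite normrM ler_piMr// ler_norml ?cos_le1 ?sin_le1 ?cos_geN1 ?sin_geN1.
Qed.

Lemma tsum_rmean s : exists A : R, forall T, 1 <= T ->
  `|rmean (fun x => complex.Re (tsum s x)) T - complex.Re (coef s 0)| <= A / T.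
Proof.
have [G [A [dG bG]]] := tsum_primitive s; exists A => T T1.
have T0 : 0 < T by lra.
set m := complex.Re (coef s 0) in dG *.
have dP : deriv_of (fun x => G x + m * x) (fun x => complex.Re (tsum s x)).
  by apply: deriv_ext (deriv_add dG (deriv_scale m (@deriv_id R))) => // x; rewrite mulr1 subrK.
have [ct _] := bcont_Re_tsum s.
rewrite /rmean (Rintegral_deriv ct dP); last lra.
have -> : (2 * T)^-1 * (G T + m * T - (G (- T) + m * - T)) - m = (2 * T)^-1 * (G T - G (- T)).
  by field; rewrite lt0r_neq0.
rewrite normrM gtr0_norm ?invr_gt0 ?mulr_gt0//.
have -> : A / T = (2 * T)^-1 * (A + A) by field; rewrite lt0r_neq0.
apply: ler_wpM2l; first by rewrite invr_ge0 mulr_ge0// ltW.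
exact: le_trans (ler_normB _ _) (lerD (bG T) (bG (- T))).
Qed.

Lemma cmod_le_parts z : cmod z <= `|complex.Re z| + `|complex.Im z|.
Proof.
have n0 : 0 <= `|complex.Re z| + `|complex.Im z| by exact: addr_ge0.
rewrite -(ler_pXn2r (n := 2))// ?nnegrE ?cmod_ge0// cmod_sqr sqrrD !real_normK ?num_real//.
by rewrite addrAC lerDl mulrn_wge0// mulr_ge0.
Qed.

Lemma Im_Re z : complex.Re (- 'i * z) = complex.Im z.
Proof. by case: z => a b /=; ring. Qed.

Lemma cmod_measurable f : cmeasurable f -> measurable_fun [set: R] (fun x => cmod (f x)).
Proof.
move=> [m1 m2].
have -> : (fun x => cmod (f x)) = (fun x => Num.sqrt (complex.Re (f x) ^+ 2 + complex.Im (f x) ^+ 2)).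
  by apply/funext => x; rewrite -cmod_sqr sqrtr_sqr ger0_norm// cmod_ge0.
apply: (measurableT_comp (continuous_measurable (@sqrt_continuous R))).
by apply: measurable_funD; exact: measurable_funX.
Qed.

Lemma cmeasurableM f g : cmeasurable f -> cmeasurable g -> cmeasurable (fun x => f x * g x).
Proof.
move=> [a b] [c d]; split.
  under eq_fun do rewrite cReM.
  by apply: measurable_funB; exact: measurable_funM.
under eq_fun do rewrite cImM.
by apply: measurable_funD; exact: measurable_funM.
Qed.

Lemma cmeasurableB f g : cmeasurable f -> cmeasurable g -> cmeasurable (fun x => f x - g x).
Proof.
move=> [a b] [c d]; split.
  by under eq_fun do rewrite cReD cReN; exact: measurable_funB.
by under eq_fun do rewrite cImD cImN; exact: measurable_funB.
Qed.

Lemma cmeasurable_tsum s : cmeasurable (tsum s).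
Proof.
split; apply: continuous_measurable; [exact: (bcont_Re_tsum s).1|exact: (bcont_Im_tsum s).1].
Qed.

Lemma cis_tsum l x : cis (l * x) = tsum [:: (l, 1)] x.
Proof. by rewrite tsum_cons tsum_nil addr0 mul1r. Qed.

(** The factor [u] is later [1] or [- 'i], so that a single real statement serves the real and the
    imaginary part of a Fourier mean. *)
Lemma close_mean f s l u (eta : R) n T : 0 < eta -> cmod u <= 1 -> cmeasurable f ->
  unif_int (fun x => cmod (f x - tsum s x) ^+ n.+1) (eta ^+ n.+1) -> 1 <= T ->
  `|rmean (fun x => complex.Re (u * (f x * cis (- (l * x))))) T -
    rmean (fun x => complex.Re (tsum (tmult (fun=> u) (tshift (- l) s)) x)) T| <= 4 * eta.
Proof.
move=> e0 u1 mf fs T1.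
pose w x := f x - tsum s x; pose h x := complex.Re (u * (w x * cis (- (l * x)))).
have mw : cmeasurable w by apply: cmeasurableB => //; exact: cmeasurable_tsum.
have mc : cmeasurable (fun x => cis (- (l * x))).
  have -> : (fun x => cis (- (l * x))) = tsum [:: (- l, 1)].
    by apply/funext => x; rewrite -mulNr cis_tsum.
  exact: cmeasurable_tsum.
have mu' : cmeasurable (fun=> u) by split; exact: measurable_cst.
have mh : measurable_fun [set: R] h by have [] := cmeasurableM mu' (cmeasurableM mw mc).
pose g x := eta + (eta ^+ n)^-1 * cmod (w x) ^+ n.+1.
have mwn := measurable_funX n.+1 (cmod_measurable mw).
have mg : measurable_fun [set: R] g.
  by apply: measurable_funD => //; apply: measurable_funM.
have hg x : `|h x| <= g x.
  apply: le_trans (Re_le_cmod _) _; rewrite !cmodM -mulNr cmod_cis mulr1.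
  apply: (@le_trans _ _ (cmod (w x))); first by rewrite ler_piMl ?cmod_ge0.
  by rewrite /g mulrC; apply: le_cut_pow; rewrite ?cmod_ge0.
have en : 0 < eta ^+ n by exact: exprn_gt0.
have ug : unif_int g (2 * eta).
  have -> : 2 * eta = eta + (eta ^+ n)^-1 * eta ^+ n.+1.
    by rewrite exprSr mulKf ?lt0r_neq0//; lra.
  apply: unif_int_add.
  - exact: measurable_cst.
  - by apply: measurable_funM => //; exact: measurable_cst.
  - by move=> x; exact: ltW.
  - by move=> x; rewrite mulr_ge0 ?invr_ge0 ?exprn_ge0 ?cmod_ge0// ltW.
  - exact: unif_int_cst.
  - apply: unif_int_scale => //; first by rewrite invr_ge0 ltW.
    by move=> x; rewrite exprn_ge0 ?cmod_ge0.
have [ih bh] := unif_int_mean mg mh hg ug T1.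
have [ct _] := bcont_Re_tsum (tmult (fun=> u) (tshift (- l) s)).
have -> : (fun x => complex.Re (u * (f x * cis (- (l * x))))) =
   (fun x => h x + complex.Re (tsum (tmult (fun=> u) (tshift (- l) s)) x)).
  apply/funext => x; rewrite tsum_scale tsum_shift /h /w -cReD; congr complex.Re.
  by rewrite mulNr; ring.
rewrite /rmean RintegralD//; last exact: continuous_itv_integrable.
by rewrite mulrDr addrK; apply: le_trans bh _; lra.
Qed.

Lemma fourier_meanE f l T : fourier_mean f l T =
  (rmean (fun x => complex.Re (1 * (f x * cis (- (l * x))))) T) +i*
  (rmean (fun x => complex.Re (- 'i * (f x * cis (- (l * x))))) T).
Proof.
have -> : (fun x => complex.Re (- 'i * (f x * cis (- (l * x))))) = (fun x => complex.Im (f x * cis (- (l * x)))).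
  by apply/funext => x; exact: Im_Re.
under [in RHS]eq_fun do rewrite mul1r.
rewrite /fourier_mean /cintegral /rmean; apply/eqP; rewrite eq_complex /=.
by rewrite !mul0r subr0 addr0 !eqxx.
Qed.

(** Writing the exponent as [n.+1] makes it positive by construction; it is used with
    [n = (2 ^ k).-1]. *)
Definition close n (eta : R) f s := unif_int (fun x => cmod (f x - tsum s x) ^+ n.+1) (eta ^+ n.+1).

Definition approximable n f := cmeasurable f /\ forall eta : R, 0 < eta -> exists s, close n eta f s.

Lemma coef_scale_shift u s l : coef (tmult (fun=> u) (tshift (- l) s)) 0 = u * coef s l.
Proof.
rewrite /coef /tmult /tshift !big_map mulr_sumr; apply: eq_bigl => p /=.
by rewrite subr_eq0.
Qed.

Lemma near_mean f s l u (eta : R) n : 0 < eta -> cmod u <= 1 -> cmeasurable f -> close n eta f s ->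
  \forall T \near +oo, `|rmean (fun x => complex.Re (u * (f x * cis (- (l * x))))) T - complex.Re (u * coef s l)| <= 5 * eta.
Proof.
move=> e0 u1 mf fs; have [A hA] := tsum_rmean (tmult (fun=> u) (tshift (- l) s)).
rewrite coef_scale_shift in hA.
near=> T.
have T1 : 1 <= T by near: T; apply: nbhs_pinfty_ge; exact: num_real.
have := close_mean l e0 u1 mf fs T1; have := hA _ T1.
have : A / T <= eta.
  have : A / eta <= T by near: T; apply: nbhs_pinfty_ge; exact: num_real.
  rewrite ler_pdivrMr// => h; rewrite ler_pdivrMr; last exact: lt_le_trans ltr01 T1.
  by rewrite mulrC.
move: (rmean _ _) (rmean _ _) (complex.Re _) (A / T) => a b c d h1 h2 h3.
have := ler_normD (a - b) (b - c); rewrite addrA subrK; lra.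
Unshelve. all: by end_near.
Qed.

Lemma rmean_cvg n f l u : cmod u <= 1 -> approximable n f ->
  cvg (rmean (fun x => complex.Re (u * (f x * cis (- (l * x))))) T @[T --> +oo]).
Proof.
move=> u1 [mf af]; apply/cauchy_cvgP; apply: cauchy_exP => e e0.
have e5 : 0 < e / 6 by rewrite divr_gt0.
have [s cs] := af _ e5.
exists (complex.Re (u * coef s l)).
have := near_mean l e5 u1 mf cs; apply: filterS => T.
rewrite /ball /= distrC => h; apply: le_lt_trans h _; lra.
Qed.

Lemma cvg_complex (a b : R -> R) (A B : R) : a T @[T --> +oo] --> A -> b T @[T --> +oo] --> B ->
  ((a T +i* b T : R[i]^o) @[T --> +oo] --> (A +i* B : R[i]^o)).
Proof.
move=> /cvgrPdist_lt ha /cvgrPdist_lt hb; apply/cvgrPdist_lt => -[e e'] /= eps0.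
(* A positive element of [R[i]] has zero imaginary part, so the radius is the real number [e]. *)
move: eps0; rewrite ltcE /= => /andP[/eqP -> e0].
have e2 : 0 < e / 2 by rewrite divr_gt0.
have h1 := ha _ e2; have h2 := hb _ e2.
near=> T.
have k1 : `|A - a T| < e / 2 by near: T.
have k2 : `|B - b T| < e / 2 by near: T.
suff : cmod ((A +i* B) - (a T +i* b T)) < e by rewrite ltcE /= eqxx.
apply: le_lt_trans (cmod_le_parts _) _ => /=.
lra.
Unshelve. all: by end_near.
Qed.

Lemma fourier_mean_cvg n f l : approximable n f -> cvg (fourier_mean f l T @[T --> +oo]).
Proof.
move=> af; apply/cvg_ex.
have u1 : cmod (1 : Rc) <= 1 by rewrite cmod1.
have u2 : cmod (- 'i : Rc) <= 1 by rewrite cmodN /cmod /= expr0n expr1n add0r sqrtr1.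
have h1 := @rmean_cvg _ f l _ u1 af; have h2 := @rmean_cvg _ f l _ u2 af.
eexists; under eq_fun do rewrite fourier_meanE; exact: cvg_complex h1 h2.
Qed.

(** Both are limits of means that stay within a fixed multiple of [eta] of each other. The bound is
    uniform in [l], so one approximant [s] serves all frequencies of a kernel at once. *)
Lemma fourier_coef_close n f s l (eta : R) : approximable n f -> 0 < eta -> close n eta f s ->
  cmod (fourier_coef f l - coef s l) <= 12 * eta.
Proof.
move=> af e0 cs.
have u1 : cmod (1 : Rc) <= 1 by rewrite cmod1.
have u2 : cmod (- 'i : Rc) <= 1 by rewrite cmodN /cmod /= expr0n expr1n add0r sqrtr1.
have /cvg_ex[a h1] := @rmean_cvg _ f l _ u1 af; have /cvg_ex[b h2] := @rmean_cvg _ f l _ u2 af.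
have c : fourier_mean f l T @[T --> +oo] --> (a +i* b : R[i]^o).
  under eq_fun do rewrite fourier_meanE; exact: cvg_complex h1 h2.
have FE : fourier_coef f l = a +i* b by exact: (cvg_lim (@norm_hausdorff _ _) c).
have key u : cmod u <= 1 -> forall L : R, rmean (fun x => complex.Re (u * (f x * cis (- (l * x))))) T @[T --> +oo] --> L ->
  `|L - complex.Re (u * coef s l)| <= 6 * eta.
  move=> hu L /cvgrPdist_lt /(_ _ e0) hL.
  have [mf _] := af; have hn := near_mean l e0 hu mf cs.
  have [T [/ltW h3 h4]] : exists T, `|L - rmean (fun x => complex.Re (u * (f x * cis (- (l * x))))) T| < eta /\
    `|rmean (fun x => complex.Re (u * (f x * cis (- (l * x))))) T - complex.Re (u * coef s l)| <= 5 * eta.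
    by have [T [h3 h4]] := filter_ex (filterI hL hn); exists T.
  move: h3 h4; move: (rmean _ _) (complex.Re _) => m c1 h3 h4.
  have := ler_normD (L - m) (m - c1); rewrite addrA subrK; lra.
have k1 := key _ u1 _ h1; have k2 := key _ u2 _ h2.
have FR := congr1 (@complex.Re R) FE; have FI := congr1 (@complex.Im R) FE.
apply: le_trans (cmod_le_parts _) _; rewrite cReD cReN cImD cImN FR FI /=.
move: k1 k2; rewrite mul1r Im_Re; lra.
Qed.

End FourierMeans.

(** * Bochner-Fejer polynomials *)

Section Averages.
Variable R : realType.
Local Notation Rc := (R[i]).
Implicit Types (x y t h : R) (s P B : seq (R * Rc)) (z : Rc).

Lemma cos_eq1 x : `|x| <= 1 -> cos x = 1 -> x = 0.
Proof.
move=> x1 c1; apply/eqP; apply: contraT => xn0.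
have x0 : 0 < `|x| by rewrite normr_gt0.
have c2 : cos `|x| = 1 by case: (ger0P x) => _; rewrite ?cosN.
have pi1 : `|x| <= pi by have := pi_ge2 R; lra.
have := @cos_inj R `|x| 0; rewrite !in_itv /= lexx normr_ge0 pi_ge0 pi1 c2 cos0.
by move=> /(_ isT isT erefl) xe; rewrite xe ltxx in x0.
Qed.

Lemma cmod_eq0 z : cmod z = 0 -> z = 0.
Proof. exact: ComplexField.Normc.eq0_normc. Qed.

Lemma cmod_nat n : cmod (n%:R : Rc) = n%:R.
Proof. by rewrite -(rmorph_nat (real_complex R)) cmodC normr_nat. Qed.

Lemma geom_bound z n : cmod z = 1 -> z != 1 -> cmod (\sum_(m < n) z ^+ m) <= 2 / cmod (1 - z).
Proof.
move=> z1 zn1; have n0 : 0 < cmod (1 - z).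
  rewrite lt_neqAle cmod_ge0 andbT eq_sym; apply: contra zn1 => /eqP/cmod_eq0/eqP.
  by rewrite subr_eq0 eq_sym.
rewrite ler_pdivlMr// -cmodM mulrC -opprB mulNr -subrX1 cmodN.
by apply: le_trans (cmodB _ _) _; rewrite cmodX z1 expr1n cmod1.
Qed.

Lemma cisX x m : cis (x * m%:R) = cis x ^+ m.
Proof. by elim: m => [|m ih]; [rewrite mulr0 cis0|rewrite -natr1 mulrDr mulr1 cisD ih exprSr]. Qed.

Lemma cis_neq1 x : `|x| <= 1 -> x != 0 -> cis x != 1.
Proof.
move=> x1; apply: contra => /eqP /(congr1 (@complex.Re R)) /= c1.
by apply/eqP/cos_eq1.
Qed.

(* The frequency [0] contributes nothing, since [2 / 0 = 0]. *)
Definition avg_err h s : R := \sum_(p <- s) cmod p.2 * (2 / cmod (1 - cis (p.1 * h))).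

Lemma avg_err_ge0 h s : 0 <= avg_err h s.
Proof. by apply: sumr_ge0 => p _; rewrite mulr_ge0 ?cmod_ge0 ?divr_ge0 ?cmod_ge0. Qed.

Lemma avg_bound h s n : 0 < h -> all (fun p => `|p.1 * h| <= 1) s ->
  cmod (\sum_(m < n) tsum s (h * m%:R) - n%:R * coef s 0) <= avg_err h s.
Proof.
move=> h0; elim: s => [_|[nu c] s ih /= /andP[h1 hs]].
  rewrite /coef /avg_err !big_nil mulr0 subr0 big1 ?cmod0// => m _; exact: tsum_nil.
have -> : \sum_(m < n) tsum ((nu, c) :: s) (h * m%:R) =
   c * (\sum_(m < n) cis (nu * h) ^+ m) + \sum_(m < n) tsum s (h * m%:R).
  rewrite mulr_sumr -big_split /=; apply: eq_bigr => m _.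
  by rewrite tsum_cons /= mulrA cisX.
rewrite /avg_err big_cons /= -/(avg_err h s) /coef big_cons /= -/(coef s 0).
have [nu0|nu0] := eqVneq nu 0.
  have -> : \sum_(m < n) cis (nu * h) ^+ m = n%:R.
    rewrite nu0 mul0r cis0; under eq_bigr do rewrite expr1n.
    by rewrite sumr_const card_ord.
  have -> (u : Rc) : c * n%:R + u - n%:R * (c + coef s 0) = u - n%:R * coef s 0 by ring.
  by apply: le_trans (ih hs) _; rewrite lerDr mulr_ge0 ?cmod_ge0 ?divr_ge0 ?cmod_ge0.
rewrite -addrA; apply: le_trans (cmodD _ _) _; apply: lerD; last exact: ih.
rewrite cmodM; apply: ler_wpM2l; first exact: cmod_ge0.
apply: geom_bound; first exact: cmod_cis.
by apply: cis_neq1 => //; rewrite mulf_neq0// lt0r_neq0.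
Qed.

Lemma small_step s : exists2 h, 0 < h & all (fun p => `|p.1 * h| <= 1) s.
Proof.
have [M M0 sM] : exists2 M : R, 0 <= M & all (fun p => `|p.1| <= M) s.
  elim: s => [|p s [M M0 sM]]; first by exists 0.
  exists (`|p.1| + M); first by rewrite addr_ge0.
  by rewrite /= lerDl M0; apply: sub_all sM => q /le_trans; apply; rewrite lerDr.
exists (1 + M)^-1; first by rewrite invr_gt0; lra.
apply: sub_all sM => p pM; rewrite normrM normfV (gtr0_norm (_ : 0 < 1 + M)); last lra.
by rewrite ler_pdivrMr ?mul1r; lra.
Qed.

(** Cauchy-Schwarz iterated [k] times. The weights are not normalised, since the samples of the
    kernel sum only approximately to its mean. *)
Lemma power_mean k (I : Type) (r : seq I) (w a : I -> R) : (forall i, 0 <= w i) -> (forall i, 0 <= a i) ->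
  (\sum_(i <- r) w i * a i) ^+ (2 ^ k) <=
  (\sum_(i <- r) w i) ^+ (2 ^ k).-1 * \sum_(i <- r) w i * a i ^+ (2 ^ k).
Proof.
move=> w0; elim: k a => [|k ih] a a0; first by rewrite expr0 mul1r; under [leRHS]eq_bigr do rewrite expr1.
have W0 : 0 <= \sum_(i <- r) w i by exact: sumr_ge0.
have s2 : (\sum_(i <- r) w i * a i) ^+ 2 <= (\sum_(i <- r) w i) * \sum_(i <- r) w i * a i ^+ 2.
  have cs := @cauchy_schwarz _ _ r (fun i => Num.sqrt (w i)) (fun i => Num.sqrt (w i) * a i).
  have e1 : \sum_(i <- r) Num.sqrt (w i) * (Num.sqrt (w i) * a i) = \sum_(i <- r) w i * a i.
    by apply: eq_bigr => i _; rewrite mulrA -expr2 sqr_sqrtr.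
  have e2 : \sum_(i <- r) Num.sqrt (w i) ^+ 2 = \sum_(i <- r) w i.
    by apply: eq_bigr => i _; rewrite sqr_sqrtr.
  have e3 : \sum_(i <- r) (Num.sqrt (w i) * a i) ^+ 2 = \sum_(i <- r) w i * a i ^+ 2.
    by apply: eq_bigr => i _; rewrite exprMn sqr_sqrtr.
  by move: cs; rewrite e1 e2 e3; apply=> i; rewrite ?mulr_ge0 ?sqrtr_ge0.
have A0 : 0 <= \sum_(i <- r) w i * a i by apply: sumr_ge0 => i _; rewrite mulr_ge0.
have A20 : 0 <= \sum_(i <- r) w i * a i ^+ 2 by apply: sumr_ge0 => i _; rewrite mulr_ge0 ?sqr_ge0.
have -> : (2 ^ k.+1).-1 = (2 ^ k + (2 ^ k).-1)%N.
  by rewrite expnS; case: (2 ^ k)%N (expn_gt0 2 k) => // m _; rewrite mul2n -addnn !addSn /= addnS.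
rewrite expnS exprM; apply: (@le_trans _ _ (((\sum_(i <- r) w i) * \sum_(i <- r) w i * a i ^+ 2) ^+ (2 ^ k))).
  by apply: lerXn2r => //; rewrite nnegrE; [exact: sqr_ge0|exact: mulr_ge0].
rewrite exprMn exprD -mulrA; apply: ler_wpM2l; first exact: exprn_ge0.
apply: le_trans (ih (fun i => a i ^+ 2) (fun i => sqr_ge0 _)) _.
by rewrite le_eqVlt; apply/orP; left; apply/eqP; congr (_ * _); apply: eq_bigr => i _; rewrite -exprM -?expnS.
Qed.

Lemma unif_le_mono (f g : R -> R) K : continuous f -> continuous g -> (forall x, f x <= g x) ->
  unif_le g K -> unif_le f K.
Proof.
move=> cf cg fg gK y; apply: le_trans (gK y).
by apply: (deriv_diff_le (prim_deriv cf) (prim_deriv cg)) => //; rewrite lerDl.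
Qed.

Lemma unif_le_wsum (I : Type) (r : seq I) (w : I -> R) (g : I -> R -> R) (b a K : R) :
  (forall i, 0 <= w i) -> 0 <= a -> (forall i, continuous (g i)) -> (forall i, unif_le (g i) K) ->
  unif_le (fun x => a * (\sum_(i <- r) w i * g i x) + b) (a * ((\sum_(i <- r) w i) * K) + b).
Proof.
move=> w0 a0 cg gK y.
have ds := deriv_sum r predT (fun i => deriv_scale (w i) (prim_deriv (cg i))).
have dl : deriv_of (fun x => b * x) (fun=> b).
  by apply: deriv_ext (deriv_scale b (@deriv_id R)) => z; rewrite ?mulr1.
have dt := deriv_add (deriv_scale a ds) dl.
have ct : continuous (fun x => a * (\sum_(i <- r) w i * g i x) + b).
  move=> x; apply: cvgD; last exact: cvg_cst.
  apply: cvgM; first exact: cvg_cst.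
  apply: cvg_big; last by move=> i _; apply: cvgM; [exact: cvg_cst|exact: cg].
  exact: add_continuous.
rewrite (deriv_eq (y + 1) y (prim_deriv ct) dt).
have -> : a * (\sum_(i <- r) w i * prim (g i) (y + 1)) + b * (y + 1) -
  (a * (\sum_(i <- r) w i * prim (g i) y) + b * y) =
  a * (\sum_(i <- r) w i * (prim (g i) (y + 1) - prim (g i) y)) + b.
  have -> : \sum_(i <- r) w i * (prim (g i) (y + 1) - prim (g i) y) =
     (\sum_(i <- r) w i * prim (g i) (y + 1)) - \sum_(i <- r) w i * prim (g i) y.
    by rewrite -sumrB; apply: eq_bigr => i _; rewrite mulrBr.
  by ring.
rewrite lerD2r ler_wpM2l// mulr_suml; apply: ler_sum => i _; apply: ler_wpM2l; [exact: w0|exact: gK].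
Qed.

Lemma bcont_cmod_tsum s : bcont (fun x => cmod (tsum s x)).
Proof.
have [cc [M hM]] := bcont_cmod2_tsum s.
have e x : cmod (tsum s x) = Num.sqrt (cmod (tsum s x) ^+ 2) by rewrite sqrtr_sqr ger0_norm ?cmod_ge0.
split.
  have -> : (fun x => cmod (tsum s x)) = (fun x => Num.sqrt (cmod (tsum s x) ^+ 2)) by apply/funext.
  move=> x; apply: (@continuous_comp _ _ _ (fun x => cmod (tsum s x) ^+ 2)); first exact: cc.
  exact: sqrt_continuous.
exists (1 + M) => x; rewrite ger0_norm ?cmod_ge0//.
have := le_trans (ler_norm _) (hM x); have := sqr_ge0 (cmod (tsum s x) - 1).
by have := cmod_ge0 (tsum s x); rewrite !expr2; lra.
Qed.

Let shifted P B x := tmul [seq (- p.1, p.2 * cis (p.1 * x)) | p <- P] B.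

Let tsum_shifted P B x t : tsum (shifted P B x) t = tsum P (x - t) * tsum B t.
Proof.
rewrite /shifted tsum_mul; congr (_ * _); rewrite /tsum big_map; apply: eq_bigr => p _ /=.
by rewrite -mulrA -cisD mulrBr mulNr.
Qed.

Let coef_shifted P B x : coef (shifted P B x) 0 = tsum (tmult (coef P) B) x.
Proof.
rewrite /coef /shifted /tmul big_mkcond big_allpairs_dep /= big_map tsum_mult.
rewrite exchange_big /=; apply: eq_bigr => q _; rewrite !mulr_suml [RHS]big_mkcond /=.
apply: eq_bigr => p _; rewrite addrC subr_eq0 eq_sym.
by case: eqVneq => [->|_] //; ring.
Qed.

(** Only the phases of the coefficients depend on [x], so one number of nodes gives an accuracy
    uniform in [x]. *)
Let err_shifted h P B x : avg_err h (shifted P B x) = avg_err h (shifted P B 0).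
Proof.
rewrite /avg_err /shifted /tmul !big_allpairs_dep /= !big_map; apply: eq_bigr => p _.
by apply: eq_bigr => q _ /=; rewrite !cmodM !cmod_cis.
Qed.

(* The left-hand side is the mean over [t] of [P (x - t) * B t]; the mean is taken along an arithmetic
   progression [t = m * h] with [h] so small that no nonzero frequency involved is aliased to [0]. *)
Lemma bochner_unif k P B (b : R -> R) (b0 K : R) : 0 < b0 -> coef B 0 = b0%:C ->
  (forall t, 0 <= b t) -> (forall t, tsum B t = (b t)%:C) ->
  unif_le (fun x => cmod (tsum P x) ^+ (2 ^ k)) K ->
  unif_le (fun x => cmod (tsum (tmult (coef P) B) x) ^+ (2 ^ k)) ((4 * b0) ^+ (2 ^ k) * K).
Proof.
move=> b00 cB bp bE PK; set N := (2 ^ k)%N.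
have cp s : continuous (fun x => cmod (tsum s x) ^+ N) by have [] := bcontX N (bcont_cmod_tsum s).
have K0 : 0 <= K.
  apply: le_trans (PK 0); rewrite add0r subr_ge0.
  by apply: (deriv_ge0_homo (prim_deriv (cp P))) => // z _; rewrite exprn_ge0 ?cmod_ge0.
suff eps e : 0 < e -> unif_le (fun x => cmod (tsum (tmult (coef P) B) x) ^+ N) (2 ^+ N * (2 * b0) ^+ N * K + e).
  move=> y; apply/ler_addgt0Pr => e /eps /(_ y); rewrite -exprMn mulrA.
  by rewrite -natrM.
move=> e0; pose e1 := e / 2 ^+ N.
have e10 : 0 < e1 by rewrite divr_gt0// exprn_gt0.
have [h h0 hall] := small_step (shifted P B 0 ++ B).
move: hall; rewrite all_cat => /andP[hS hB].
have hSx x : all (fun p => `|p.1 * h| <= 1) (shifted P B x).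
  have ea s : all (fun p => `|p.1 * h| <= 1) s = all (fun v => `|v * h| <= 1) (map fst s) by rewrite all_map.
  move: hS; rewrite !ea; congr (is_true (all _ _)); rewrite /shifted /tmul !map_allpairs /= !allpairs_mapl.
  by [].
pose A := avg_err h (shifted P B 0); pose A' := avg_err h B.
have A0 : 0 <= A := avg_err_ge0 _ _; have A'0 : 0 <= A' := avg_err_ge0 _ _.
(* Three demands on the number of nodes: [n1] keeps the total weight below [2 * b0], while [n2] and
   [n3] make the averaging error [A / n] at most 1 and at most [e1], so that its [N]-th power is at
   most [e1] too. *)
pose n := (Num.bound (A' / b0 + A + A / e1)).+1.
have n0 : 0 < n%:R :> R by rewrite ltr0n.
have q1 : 0 <= A' / b0 by rewrite divr_ge0// ltW.
have q2 : 0 <= A / e1 by rewrite divr_ge0// ltW.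
have nle u : u <= A' / b0 + A + A / e1 -> u <= n%:R.
  move=> ul; have q : 0 <= A' / b0 + A + A / e1 by rewrite !addr_ge0.
  by have := archi_boundP q; rewrite /n -natr1; lra.
have n1 : A' <= n%:R * b0 by rewrite -ler_pdivrMr//; apply: nle; lra.
have n2 : A <= n%:R by apply: nle; lra.
have n3 : A <= n%:R * e1 by rewrite -ler_pdivrMr//; apply: nle; lra.
pose w (m : 'I_n) := b (h * m%:R) / n%:R.
have w0 m : 0 <= w m by rewrite divr_ge0// ltW.
pose a (m : 'I_n) x := cmod (tsum P (x - h * m%:R)).
have aw x : cmod (tsum (tmult (coef P) B) x) <= (\sum_m w m * a m x) + A / n%:R.
  have := avg_bound n h0 (hSx x); rewrite coef_shifted err_shifted -/A.
  set S := \sum_(m < n) _; set q := tsum (tmult _ _) _ => hq.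
  have Sle : cmod S <= n%:R * \sum_m w m * a m x.
    apply: le_trans (cmod_sum _ _ _) _; rewrite mulr_sumr; apply: ler_sum => m _.
    rewrite tsum_shifted bE cmodM cmodC ger0_norm// /w /a mulrC.
    by rewrite le_eqVlt; apply/orP; left; apply/eqP; field; rewrite lt0r_neq0.
  have : n%:R * cmod q <= cmod S + A.
    rewrite -{1}(cmod_nat n) -cmodM; have -> : n%:R * q = S - (S - n%:R * q) by ring.
    by apply: le_trans (cmodB _ _) _; rewrite lerD2l.
  move=> h1; have h2 : n%:R * cmod q <= n%:R * (\sum_m w m * a m x + A / n%:R).
    rewrite mulrDr mulrCA mulfV ?lt0r_neq0// mulr1.
    by apply: le_trans h1 _; rewrite lerD2r.
  by rewrite -(ler_pM2l n0).
have W2 : \sum_m w m <= 2 * b0.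
  have := avg_bound n h0 hB; rewrite cB -/A' => hq.
  have : complex.Re (\sum_(m < n) tsum B (h * m%:R) - n%:R * b0%:C) <= A'.
    by apply: le_trans (ler_norm _) _; apply: le_trans (Re_le_cmod _) hq.
  have -> : \sum_(m < n) tsum B (h * m%:R) = (n%:R * \sum_m w m)%:C.
    rewrite mulr_sumr rmorph_sum; apply: eq_bigr => m _.
    by rewrite bE /w; congr (_%:C); field; rewrite lt0r_neq0.
  rewrite -(rmorph_nat (real_complex R)) -rmorphM -rmorphB /= => h1.
  by rewrite -(ler_pM2l n0); lra.
have W0 : 0 <= \sum_m w m by exact: sumr_ge0.
have a0 m x : 0 <= a m x by exact: cmod_ge0.
have N1 : (N.-1.+1 = N)%N by rewrite prednK ?expn_gt0.
have ca m : continuous (fun x => a m x ^+ N).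
  move=> x; apply: (@continuous_comp _ _ _ (fun x => x - h * m%:R) (fun x => cmod (tsum P x) ^+ N)); last exact: cp.
  by apply: cvgB; [exact: cvg_id|exact: cvg_cst].
have Ka m : unif_le (fun x => a m x ^+ N) K by exact: (unif_le_shift (- (h * m%:R)) (cp P) PK).
pose c0 := 2 ^+ N * (\sum_m w m) ^+ N.-1.
have c00 : 0 <= c0 by rewrite mulr_ge0 ?exprn_ge0.
have hu := @unif_le_wsum _ (index_enum 'I_n) w _ e c0 K w0 c00 ca Ka.
have cs : continuous (fun x => c0 * (\sum_(m <- index_enum 'I_n) w m * a m x ^+ N) + e).
  move=> x; apply: cvgD; last exact: cvg_cst.
  apply: cvgM; first exact: cvg_cst.
  apply: cvg_big; last by move=> i _; apply: cvgM; [exact: cvg_cst|exact: ca].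
  exact: add_continuous.
have step : unif_le (fun x => cmod (tsum (tmult (coef P) B) x) ^+ N) (c0 * ((\sum_m w m) * K) + e).
  apply: unif_le_mono hu => // x.
  have s0 : 0 <= \sum_m w m * a m x by apply: sumr_ge0 => m _; rewrite mulr_ge0.
  have An : 0 <= A / n%:R by rewrite divr_ge0// ltW.
  apply: (@le_trans _ _ ((\sum_m w m * a m x + A / n%:R) ^+ N)).
    by rewrite lerXn2r ?nnegrE ?cmod_ge0// addr_ge0.
  apply: le_trans (exprD_le N s0 An) _; rewrite mulrDr; apply: lerD.
    rewrite /c0 -mulrA; apply: ler_wpM2l; first exact: exprn_ge0.
    by have := @power_mean k _ (index_enum 'I_n) w (fun m => a m x) w0 (fun m => a0 m x).
  have -> : e = 2 ^+ N * e1 by rewrite /e1 mulrCA mulfV ?mulr1// expf_neq0.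
  apply: ler_wpM2l; first exact: exprn_ge0.
  apply: (@le_trans _ _ (A / n%:R)); last by rewrite ler_pdivrMr// mulrC.
  rewrite -N1 exprS ler_piMr// exprn_ile1// ler_pdivrMr ?mul1r//.
move=> y; apply: le_trans (step y) _; rewrite lerD2r /c0 mulrA; apply: ler_wpM2r => //.
rewrite -mulrA -exprSr N1; apply: ler_wpM2l; first exact: exprn_ge0.
by rewrite lerXn2r ?nnegrE// mulr_ge0// ltW.
Qed.

End Averages.

(** * Fejer kernels with nonnegative coefficients *)

Section FejerKernel.
Variable R : realType.
Local Notation Rc := (R[i]).
Local Notation mu := (@lebesgue_measure R).
Implicit Types (x y l : R) (s t : seq (R * Rc)) (z : Rc) (F : seq R).

Lemma coef_Re_ge0 s : (forall x, 0 <= complex.Re (tsum s x)) -> 0 <= complex.Re (coef s 0).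
Proof.
move=> h; have [A hA] := tsum_rmean s; rewrite leNgt; apply/negP => lt0.
set r := complex.Re (coef s 0) in hA lt0.
pose T := 1 + `|A| / - r.
have r0 : 0 < - r by rewrite oppr_gt0.
have T1 : 1 <= T by rewrite lerDl divr_ge0// ltW.
have T0 : 0 < T by exact: lt_le_trans ltr01 T1.
have := hA T T1; have m0 : 0 <= rmean (fun x => complex.Re (tsum s x)) T.
  rewrite /rmean mulr_ge0//; first by rewrite invr_ge0 mulr_ge0// ltW.
  by apply: Rintegral_ge0 => x _; exact: h.
rewrite ger0_norm; last lra.
move=> hh; have : - r <= A / T by lra.
rewrite ler_pdivlMr// /T mulrDr mulr1 mulrCA mulfV ?lt0r_neq0// mulr1.
by have := ler_norm A; lra.
Qed.

Lemma coef_cons p s l : coef (p :: s) l = (if p.1 == l then p.2 else 0) + coef s l.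
Proof. by rewrite /coef big_cons; case: ifP => // _; rewrite add0r. Qed.

Lemma coef_nil l : coef (Nil (R * Rc)) l = 0.
Proof. exact: big_nil. Qed.

Lemma coef_cat s t l : coef (s ++ t) l = coef s l + coef t l.
Proof. exact: big_cat. Qed.

(** Coefficients are mean values, hence determined by the function even though a list may repeat
    frequencies. The positivity of means is applied to the zero function rotated by [1], [-1], ['i]
    and [- 'i]. *)
Lemma coef_ext s t l : tsum s =1 tsum t -> coef s l = coef t l.
Proof.
move=> st.
pose v (u : Rc) := tmult (fun=> u) (tshift (- l) (s ++ tmult (fun=> -1) t)).
have v0 u x : tsum (v u) x = 0.
  by rewrite /v tsum_scale tsum_shift tsum_cat tsum_scale st mulN1r subrr !mulr0.
have cv u : coef (v u) 0 = u * (coef s l - coef t l).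
  rewrite /v coef_scale_shift coef_cat; congr (_ * (_ + _)).
  by rewrite /coef big_map -sumrN; apply: eq_bigr => p _ /=; rewrite mulN1r.
have re0 u : 0 <= complex.Re (u * (coef s l - coef t l)).
  by rewrite -cv; apply: coef_Re_ge0 => x; rewrite v0.
apply/eqP; rewrite -subr_eq0; move: re0; case: (coef s l - coef t l) => a b re0.
have := re0 1; have := re0 (-1); have := re0 'i; have := re0 (- 'i).
rewrite /= ?(mul0r, mul1r, mulN1r, subr0, sub0r, oppr0, opprK, addr0, add0r) => h1 h2 h3 h4.
by rewrite eq_complex /=; apply/andP; split; apply/eqP; lra.
Qed.

Lemma coef_tmul s t l : coef (tmul s t) l = \sum_(p <- s) p.2 * coef t (l - p.1).
Proof.
rewrite /coef /tmul big_mkcond big_allpairs_dep /=; apply: eq_bigr => p _.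
rewrite mulr_sumr [RHS]big_mkcond /=; apply: eq_bigr => q _.
by rewrite addrC eq_sym -subr_eq eq_sym.
Qed.

Definition nneg s := all (fun p => 0 <= p.2) s.

Lemma coef_nneg s l : nneg s -> 0 <= coef s l.
Proof.
elim: s => [_|p s ih /= /andP[p0 /ih s0]]; first by rewrite coef_nil.
by rewrite coef_cons; case: ifP => _; rewrite ?add0r// addr_ge0.
Qed.

Lemma nneg_tmul s t : nneg s -> nneg t -> nneg (tmul s t).
Proof.
move=> hs ht; elim: s hs => //= p s ih /andP[p0 /ih hs].
rewrite /nneg all_cat; apply/andP; split; last exact: hs.
rewrite all_map.
by apply: sub_all ht => q /= q0; rewrite mulr_ge0.
Qed.

Lemma nneg_tconj s : nneg s -> nneg (tconj s).
Proof.
rewrite /nneg /tconj all_map; apply: sub_all => -[a [u v]] /=.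
by rewrite !lecE /= oppr_eq0.
Qed.

Definition energy s := tmul s (tconj s).

Lemma tsum_energy s x : tsum (energy s) x = (cmod (tsum s x) ^+ 2)%:C.
Proof. by rewrite /energy tsum_mul tsum_conj mulrC conj_mul. Qed.

Lemma nneg_energy s : nneg s -> nneg (energy s).
Proof. by move=> h; apply: nneg_tmul => //; exact: nneg_tconj. Qed.

Definition dirichlet m l : seq (R * Rc) := [seq (l * k%:R, 1) | k <- iota 0 m].

Lemma nneg_dirichlet m l : nneg (dirichlet m l).
Proof. by rewrite /nneg all_map; apply/allP => k _ /=; exact: ler01. Qed.

Lemma tsum_dirichlet m l x : tsum (dirichlet m l) x = \sum_(k < m) cis (l * x) ^+ k.
Proof.
rewrite /tsum big_map big_iota0; apply: eq_bigr => k _ /=.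
by rewrite mul1r mulrAC cisX.
Qed.

Lemma energy_dirichlet_ge m l s : nneg s ->
  m%:R * coef (energy s) 0 <= coef (energy (tmul (dirichlet m l) s)) 0.
Proof.
move=> s0; have es := nneg_energy s0.
have -> : coef (energy (tmul (dirichlet m l) s)) 0 = coef (tmul (energy (dirichlet m l)) (energy s)) 0.
  apply: coef_ext => x; rewrite tsum_energy (tsum_mul (energy _)) !tsum_energy tsum_mul cmodM exprMn.
  by rewrite rmorphM.
have ce : tconj (dirichlet m l) = dirichlet m (- l).
  rewrite /tconj /dirichlet -map_comp; apply: eq_map => k /=.
  by rewrite mulNr oppr0.
rewrite coef_tmul [energy (dirichlet m l)]/energy ce /tmul big_allpairs_dep /= big_map big_iota0.
rewrite mulr_natl -[X in _ *+ X](card_ord m) -sumr_const; apply: ler_sum => k _ /=.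
rewrite big_map big_iota0 (bigD1 k)//= !mul1r sub0r mulNr subrr oppr0.
by rewrite lerDl; apply: sumr_ge0 => j _; rewrite mul1r; apply: coef_nneg.
Qed.

Definition laplace l : seq (R * Rc) := [:: (0, 2); (l, -1); (- l, -1)].

Lemma tsum_laplace l x : tsum (laplace l) x = (1 - cis (l * x)) * (1 - Num.conj (cis (l * x))).
Proof.
have c1 : Num.conj (cis (l * x)) * cis (l * x) = 1 by rewrite conj_mul cmod_cis expr1n.
have cN : cis (- l * x) = Num.conj (cis (l * x)) by rewrite mulNr; exact: cisN.
rewrite /laplace !tsum_cons tsum_nil /= mul0r cis0 cN addr0 mulr1 !mulN1r.
rewrite mulrBr mulr1 mulrBl mul1r [cis (l * x) * _]mulrC c1.
by ring.
Qed.

Lemma coef_laplace l s : coef (tmul (laplace l) s) 0 = 2 * coef s 0 - coef s (- l) - coef s l.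
Proof.
by rewrite coef_tmul /laplace !big_cons big_nil /= !sub0r oppr0 opprK addr0 !mulN1r addrA.
Qed.

(** It is the mean of [1 - cos] against a squared modulus. This allows the deviations at [l] and
    [- l] to be bounded one by one from a bound on their sum. *)
Lemma coef_sub_ge0 s l : 0 <= complex.Re (coef (energy s) 0 - coef (energy s) l).
Proof.
have -> : coef (energy s) 0 - coef (energy s) l = coef (tmul [:: (0, 1); (- l, -1)] (energy s)) 0.
  by rewrite coef_tmul !big_cons big_nil /= !sub0r oppr0 opprK addr0 mulN1r mul1r.
apply: coef_Re_ge0 => x.
have e : tsum [:: (0, 1); (- l, -1)] x = 1 - cis (- l * x).
  by rewrite !tsum_cons tsum_nil /= mul0r cis0 addr0 mulr1 mulN1r.
rewrite tsum_mul e tsum_energy.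
rewrite cReM /= mulr0 subr0 mulr_ge0 ?sqr_ge0// subr_ge0; exact: cos_le1.
Qed.

Lemma energy_dirichlet_le m l s : nneg s ->
  2 * coef (energy (tmul (dirichlet m l) s)) 0 - coef (energy (tmul (dirichlet m l) s)) (- l) -
  coef (energy (tmul (dirichlet m l) s)) l <= 2 * coef (energy s) 0.
Proof.
move=> s0; have es := nneg_energy s0.
rewrite -coef_laplace.
have -> : coef (tmul (laplace l) (energy (tmul (dirichlet m l) s))) 0 = coef (tmul (laplace (l * m%:R)) (energy s)) 0.
  apply: coef_ext => x; rewrite !(tsum_mul (laplace _)) !tsum_energy -!conj_mul tsum_mul rmorphM.
  have e0 : cis (l * m%:R * x) = cis (l * x) ^+ m by rewrite mulrAC cisX.
  rewrite !tsum_laplace tsum_dirichlet e0.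
  have e1 (w : Rc) : (1 - w) * (\sum_(k < m) w ^+ k) = 1 - w ^+ m.
    by rewrite -opprB mulNr -subrX1 opprB.
  have e2 (w : Rc) : (1 - Num.conj w) * Num.conj (\sum_(k < m) w ^+ k) = 1 - Num.conj (w ^+ m).
    by rewrite -[X in X - _](rmorph1 Num.conj) -rmorphB -rmorphM e1 rmorphB rmorph1.
  rewrite -e1 -e2; ring.
rewrite coef_laplace -addrA gerDl -opprD oppr_le0 addr_ge0//; exact: coef_nneg.
Qed.

(* For [Q = D * Q'] with [D] the Dirichlet sum of [l], multiplying by [1 - e_l] turns [D] into [1 - e_(ml)]:
   the mean of [|1 - e_l|^2 |Q|^2] is at most [4] times that of [|Q'|^2], whereas the mean of [|Q|^2] is
   at least [m] times the latter since all coefficients are nonnegative. *)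
Lemma fejer_kernel F m : (0 < m)%N -> exists s (b0 : R),
  [/\ 0 < b0, coef (energy s) 0 = b0%:C &
      forall l, l \in F -> cmod (coef (energy s) l - b0%:C) <= 2 / m%:R * b0].
Proof.
move=> m0.
pose Q G := foldr (fun l s => tmul (dirichlet m l) s) [:: (0, 1)] G.
have Q0 G : nneg (Q G).
  elim: G => [|l G ih] /=; first by rewrite /nneg /= ler01.
  by apply: nneg_tmul => //; exact: nneg_dirichlet.
have QE G x : tsum (Q G) x = \prod_(l <- G) tsum (dirichlet m l) x.
  elim: G => [|l G ih] /=; first by rewrite tsum_cons tsum_nil big_nil /= mul0r cis0 addr0 mulr1.
  by rewrite tsum_mul ih big_cons.
have Q1 G : 0 < coef (energy (Q G)) 0.
  elim: G => [|l G ih] /=.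
    rewrite /energy coef_tmul big_cons big_nil /= mul1r addr0 subr0 coef_cons coef_nil addr0 /= oppr0 eqxx.
    by rewrite ltcE /= eqxx ltr01.
  by apply: lt_le_trans (energy_dirichlet_ge m l (Q0 G)); rewrite mulr_gt0// ltr0n.
have real z : 0 <= z -> z = (complex.Re z)%:C by case: z => u v; rewrite lecE /= => /andP[/eqP-> _].
pose S := energy (Q F).
exists (Q F), (complex.Re (coef S 0)).
have S0 := real _ (ltW (Q1 F)); rewrite -/S in S0.
split=> //; first by have := Q1 F; rewrite -/S S0 ltcE /= eqxx.
move=> l lF; rewrite -S0.
(* The product of Dirichlet sums is symmetric as a function, so by [coef_ext] the factor of any [l]
   in [F] may be treated as the outermost one. *)
pose G := rem l F.
have SE v : coef S v = coef (energy (tmul (dirichlet m l) (Q G))) v.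
  apply: coef_ext => x; rewrite !tsum_energy tsum_mul !QE.
  by rewrite (perm_big _ (perm_to_rem lF)) big_cons.
have Sn v : 0 <= coef S v by apply: coef_nneg; exact: nneg_energy.
have k1 := energy_dirichlet_le m l (Q0 G); rewrite -!SE in k1.
have k2 := energy_dirichlet_ge m l (Q0 G); rewrite -SE in k2.
have k3 : 0 <= complex.Re (coef S 0 - coef S l) := coef_sub_ge0 _ _.
have k4 : 0 <= complex.Re (coef S 0 - coef S (- l)) := coef_sub_ge0 _ _.
have g0 := coef_nneg 0 (nneg_energy (Q0 G)).
have E1 := real _ (Sn l); have E2 := real _ (Sn (- l)); have E3 := real _ g0.
move: k1 k2 k3 k4; rewrite S0 E1 E2 E3 -(rmorph_nat (real_complex R) m) -(rmorph_nat (real_complex R) 2).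
move: (complex.Re _) (complex.Re _) (complex.Re _) (complex.Re _) => a b c d.
rewrite -!rmorphM -!rmorphB !lecR cmodC.
have m1 : 0 < m%:R :> R by rewrite ltr0n.
rewrite mulrAC ler_pdivlMr// => k1 k2 k3 k4.
have h : `|b - d| <= 2 * a.
  by move: k1 k3 k4; rewrite /= ler_norml => k1 k3 k4; apply/andP; split; lra.
have h2 := ler_wpM2r (ltW m1) h; move: k2 h2 => /= k2; lra.
Qed.

End FejerKernel.

(** * Uniform bounds for the Bochner-Fejer polynomials of a Stepanov function *)

Section BochnerFejer.
Variable R : realType.
Local Notation Rc := (R[i]).
Local Notation mu := (@lebesgue_measure R).
Implicit Types (x y l : R) (s t B : seq (R * Rc)) (z : Rc) (F : seq R) (f : R -> Rc).

Lemma small_scale (C e : R) N : 0 <= C -> 0 < e -> (0 < N)%N -> exists2 eta : R, 0 < eta & C * eta ^+ N <= e.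
Proof.
move=> C0 e0 N0; pose eta := Num.min 1 (e / (1 + C)).
have C1 : 0 < 1 + C by lra.
have h0 : 0 < eta by rewrite lt_min ltr01 divr_gt0.
have h1 : eta <= 1 by rewrite ge_min lexx.
have h2 : eta * (1 + C) <= e by rewrite -ler_pdivlMr// ge_min lexx orbT.
exists eta => //; apply: (@le_trans _ _ (C * eta)); last lra.
by apply: ler_wpM2l => //; rewrite -(prednK N0) exprS ler_piMr ?exprn_ile1// ltW.
Qed.

Lemma cmod_pow_measurable f N : cmeasurable f -> measurable_fun [set: R] (fun x => cmod (f x) ^+ N).
Proof. by move=> mf; apply: measurable_funX; exact: cmod_measurable. Qed.

Lemma unif_int_pow_add f g h N (K L : R) : cmeasurable f -> cmeasurable g -> cmeasurable h ->
  (forall x, cmod (h x) <= cmod (f x) + cmod (g x)) ->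
  unif_int (fun x => cmod (f x) ^+ N) K -> unif_int (fun x => cmod (g x) ^+ N) L ->
  unif_int (fun x => cmod (h x) ^+ N) (2 ^+ N * (K + L)).
Proof.
move=> mf mg mh hfg fK gL.
have mf' := cmod_pow_measurable N mf; have mg' := cmod_pow_measurable N mg.
have c0 (u : R -> Rc) x : 0 <= cmod (u x) ^+ N by rewrite exprn_ge0 ?cmod_ge0.
apply: (@unif_int_mono _ _ (fun x => 2 ^+ N * (cmod (f x) ^+ N + cmod (g x) ^+ N))) => //.
- exact: cmod_pow_measurable.
- by apply: measurable_funM => //; apply: measurable_funD.
- move=> x; apply: (@le_trans _ _ ((cmod (f x) + cmod (g x)) ^+ N)).
    by rewrite lerXn2r ?nnegrE ?addr_ge0 ?cmod_ge0.
  by apply: exprD_le; exact: cmod_ge0.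
apply: unif_int_scale; first exact: exprn_ge0.
- exact: measurable_funD.
- by move=> x; rewrite addr_ge0.
exact: unif_int_add.
Qed.

Lemma unif_int_ge0 (g : R -> R) K : (forall x, 0 <= g x) -> unif_int g K -> 0 <= K.
Proof.
by move=> g0 gK; have := gK 0; rewrite -lee_fin; apply: le_trans; apply: integral_ge0 => s _; rewrite lee_fin.
Qed.

(** [bochner_unif] is applied to a polynomial close to [f]. Of the factor 16, 4 comes from there and
    two factors 2 from the triangle inequality for powers, used to pass from [f] to the polynomial
    and from its coefficients back to those of [f]. What remains tends to [0] with [eta], because
    [B] is fixed. *)
Lemma bochner_fourier k f B (b : R -> R) (b0 K : R) : 0 < b0 -> coef B 0 = b0%:C ->
  (forall x, 0 <= b x) -> (forall x, tsum B x = (b x)%:C) -> approximable (2 ^ k).-1 f ->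
  unif_int (fun x => cmod (f x) ^+ (2 ^ k)) K ->
  unif_int (fun x => cmod (tsum (tmult (fourier_coef f) B) x) ^+ (2 ^ k)) ((16 * b0) ^+ (2 ^ k) * K).
Proof.
move=> b00 cB bp bE af fK; set N := (2 ^ k)%N.
have N0 : (0 < N)%N by rewrite expn_gt0.
have cl eta s : close N.-1 eta f s -> unif_int (fun x => cmod (f x - tsum s x) ^+ N) (eta ^+ N).
  by rewrite /close prednK.
have [mf appr] := af.
pose S := \sum_(p <- B) cmod p.2.
have S0 : 0 <= S by apply: sumr_ge0 => p _; exact: cmod_ge0.
have cp s : continuous (fun x => cmod (tsum s x) ^+ N) by have [] := bcontX N (bcont_cmod_tsum s).
suff eps e : 0 < e -> unif_int (fun x => cmod (tsum (tmult (fourier_coef f) B) x) ^+ N) ((16 * b0) ^+ N * K + e).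
  move=> x; apply/lee_addgt0Pr => e /eps /(_ x); by rewrite EFinD.
move=> e0; pose C := 2 ^+ N * ((8 * b0) ^+ N + (12 * S) ^+ N).
have C0 : 0 <= C by rewrite mulr_ge0 ?exprn_ge0// addr_ge0 ?exprn_ge0// mulr_ge0// ltW.
have [eta eta0 etae] := small_scale C0 e0 N0.
have [s cs] := appr _ eta0.
have hs := fourier_coef_close _ af eta0 cs.
have ms := cmeasurable_tsum s.
have us := unif_int_pow_add (cmeasurableB mf ms) mf ms _ (cl _ _ cs) fK.
have {}us : unif_le (fun x => cmod (tsum s x) ^+ N) (2 ^+ N * (eta ^+ N + K)).
  apply/unif_int_continuous; first exact: cp.
  apply: us => x; have e3 : tsum s x = f x - (f x - tsum s x) by ring.
  rewrite {1}e3.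
  by apply: le_trans (cmodB _ _) _; rewrite addrC.
have up := bochner_unif b00 cB bp bE us.
rewrite -/N in up; move/unif_int_continuous : up => /(_ (cp _)) up.
pose d x := (12 * S * eta)%:C : Rc.
have md : cmeasurable d by split; exact: measurable_cst.
have de x : cmod (d x) = 12 * S * eta by rewrite cmodC ger0_norm// !mulr_ge0// ltW.
have ud : unif_int (fun x => cmod (d x) ^+ N) ((12 * S * eta) ^+ N).
  by under eq_fun do rewrite de; exact: unif_int_cst.
have mt v : cmeasurable (tsum (tmult v B)) by exact: cmeasurable_tsum.
have := unif_int_pow_add (mt _) md (mt (fourier_coef f)) _ up ud.
move=> H; apply: unif_int_le (H _); last first.
  move=> x; rewrite de.
  have -> : tsum (tmult (fourier_coef f) B) x = tsum (tmult (coef s) B) x +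
      (tsum (tmult (fourier_coef f) B) x - tsum (tmult (coef s) B) x) by ring.
  apply: le_trans (cmodD _ _) _; rewrite lerD2l !tsum_mult -sumrB.
  apply: le_trans (cmod_sum _ _ _) _; rewrite mulr_sumr mulr_suml; apply: ler_sum => p _.
  have -> : fourier_coef f p.1 * p.2 * cis (p.1 * x) - coef s p.1 * p.2 * cis (p.1 * x) =
     (fourier_coef f p.1 - coef s p.1) * (p.2 * cis (p.1 * x)) by ring.
  rewrite !cmodM cmod_cis mulr1 mulrAC; apply: ler_wpM2r; [exact: cmod_ge0|exact: hs].
have alg (a u v c v' K' e' : R) : 2 ^+ N * (8 ^+ N * v + v') * u <= e' ->
  2 ^+ N * ((4 ^+ N * v) * (2 ^+ N * (u + K')) + v' * u) <= 16 ^+ N * v * K' + e'.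
  have -> : 8 ^+ N = 4 ^+ N * 2 ^+ N :> R by rewrite -exprMn -natrM.
  have -> : 16 ^+ N = 2 ^+ N * (4 ^+ N * 2 ^+ N) :> R by rewrite -!exprMn -!natrM.
  lra.
rewrite !exprMn; apply: alg => //; move: etae; rewrite /C !exprMn; lra.
Qed.

End BochnerFejer.

(** * From separated polynomials to functions with separated exponents *)

Section Assembly.
Variable R : realType.
Local Notation Rc := (R[i]).
Implicit Types (x y : R) (l : nat -> R) (s B : seq (R * Rc)) (z : Rc) (F U : seq R) (f : R -> Rc) (J : nat).

Lemma sum_coef U s (G : R -> Rc) : uniq U -> all (fun p => p.1 \in U) s ->
  \sum_(u <- U) G u * coef s u = \sum_(p <- s) G p.1 * p.2.
Proof.
move=> uU; elim: s => [_|p s ih /= /andP[pU sU]].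
  by rewrite big_nil big1// => u _; rewrite coef_nil mulr0.
rewrite big_cons -ih// -[X in _ = X + _]addr0.
under eq_bigr do rewrite coef_cons mulrDr.
rewrite big_split /=; congr (_ + _); rewrite (bigD1_seq p.1)//= eqxx; congr (_ + _).
by rewrite big1// => u /negPf; rewrite eq_sym => ->; rewrite mulr0.
Qed.

Lemma bigmax_sqr (I : Type) (r : seq I) (v : I -> R) : (forall i, 0 <= v i) ->
  bigmax r v ^+ 2 = bigmax r (fun i => v i ^+ 2).
Proof.
move=> v0; elim: r => [|i r ih]; first by rewrite /bigmax !big_nil expr0n.
rewrite !bigmax_cons -ih; have b0 := bigmax_ge0 r v.
have [h|/ltW h] := leP (v i) (bigmax r v).
  by rewrite (max_idPr _)// lerXn2r ?nnegrE.
by rewrite (max_idPl _)// lerXn2r ?nnegrE.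
Qed.

Lemma fourier_coef_exponents f u : ~ exponents f u -> fourier_coef f u = 0.
Proof. by move=> h; apply/eqP; apply: contraT => c; exfalso; apply: h; right; left. Qed.

Section Fixed.
Variables (f : R -> Rc) (J : nat) (F : seq R).
Hypotheses (uF : uniq F) (FE : forall u, (u \in F) <-> dyadic_exponents f J u).

Lemma dyadic_sumE j x : (j <= J)%N ->
  dyadic_sum j f x = \sum_(u <- F | `|u| <= 2 ^+ j) fourier_coef f u * cis (u * x).
Proof.
move=> jJ; rewrite /dyadic_sum.
have -> : dyadic_exponents f j = [set` [seq u <- F | `|u| <= 2 ^+ j]].
  apply/seteqP; split=> u /=; rewrite mem_filter.
    move=> [eu uj]; apply/andP; split=> //; apply/FE; split=> //=.
    by apply: le_trans uj _; rewrite ler_eXn2l// ltr1n.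
  by move=> /andP[uj /FE [eu _]].
by rewrite -fsbig_seq ?filter_uniq// big_filter.
Qed.

(** Frequencies of [B] that are not exponents of [f] carry the coefficient [0] and are dropped,
    repeated ones are merged. What is left lies among the exponents and inherits their gaps. *)
Lemma sorted_spectrum B (delta : R) : (forall x y, exponents f x -> exponents f y -> x < y -> x + delta <= y) ->
  exists n l c, [/\ forall i, (i < n)%N -> l i + delta <= l i.+1,
    forall x, tsum (tpoly n.+1 l c) x = tsum (tmult (fourier_coef f) B) x &
    forall j x, (j <= J)%N -> sharp n.+1 l c j x =
      \sum_(u <- F | `|u| <= 2 ^+ j) fourier_coef f u * coef B u * cis (u * x)].
Proof.
move=> sep.
(* The exponent [0] is put in to make the list nonempty, as [n.+1] terms require, and [F] so that
   every exponent up to [2 ^+ J] occurs, be it with coefficient [0] in [B]. *)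
pose U0 := undup (0 :: F ++ [seq p.1 | p <- B]).
pose U := sort <=%R [seq u <- U0 | `[<exponents f u>]].
have uU : uniq U by rewrite sort_uniq filter_uniq// undup_uniq.
have UE u : (u \in U) = `[<exponents f u>] && (u \in U0) by rewrite mem_sort mem_filter.
have U00 : 0 \in U by rewrite UE mem_undup inE eqxx andbT; apply/asboolP; left.
have sU : sorted <%R U by rewrite sort_lt_sorted filter_uniq// undup_uniq.
have szU : (0 < size U)%N by case: (U) U00.
exists (size U).-1, (nth 0 U), (fun i => fourier_coef f (nth 0 U i) * coef B (nth 0 U i)).
rewrite prednK//.
have sumU (P : pred R) (G : R -> Rc) : \sum_(i < size U | P (nth 0 U i)) G (nth 0 U i) = \sum_(u <- U | P u) G u.
  by rewrite (big_nth 0) big_mkord.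
split.
- move=> i iU; have i1 : (i.+1 < size U)%N by rewrite -(prednK szU) ltnS.
  have i0 : (i < size U)%N := ltnW i1.
  have ex v : (v < size U)%N -> exponents f (nth 0 U v).
    by move=> vU; have := mem_nth 0 vU; rewrite UE => /andP[/asboolP].
  apply: sep; [exact: ex|exact: ex|].
  exact: (sorted_ltn_nth lt_trans 0 sU i i.+1 i0 i1 (leqnn _)).
- move=> x; rewrite tpolyE.
  rewrite (sumU predT (fun u => fourier_coef f u * coef B u * cis (u * x))).
  rewrite (perm_big _ (permEl (perm_sort _ _))) big_filter tsum_mult.
  transitivity (\sum_(u <- U0) (fourier_coef f u * cis (u * x)) * coef B u).
    rewrite big_mkcond /=; apply: eq_bigr => u _; case: asboolP => [_|/fourier_coef_exponents ->]; first by rewrite mulrAC.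
    by rewrite !mul0r.
  rewrite sum_coef ?undup_uniq//; first by apply: eq_bigr => p _; rewrite mulrAC.
  have -> : all (fun p => p.1 \in U0) B = all (mem U0) [seq p.1 | p <- B] by rewrite all_map.
  by apply/allP => u uB; rewrite /= mem_undup inE mem_cat uB !orbT.
- move=> j x jJ; rewrite /sharp.
  rewrite (sumU (fun u => `|u| <= 2 ^+ j) (fun u => fourier_coef f u * coef B u * cis (u * x))).
  rewrite -[LHS]big_filter -[RHS]big_filter; apply: perm_big; apply: uniq_perm; rewrite ?filter_uniq// => u.
  rewrite !mem_filter UE; have [uj|//] := boolP (`|u| <= _); rewrite /=.
  apply/andP/idP => [[/asboolP eu _]|uFu].
    by apply/FE; split=> //=; apply: le_trans uj _; rewrite ler_eXn2l// ltr1n.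
  split; last by rewrite mem_undup inE mem_cat uFu orbT.
  by apply/asboolP; have /FE[] := uFu.
Qed.

End Fixed.

Lemma dyadic_sum_tsum f j : finite_set (dyadic_exponents f j) -> exists s, dyadic_sum j f = tsum s.
Proof.
move=> /finite_seqP[F0 F0E]; pose F := undup F0.
have FE u : (u \in F) <-> dyadic_exponents f j u by rewrite mem_undup F0E.
exists [seq (u, fourier_coef f u) | u <- [seq u <- F | `|u| <= 2 ^+ j]].
apply/funext => x; rewrite (dyadic_sumE (undup_uniq F0) FE x (leqnn j)).
by rewrite /tsum big_map big_filter.
Qed.

Lemma bcont_dyadic_max f (r : seq nat) : (forall j, finite_set (dyadic_exponents f j)) ->
  bcont (fun x => bigmax r (fun j => cmod (dyadic_sum j f x))).
Proof.
move=> fin; apply: bcont_bigmax => j; have [t ->] := dyadic_sum_tsum (fin j); exact: bcont_cmod_tsum.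
Qed.

Lemma dyadic_max_unif k (delta : R) : 0 < delta -> delta <= 1 -> exists2 C : R, 0 <= C &
  forall f, approximable (2 ^ k.+1).-1 f ->
  (forall x y, exponents f x -> exponents f y -> x < y -> x + delta <= y) ->
  (forall j, finite_set (dyadic_exponents f j)) ->
  forall K, unif_int (fun x => cmod (f x) ^+ (2 ^ k.+1)) K ->
  forall J, unif_int (fun x => (bigmax (iota 0 J) (fun j => cmod (dyadic_sum j f x))) ^+ (2 ^ k.+1)) (C * K).
Proof.
move=> d0 d1; have [C0 C00 hC] := sharp_maximal_unif k d0 d1.
exists (32 ^+ (2 ^ k.+1) * C0); first by rewrite mulr_ge0// (exprn_ge0 _ (ler0n R 32)).
move=> f af sep fin K fK J; set N := (2 ^ k.+1)%N.
(* With [J] scales only the exponents up to [2 ^+ J] matter. The kernel is adapted to this finite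
   set and so depends on [J], but the constant obtained does not. *)
have [F0 F0E] := (finite_seqP _).1 (fin J); pose F := undup F0.
have uF : uniq F := undup_uniq _.
have FE u : (u \in F) <-> dyadic_exponents f J u by rewrite mem_undup F0E.
pose Sf := \sum_(u <- F) cmod (fourier_coef f u).
have Sf0 : 0 <= Sf by apply: sumr_ge0 => u _; exact: cmod_ge0.
have N0 : (0 < N)%N by rewrite expn_gt0.
suff eps e : 0 < e -> unif_int (fun x => (bigmax (iota 0 J) (fun j => cmod (dyadic_sum j f x))) ^+ N) (32 ^+ N * C0 * K + e).
  by move=> x; apply/lee_addgt0Pr => e /eps /(_ x); rewrite EFinD.
move=> e0.
have [eta eta0 etae] := small_scale (exprn_ge0 N (ler0n R 2)) e0 N0.
pose m := (Num.bound (2 * Sf / eta)).+1.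
have m0 : 0 < m%:R :> R by rewrite ltr0n.
have meta : 2 * Sf / m%:R <= eta.
  rewrite ler_pdivrMr// [leRHS]mulrC -ler_pdivrMr// /m -natr1.
  have := archi_boundP (divr_ge0 (mulr_ge0 (ler0n R 2) Sf0) (ltW eta0)); lra.
have [s [b0 [b00 cB kB]]] := fejer_kernel F (ltn0Sn _ : (0 < m)%N).
set B := energy s in cB kB.
have fB := bochner_fourier b00 cB (fun x => sqr_ge0 (cmod (tsum s x))) (tsum_energy s) af fK.
have [n [l [c [gap tE sE]]]] := sorted_spectrum uF FE B sep.
have cN t : continuous (fun x => cmod (tsum t x) ^+ N) by have [] := bcontX N (bcont_cmod_tsum t).
have eN u : (u ^+ 2) ^+ (2 ^ k) = u ^+ N :> R by rewrite -exprM -expnS.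
have pB : unif_le (fun x => (cmod (tsum (tpoly n.+1 l c) x) ^+ 2) ^+ (2 ^ k)) ((16 * b0) ^+ N * K).
  under eq_fun do rewrite eN; apply/unif_int_continuous; first exact: cN.
  by under eq_fun do rewrite tE.
have := hC _ _ _ gap _ pB J.
pose M x := bigmax (iota 0 J) (fun j => cmod (sharp n.+1 l c j x)).
have bM : bcont M.
  apply: bcont_bigmax => j; have := bcont_cmod_tsum (tpoly n.+1 l (fun i => if `|l i| <= 2 ^+ j then c i else 0)).
  congr bcont; apply/funext => x; rewrite tpolyE /sharp [in RHS]big_mkcond /=; congr cmod.
  by apply: eq_bigr => i _; case: ifP; rewrite ?mul0r.
have [cM _] := bcontX N bM.
have -> : (fun x => bigmax (iota 0 J) (fun j => cmod (sharp n.+1 l c j x) ^+ 2) ^+ (2 ^ k)) = (fun x => M x ^+ N).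
  by apply/funext => x; rewrite -bigmax_sqr ?eN// => j; exact: cmod_ge0.
move=> /(unif_int_continuous _ cM) uM.
have mM := continuous_measurable cM.
have M0 x : 0 <= M x := bigmax_ge0 _ _.
(* On [F] the quotients [coef B u / b0] are within [2 / m] of 1, so the sharp sums of the
   Bochner-Fejer polynomial, divided by [b0], miss those of [f] by at most [2 * Sf / m]. *)
have pt x : bigmax (iota 0 J) (fun j => cmod (dyadic_sum j f x)) <= M x / b0 + 2 * Sf / m%:R.
  have r0 : 0 <= 2 * Sf / m%:R by rewrite divr_ge0 ?mulr_ge0// ltW.
  apply: bigmax_seq_le => [|j]; first by rewrite addr_ge0// divr_ge0// ltW.
  rewrite mem_iota add0n /= => jlt; have jJ := ltnW jlt.
  rewrite -(ler_pM2r b00) mulrDl divfK ?lt0r_neq0// -[X in cmod _ * X]ger0_norm ?(ltW b00)// -cmodC -cmodM.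
  have -> : dyadic_sum j f x * b0%:C = sharp n.+1 l c j x -
      \sum_(u <- F | `|u| <= 2 ^+ j) fourier_coef f u * (coef B u - b0%:C) * cis (u * x).
    rewrite (dyadic_sumE uF FE)// sE// mulr_suml -sumrB; apply: eq_bigr => u _; ring.
  apply: le_trans (cmodB _ _) _; apply: lerD.
    by apply: (le_bigmax_in (fun j => cmod (sharp n.+1 l c j x))); rewrite mem_iota.
  apply: le_trans (cmod_sum _ _ _) _.
  have -> : 2 * Sf / m%:R * b0 = \sum_(u <- F) cmod (fourier_coef f u) * (2 / m%:R * b0).
    by rewrite -mulr_suml -/Sf; field; rewrite lt0r_neq0.
  rewrite big_mkcond /= big_seq [leRHS]big_seq; apply: ler_sum => u uFu.
  case: ifP => _; last by rewrite mulr_ge0 ?cmod_ge0// mulr_ge0 ?divr_ge0// ltW.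
  by rewrite !cmodM cmod_cis mulr1 ler_wpM2l ?cmod_ge0//; exact: kB.
have D0 x : 0 <= bigmax (iota 0 J) (fun j => cmod (dyadic_sum j f x)) := bigmax_ge0 _ _.
have mD : measurable_fun [set: R] (fun x => bigmax (iota 0 J) (fun j => cmod (dyadic_sum j f x)) ^+ N).
  by have [+ _] := bcontX N (bcont_dyadic_max (iota 0 J) fin); exact: continuous_measurable.
pose g x := 2 ^+ N * ((b0^-1) ^+ N * M x ^+ N + eta ^+ N).
have K0 : 0 <= K by apply: unif_int_ge0 fK => x; rewrite exprn_ge0 ?cmod_ge0.
have ug : unif_int g (2 ^+ N * ((b0^-1) ^+ N * (C0 * ((16 * b0) ^+ N * K)) + eta ^+ N)).
  have bi : 0 <= b0^-1 ^+ N by rewrite exprn_ge0// invr_ge0 ltW.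
  have ei : 0 <= eta ^+ N by rewrite exprn_ge0// ltW.
  have m1 : measurable_fun [set: R] (fun x => b0^-1 ^+ N * M x ^+ N) by apply: measurable_funM.
  apply: unif_int_scale.
  - exact: exprn_ge0.
  - exact: measurable_funD.
  - by move=> x; rewrite addr_ge0// mulr_ge0// exprn_ge0.
  apply: unif_int_add => //.
  - by move=> x; rewrite mulr_ge0// exprn_ge0.
  - by apply: unif_int_scale => // x; rewrite exprn_ge0.
  - exact: unif_int_cst.
apply: (@unif_int_mono _ _ g) => //.
- apply: measurable_funM => //; apply: measurable_funD => //; apply: measurable_funM => //.
- by move=> x; rewrite exprn_ge0.
- move=> x; apply: (@le_trans _ _ ((M x / b0 + eta) ^+ N)).
    have r1 : 0 <= M x / b0 by rewrite divr_ge0// ltW.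
    rewrite lerXn2r ?nnegrE ?addr_ge0// ?(ltW eta0)//; apply: le_trans (pt x) _; rewrite lerD2l; exact: meta.
  rewrite /g mulrC -exprMn; apply: exprD_le; last exact: ltW.
  by rewrite mulr_ge0// invr_ge0 ltW.
apply: unif_int_le ug.
have alg (u v w e' : R) : 2 ^+ N * e' <= e -> u * v = 1 -> 2 ^+ N * (u * (C0 * (16 ^+ N * v * w)) + e') <= 32 ^+ N * C0 * w + e.
  move=> h1 h2; have -> : 32 ^+ N = 2 ^+ N * 16 ^+ N :> R by rewrite -exprMn -natrM.
  have -> : u * (C0 * (16 ^+ N * v * w)) = (u * v) * (16 ^+ N * C0 * w) by ring.
  by rewrite h2 mul1r mulrDr !mulrA lerD2l.
rewrite exprMn; apply: alg => //.
by rewrite -exprMn mulVf ?expr1n// lt0r_neq0.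
Qed.

End Assembly.

(** * Separation of the exponents *)

Section Separation.
Variable R : realType.
Local Notation Rc := (R[i]).
Implicit Types (x y : R) (f : R -> Rc) (s : seq (R * Rc)).

Lemma separated_lt f a x y : separated_by f a -> 0 < a -> exponents f x -> exponents f y -> x < y -> x + a < y.
Proof.
move=> [D [lam [[DE mono sym img] gap]]] a0.
rewrite -img => -[m Dm <-] [n Dn <-] xy.
have mn : m < n.
  rewrite ltNge; apply/negP; rewrite le_eqVlt => /predU1P[nm|nm].
    by rewrite nm ltxx in xy.
  by have := lt_trans xy (mono _ _ Dn Dm nm); rewrite ltxx.
have Dm1 : D (m + 1).
  case: DE Dm Dn => [-> //|[N ->]] /=; rewrite !ler_norml => /andP[h1 h2] /andP[h3 h4].
  apply/andP; split; last by apply: le_trans h4; rewrite -ltzD1 ltrD2r.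
  by apply: le_trans h1 _; rewrite lerDl.
have g := gap _ Dm Dm1.
have : lam (m + 1) <= lam n.
  have : m + 1 <= n by rewrite -ltzD1 ltrD2r.
  by rewrite le_eqVlt => /predU1P[->//|h]; exact: ltW (mono _ _ Dm1 Dn h).
lra.
Qed.

(** The integer part of [(x + b) / a] is injective on [A], since two points in one cell of length
    [a] would violate the separation. [h] picks the point of a cell, and only finitely many cells
    meet the bounded range. *)
Lemma finite_separated (A : set R) (a b : R) : 0 < a -> 0 <= b ->
  (forall x y, A x -> A y -> x < y -> x + a < y) -> (forall x, A x -> `|x| <= b) -> finite_set A.
Proof.
move=> a0 b0 sep bd.
pose g x := Num.trunc ((x + b) / a).
pose h i := xget 0 (A `&` [set x | g x = i]).
have gP x : A x -> (g x)%:R <= (x + b) / a < (g x).+1%:R.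
  move=> /bd; rewrite ler_norml => /andP[h1 _]; apply: truncn_itv.
  by apply: divr_ge0; [lra|exact: ltW].
have close x y : A x -> A y -> g x = g y -> ~ x < y.
  move=> Ax Ay gxy xy; suff: y < y by rewrite ltxx.
  have := sep _ _ Ax Ay xy; have /andP[p1 _] := gP _ Ax; have /andP[_ p2] := gP _ Ay.
  move: p1 p2; rewrite gxy ler_pdivlMr// ltr_pdivrMr// -natr1 mulrDl mul1r; lra.
apply: (@sub_finite_set _ _ (h @` `I_((Num.trunc (2 * b / a)).+1))); last by apply: finite_image; exact: finite_II.
move=> x Ax; exists (g x).
  rewrite /= ltnS; apply: le_truncn; rewrite ler_pM2r ?invr_gt0//.
  by have := bd _ Ax; rewrite ler_norml => /andP[_]; lra.
have [Ay gy] : (A `&` [set y | g y = g x]) (h (g x)) by exact: (@xgetI _ 0 (A `&` [set y | g y = g x]) x).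
by apply/eqP; rewrite eq_le !leNgt; apply/andP; split; apply/negP; apply: close.
Qed.

End Separation.

(** * Stepanov norms *)

Section Norms.
Variable R : realType.
Local Notation Rc := (R[i]).
Local Notation mu := (@lebesgue_measure R).
Implicit Types (x y : R) (f h : R -> Rc).

Definition sup_int (g : R -> R) : \bar R :=
  ereal_sup [set (\int[mu]_(s in `[x, (x + 1)%R]) (g s)%:E)%E | x in [set: R]].

Lemma sup_int_unif (g : R -> R) K : (sup_int g <= K%:E)%E <-> unif_int g K.
Proof.
split=> [h x|h].
  by apply: le_trans h; apply: ereal_sup_ubound; exists x.
by apply: ge_ereal_sup => _ [x _ <-]; exact: h.
Qed.

Lemma sup_int_ge0 (g : R -> R) : (forall x, 0 <= g x) -> (0 <= sup_int g)%E.
Proof.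
move=> g0; apply: (@le_trans _ _ (\int[mu]_(s in `[0%R, (0 + 1)%R]) (g s)%:E)%E).
  by apply: integral_ge0 => s _; rewrite lee_fin.
by apply: ereal_sup_ubound; exists 0.
Qed.

Lemma powR_2X (u : R) k : 0 <= u -> u `^ (2 ^+ k) = u ^+ (2 ^ k).
Proof. by move=> u0; rewrite -natrX powR_mulrn. Qed.

Lemma stepanov_normE k h :
  stepanov_norm (2 ^+ k) h = (sup_int (fun x => cmod (h x) ^+ (2 ^ k))%R `^ (2 ^+ k)^-1)%E.
Proof.
rewrite /stepanov_norm /stepanov_enorm /sup_int; congr (ereal_sup _ `^ _)%E.
apply/seteqP; split=> _ [x _ <-]; exists x => //; apply: eq_integral => s _;
  by rewrite /= ger0_norm ?cmod_ge0// powR_2X ?cmod_ge0.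
Qed.

Lemma cmodX_ge0 h N x : 0 <= cmod (h x) ^+ N. Proof. by rewrite exprn_ge0 ?cmod_ge0. Qed.

Lemma stepanov_norm_lt k h (e : R) : (stepanov_norm (2 ^+ k) h < e%:E)%E ->
  unif_int (fun x => cmod (h x) ^+ (2 ^ k)) (e ^+ (2 ^ k)).
Proof.
rewrite stepanov_normE => he; apply/sup_int_unif.
set S := sup_int _ in he *; have S0 : (0 <= S)%E by apply: sup_int_ge0 => x; exact: cmodX_ge0.
have p0 : 0 < 2 ^+ k :> R by rewrite exprn_gt0.
have e0 : 0 <= e by rewrite -lee_fin; apply: le_trans (ltW he); exact: poweR_ge0.
rewrite -(poweRe1 S0) -[X in (S `^ X)%E](mulVf (lt0r_neq0 p0)) poweRrM -(powR_2X _ e0) -poweR_EFin.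
apply: gt0_ler_poweR; [exact: ltW|..|exact: ltW]; rewrite in_itv /= leey andbT//.
exact: poweR_ge0.
Qed.

Lemma stepanov_enorm_le k (g : R -> \bar R) (K : R) : 0 <= K ->
  (forall x, (\int[mu]_(s in `[x, (x + 1)%R]) (`|g s| `^ (2 ^+ k)) <= K%:E)%E) ->
  (stepanov_enorm (2 ^+ k) g <= (K `^ (2 ^+ k)^-1)%:E)%E.
Proof.
move=> K0 gK; rewrite /stepanov_enorm -poweR_EFin; apply: gt0_ler_poweR.
- by rewrite invr_ge0 exprn_ge0.
- rewrite in_itv /= leey andbT; apply: (@le_trans _ _ (\int[mu]_(s in `[0%R, (0 + 1)%R]) (`|g s| `^ (2 ^+ k)))%E).
    by apply: integral_ge0 => s _; exact: poweR_ge0.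
  by apply: ereal_sup_ubound; exists 0.
- by rewrite in_itv /= leey andbT lee_fin.
by apply: ge_ereal_sup => _ [x _ <-]; exact: gK.
Qed.

Lemma trig_polyP f : trig_poly f -> exists s, f = tsum s.
Proof.
move=> [N [c [lam fE]]]; exists [seq (lam n, c n) | n <- index_enum 'I_N].
by apply/funext => x; rewrite fE /tsum big_map.
Qed.

Lemma stepanov_approximable k f : stepanov_space (2 ^+ k) f -> approximable (2 ^ k).-1 f.
Proof.
move=> [mf h]; split=> // eta /h [P /trig_polyP[s ->] /stepanov_norm_lt].
by exists s; rewrite /close prednK ?expn_gt0.
Qed.

Lemma approximable_finite k f : approximable (2 ^ k).-1 f ->
  exists K, unif_int (fun x => cmod (f x) ^+ (2 ^ k)) K.
Proof.
move=> [mf /(_ 1 ltr01) [s]]; rewrite /close prednK ?expn_gt0// => cs.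
have ms := cmeasurable_tsum s.
have [_ [M hM]] := bcontX (2 ^ k) (bcont_cmod_tsum s).
have us : unif_int (fun x => cmod (tsum s x) ^+ (2 ^ k)) M.
  apply: (@unif_int_mono _ _ (fun=> M)) => //; last exact: unif_int_cst.
  - exact: cmod_pow_measurable.
  - by move=> x; exact: cmodX_ge0.
  - by move=> x; exact: le_trans (ler_norm _) (hM x).
exists (2 ^+ (2 ^ k) * (1 ^+ (2 ^ k) + M)).
apply: (@unif_int_pow_add _ _ (tsum s) f _ _ _ (cmeasurableB mf ms) ms mf) => // x.
by have -> : f x = (f x - tsum s x) + tsum s x; [ring|rewrite addrK; exact: cmodD].
Qed.

(** The power is increasing on nonnegative extended reals, so it commutes with the supremum. Finite
    maxima form a nondecreasing sequence, ready for monotone convergence. *)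
Lemma maximal_lim k f (s : R) : ((`|dyadic_maximal f s| `^ (2 ^+ k))%E =
  limn (fun J => (bigmax (iota 1 J) (fun j => cmod (dyadic_sum j f s)) ^+ (2 ^ k))%:E)).
Proof.
set v := fun j => cmod (dyadic_sum j f s).
pose m J := bigmax (iota 1 J) v; have m0 J : 0 <= m J := bigmax_ge0 _ _.
have mhomo : {homo (fun J => (m J ^+ (2 ^ k))%:E) : n p / (n <= p)%N >-> (n <= p)%E}.
  move=> n p np; rewrite lee_fin lerXn2r ?nnegrE//; apply: bigmax_seq_le => // j.
  rewrite mem_iota => /andP[j1 jn]; apply: le_bigmax_in; rewrite mem_iota j1 /=.
  by apply: leq_trans jn _; rewrite leq_add2l.
rewrite (cvg_lim _ (ereal_nondecreasing_cvgn mhomo))//.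
have D0 : (0 <= dyadic_maximal f s)%E.
  by apply: (@le_trans _ _ (v 1%N)%:E); [rewrite lee_fin cmod_ge0|apply: ereal_sup_ubound; exists 1%N].
have p0 : 0 < 2 ^+ k :> R by rewrite exprn_gt0.
have i0 : 0 <= (2 ^+ k)^-1 :> R by rewrite invr_ge0 ltW.
rewrite gee0_abs//; apply/eqP; rewrite eq_le; apply/andP; split; last first.
  apply: ge_ereal_sup => _ [J _ <-]; rewrite -powR_2X// -poweR_EFin.
  apply: gt0_ler_poweR; [exact: ltW|by rewrite in_itv /= leey andbT lee_fin|by rewrite in_itv /= leey andbT|].
  (* The induction carries along that all indices in the list are positive, because the supremum in
     [dyadic_maximal] starts at [j = 1]. *)
  rewrite /m; elim: {J}(iota 1 J) (fun j (h : j \in iota 1 J) => proj1 (andP (etrans (esym (mem_iota 1 J j)) h))) => [_|j r ih h].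
    by rewrite /bigmax big_nil.
  rewrite bigmax_cons EFin_max ge_max ih ?andbT; last by move=> i ir; apply: h; rewrite inE ir orbT.
  by apply: ereal_sup_ubound; exists j => //; apply: h; rewrite inE eqxx.
set L := ereal_sup _; have Ljub J : ((m J ^+ (2 ^ k))%:E <= L)%E by apply: ereal_sup_ubound; exists J.
have L0 : (0 <= L)%E by apply: le_trans (Ljub 0%N); rewrite lee_fin exprn_ge0.
rewrite -[leRHS](poweRe1 L0) -[X in (_ <= L `^ X)%E](mulVf (lt0r_neq0 p0)) poweRrM.
apply: gt0_ler_poweR; [exact: ltW|by rewrite in_itv /= leey andbT|by rewrite in_itv /= leey andbT poweR_ge0|].
apply: ge_ereal_sup => _ [j /= j0 <-].
have : ((m j ^+ (2 ^ k))%:E `^ (2 ^+ k)^-1 <= L `^ (2 ^+ k)^-1)%E.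
  apply: gt0_ler_poweR => //; rewrite in_itv /= leey andbT// lee_fin exprn_ge0//.
apply: le_trans; rewrite -powR_2X// poweR_EFin -powRrM mulfV ?lt0r_neq0// powRr1// lee_fin.
by apply: (le_bigmax_in v); rewrite mem_iota j0 add1n ltnS leqnn.
Qed.

Lemma maximal_int k f K : (forall j, finite_set (dyadic_exponents f j)) ->
  (forall J, unif_int (fun x => (bigmax (iota 0 J) (fun j => cmod (dyadic_sum j f x))) ^+ (2 ^ k)) K) ->
  forall x, (\int[mu]_(s in `[x, (x + 1)%R]) (`|dyadic_maximal f s| `^ (2 ^+ k)) <= K%:E)%E.
Proof.
move=> fin fK x; under eq_integral do rewrite maximal_lim.
pose v s j := cmod (dyadic_sum j f s).
have mG r : measurable_fun [set: R] (fun s => bigmax r (v s) ^+ (2 ^ k)).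
  by have [+ _] := bcontX (2 ^ k) (bcont_dyadic_max r fin); exact: continuous_measurable.
have g0 r s : 0 <= bigmax r (v s) ^+ (2 ^ k) by rewrite exprn_ge0 ?bigmax_ge0.
have sub r r' s : {subset r <= r'} -> bigmax r (v s) ^+ (2 ^ k) <= bigmax r' (v s) ^+ (2 ^ k).
  move=> rr'; rewrite lerXn2r ?nnegrE ?bigmax_ge0//; apply: bigmax_seq_le => [|j /rr']; first exact: bigmax_ge0.
  exact: le_bigmax_in.
rewrite monotone_convergence//; last 3 first.
- by move=> J; exact: measurable_funE (mG _).
- by move=> J s _; rewrite lee_fin; exact: g0.
- move=> s _ n p np; rewrite lee_fin; apply: sub => j; rewrite !mem_iota => /andP[-> jn] /=.
  by apply: leq_trans jn _; rewrite leq_add2l.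
apply: lime_le.
  apply: ereal_nondecreasing_is_cvgn => n p np; apply: ge0_le_integral => //.
  - by move=> s _; rewrite lee_fin; exact: g0.
  - exact: measurable_funE (mG _).
  - exact: measurable_funE (mG _).
  - move=> s _; rewrite lee_fin; apply: sub => j; rewrite !mem_iota => /andP[-> jn] /=.
    by apply: leq_trans jn _; rewrite leq_add2l.
(* The bound [fK] includes the scale [j = 0], so the maximum over [1, ..., J] is dominated by the
   one over [0, ..., J]. *)
near=> J; apply: le_trans (fK J.+1 x); apply: ge0_le_integral => //.
- by move=> s _; rewrite lee_fin; exact: g0.
- exact: measurable_funE (mG _).
- exact: measurable_funE (mG _).
- move=> s _; rewrite lee_fin; apply: sub => j; rewrite !mem_iota add0n add1n => /andP[_ ->] //.
Unshelve. all: by end_near.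
Qed.

End Norms.

(** * Trigonometric polynomials *)

Section TrigPoly.
Variable R : realType.
Local Notation Rc := (R[i]).
Implicit Types (x y : R) (f : R -> Rc) (s : seq (R * Rc)) (L : seq R).

Lemma close_refl n (eta : R) s : 0 < eta -> close n eta (tsum s) s.
Proof.
move=> e0; apply: (@unif_int_le _ _ 0); first by rewrite exprn_ge0// ltW.
by under eq_fun do rewrite subrr cmod0 expr0n; exact: unif_int_cst.
Qed.

Lemma tsum_approximable n s : approximable n (tsum s).
Proof.
split; first exact: cmeasurable_tsum.
by move=> eta e0; exists s; exact: close_refl.
Qed.

Lemma fourier_coef_tsum s l : fourier_coef (tsum s) l = coef s l.
Proof.
apply/eqP; rewrite -subr_eq0; apply/eqP/cmod_eq0/eqP; rewrite eq_le cmod_ge0 andbT.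
apply/ler_addgt0Pr => e e0; rewrite add0r.
have e1 : 0 < e / 12 by rewrite divr_gt0.
have := fourier_coef_close l (tsum_approximable 0 s) e1 (close_refl 0 s e1); lra.
Qed.

Lemma coef_notin s l : l \notin [seq p.1 | p <- s] -> coef s l = 0.
Proof.
elim: s => [|p s ih]; first by rewrite coef_nil.
by rewrite /= inE negb_or coef_cons eq_sym => /andP[/negPf -> /ih ->]; rewrite addr0.
Qed.

Lemma tsum_stepanov k s : stepanov_space (2 ^+ k) (tsum s).
Proof.
split=> [|e e0]; first exact: cmeasurable_tsum.
exists (tsum s).
  exists (size s), (fun i => (nth (0, 0) s i).2), (fun i => (nth (0, 0) s i).1) => x.
  by rewrite /tsum (big_nth (0, 0)) big_mkord.
rewrite stepanov_normE; have -> : (fun x => cmod (tsum s x - tsum s x) ^+ (2 ^ k)) = (fun=> 0).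
  by apply/funext => x; rewrite subrr cmod0 expr0n expn_eq0.
apply: (@le_lt_trans _ _ (0 `^ (2 ^+ k)^-1)%E); last first.
  by rewrite poweR_EFin powR0 ?lte_fin// invr_neq0// lt0r_neq0// exprn_gt0.
have s0 : (0 <= sup_int (fun=> 0%R : R))%E by exact: sup_int_ge0.
apply: gt0_ler_poweR; [by rewrite invr_ge0 exprn_ge0|by rewrite in_itv /= leey andbT|by rewrite in_itv /= leey andbT|].
by apply/sup_int_unif; exact: unif_int_cst.
Qed.

Lemma min_gap L : exists2 a : R, 0 < a & forall x y, x \in L -> y \in L -> x < y -> a < y - x.
Proof.
have [a a0 aP] : exists2 a : R, 0 < a & forall d, d \in [seq y - x | x <- L, y <- L] -> 0 < d -> a < d.
  elim: [seq _ | x <- L, y <- L] => [|d l [a a0 aP]]; first by exists 1.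
  exists (if 0 < d then Num.min a (d / 2) else a).
    by case: ifP => // d0; rewrite lt_min a0 divr_gt0.
  move=> e; rewrite inE => /predU1P[->|el] e0.
    by rewrite e0; apply: (@le_lt_trans _ _ (d / 2)); [rewrite ge_min lexx orbT|lra].
  apply: le_lt_trans (aP e el e0); case: ifP => // _; by rewrite ge_min lexx.
exists a => // x y xL yL xy; apply: aP; last by rewrite subr_gt0.
by apply/allpairsP; exists (x, y).
Qed.

(** The exponents lie in a finite symmetric set: the positive ones are sorted after [0], the
    enumeration is reflected, and the least gap of the finite set serves as separation. *)
Lemma tsum_separation s : separation_condition (tsum s).
Proof.
pose ex := exponents (tsum s).
have exN u : ex u -> ex (- u).
  by move=> [-> |[h|h]]; [left; rewrite oppr0|right; right; rewrite opprK|right; left].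
pose L0 := [seq p.1 | p <- s].
have exL u : ex u -> u \in 0 :: L0 ++ [seq - v | v <- L0].
  move=> [->|h]; first by rewrite inE eqxx.
  rewrite inE mem_cat; case: h; rewrite fourier_coef_tsum => h.
    have -> : u \in L0 by apply: contraT => /coef_notin c; rewrite c eqxx in h.
    by rewrite orbT.
  have uL : - u \in L0 by apply: contraT => /coef_notin c; rewrite c eqxx in h.
  by rewrite (_ : u \in [seq - v | v <- L0]) ?orbT//; apply/mapP; exists (- u); rewrite ?opprK.
pose P := sort <=%R [seq u <- undup (0 :: L0 ++ [seq - v | v <- L0]) | `[<ex u>] && (0 < u)].
have PE u : (u \in P) = `[<ex u>] && (0 < u).
  rewrite mem_sort mem_filter mem_undup; case: asboolP => //= /exL ->; exact: andbT.
have sP : sorted <%R (0 :: P).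
  have : sorted <%R P by rewrite sort_lt_sorted filter_uniq// undup_uniq.
  have : all (fun u => 0 < u) P by apply/allP => u; rewrite PE => /andP[].
  by case: (P) => //= u r /andP[-> _].
pose N := size P; pose g := nth 0 (0 :: P).
have gm i j : (i < j)%N -> (j <= N)%N -> g i < g j.
  move=> ij jN; apply: (sorted_ltn_nth lt_trans 0 sP) => //; rewrite inE /= ltnS//.
  exact: leq_trans (ltnW ij) jN.
have g0 : g 0%N = 0 by [].
have gS i : (i < N)%N -> ex (g i.+1) /\ 0 < g i.+1.
  by move=> iN; have := mem_nth 0 iN; rewrite PE => /andP[/asboolP].
have gex i : (i <= N)%N -> ex (g i) by case: i => [_|i /gS[]//]; left.
pose lam (n : int) : R := match n with Posz i => g i | Negz i => - g i.+1 end.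
pose D := [set n : int | `|n| <= N%:Z].
have DP i : D (Posz i) = ((i <= N)%N : Prop) by rewrite /D /= lez_nat.
have DN i : D (Negz i) = ((i < N)%N : Prop) by [].
have lamE : lam @` D = ex.
  apply/seteqP; split=> [_ [[i|i] Di <-] /=|u eu].
  - by apply: gex; rewrite -DP.
  - by apply: exN; apply: gex; rewrite DN in Di.
  have [u0|u0|u0] := ltgtP u 0.
  - have uP : - u \in P by rewrite PE oppr_gt0 u0 andbT; apply/asboolP/exN.
    exists (Negz (index (- u) P)); first by rewrite DN index_mem.
    by rewrite /lam /g /= nth_index// opprK.
  - have uP : u \in P by rewrite PE u0 andbT; apply/asboolP.
    by exists (Posz (index u P).+1); [rewrite DP index_mem|rewrite /lam /g /= nth_index].
  - by exists (Posz 0); rewrite ?DP// u0.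
have mono m n : D m -> D n -> m < n -> lam m < lam n.
  case: m n => [i|i] [j|j]; rewrite ?DP ?DN => Di Dj.
  - by rewrite ltz_nat => ij; exact: gm.
  - by [].
  - move=> _ /=; have [_ h1] := gS _ Di.
    have : 0 <= g j by case: (j) Dj => [//|j' /gS[_ /ltW]].
    lra.
  - by move=> ji; rewrite /lam ltrN2; apply: gm.
have [a a0 aP] := min_gap (0 :: L0 ++ [seq - v | v <- L0]).
exists a => //; exists D, lam; split.
  split=> //; first by right; exists N.
  move=> [[|i]|i] Di; rewrite /lam /=.
  - by rewrite g0 oppr0.
  - by [].
  - by rewrite opprK.
move=> n Dn Dn1; apply: aP; [| |by apply: mono => //; rewrite ltzD1].
  by apply: exL; rewrite -lamE; exists n.
by apply: exL; rewrite -lamE; exists (n + 1).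
Qed.

End TrigPoly.

Theorem theorem1p2 (R : realType) (k : nat) (hk : (0 < k)%N) :
  (forall f : R -> R[i], trig_poly f ->
     stepanov_space (2 ^+ k) f /\ separation_condition f) /\
  (exists C : \bar R -> R, forall f : R -> R[i],
     stepanov_space (2 ^+ k) f -> separation_condition f ->
     [/\ forall l : R, cvg (fourier_mean f l T @[T --> +oo]),
         forall j : nat, (0 < j)%N -> finite_set (dyadic_exponents f j)
       & (stepanov_enorm (2 ^+ k) (dyadic_maximal f) <=
          (C (separation_constant f))%:E * stepanov_norm (2 ^+ k) f)%E]).
Proof.
split=> [f /trig_polyP[s ->]|]; first by split; [exact: tsum_stepanov|exact: tsum_separation].
case: k hk => // k _.
(* The constants are selected by choice for all [delta] at once, before [f] is given, so that the
   final constant is a function of [separation_constant f] alone. Outside [0 < delta <= 1] the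
   statement is void and [0] is taken. *)
pose bound (delta : R) (C : R) := 0 < delta -> delta <= 1 -> 0 <= C /\
  forall f, approximable (2 ^ k.+1).-1 f ->
  (forall x y, exponents f x -> exponents f y -> x < y -> x + delta <= y) ->
  (forall j, finite_set (dyadic_exponents f j)) ->
  forall K, unif_int (fun x => cmod (f x) ^+ (2 ^ k.+1)) K ->
  forall J, unif_int (fun x => (bigmax (iota 0 J) (fun j => cmod (dyadic_sum j f x))) ^+ (2 ^ k.+1)) (C * K).
have [C0 C0P] : {C0 : R -> R & forall delta, bound delta (C0 delta)}.
  apply: choice => delta; have [d0|d0] := pselect (0 < delta); last by exists 0 => /d0.
  have [d1|d1] := pselect (delta <= 1); last by exists 0 => _ /d1.
  by have [C C0 hC] := dyadic_max_unif k d0 d1; exists C.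
(* Half of the separation constant, as its supremum may not be attained: [delta al < al] yields an
   admissible separation above [delta al]. The cap 1 meets the requirement [delta <= 1] and gives
   the value at [+oo]. *)
pose delta (al : \bar R) : R := match al with r%:E => Num.min 1 (r / 2) | _ => 1 end.
exists (fun al => C0 (delta al) `^ (2 ^+ k.+1)^-1) => f sf [a a0 fa].
have af := stepanov_approximable sf.
have fin j : finite_set (dyadic_exponents f j).
  apply: (finite_separated a0 (exprn_ge0 j (ler0n R 2))).
  - by move=> x y [ex _] [ey _]; exact: separated_lt fa a0 ex ey.
  - by move=> x [].
split=> [l|j _|]; [exact: fourier_mean_cvg af|exact: fin|].
set al := separation_constant f.
have aal b : 0 < b -> separated_by f b -> (b%:E <= al)%E.
  by move=> b0 fb; apply: ereal_sup_ubound; exists b.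
have al0 : (0 < al)%E by apply: lt_le_trans (aal _ a0 fa).
have [d0 d1 [b bd [b0 fb]]] : [/\ 0 < delta al, delta al <= 1 & exists2 b, delta al <= b & 0 < b /\ separated_by f b].
  have gt (u : R) : (u%:E < al)%E -> exists2 b, u <= b & 0 < b /\ separated_by f b.
    by move=> /ereal_sup_gt[_ [b hb <-]]; rewrite lte_fin => /ltW; exists b.
  move: gt al0; rewrite /delta; case: (al) => [r| |] gt //; last first.
    by move=> _; split=> //; apply: gt; rewrite ltry.
  rewrite lte_fin => r0; split; first by rewrite lt_min ltr01 divr_gt0.
    by rewrite ge_min lexx.
  apply: gt; rewrite lte_fin; apply: (@le_lt_trans _ _ (r / 2)); last lra.
  by rewrite ge_min lexx orbT.
have [C00 hC] := C0P _ d0 d1.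
have sep x y : exponents f x -> exponents f y -> x < y -> x + delta al <= y.
  by move=> ex ey xy; have := separated_lt fb b0 ex ey xy; lra.
have [K fK] := approximable_finite af.
have S0 : (0 <= sup_int (fun x => cmod (f x) ^+ (2 ^ k.+1))%R)%E.
  by apply: sup_int_ge0 => x; exact: cmodX_ge0.
have : sup_int (fun x => cmod (f x) ^+ (2 ^ k.+1)) \is a fin_num.
  rewrite ge0_fin_numE//; apply: le_lt_trans (ltry K); exact/sup_int_unif.
move=> /fineK; set L := fine _ => LE.
have fL : unif_int (fun x => cmod (f x) ^+ (2 ^ k.+1)) L by apply/sup_int_unif; rewrite LE.
have L0 : 0 <= L by rewrite -lee_fin LE.
have := maximal_int fin (hC f af sep fin L fL) => /(stepanov_enorm_le (mulr_ge0 C00 L0)).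
by rewrite powRM// EFinM -poweR_EFin -[X in (_ * X)%E]poweR_EFin LE -stepanov_normE.
Qed.
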